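(* Assume that $\mathrm{U}$ is convex and let $x^1\in\mathbb{R}^n$ be a target point that is $L^\infty_{\mathrm U}$-reachable in time $T$ from $x^0$ with a control $u\in L^\infty([0,T],\mathrm{U})$ (that is, $u\in\mathcal{U}\cap L^\infty([0,T],\mathrm{U})$ and $x_u(T)=x^1$). If $u$ is weakly $\mathrm{U}$-regular, then there exists a threshold $\delta>0$ such that $x^1$ is $\mathrm{PC}^{\mathbb T}_{\mathrm U}$-reachable in time $T$ from $x^0$ for any partition $\mathbb{T}$ of $[0,T]$ satisfying $\Vert\mathbb{T}\Vert\le\delta$.
   Context: Fix integers $n,m\ge 1$, a real number $T>0$, a point $x^0\in\mathbb{R}^n$, a nonempty set $\mathrm{U}\subset\mathbb{R}^m$, and a continuous map $f:\mathbb{R}^n\times\mathbb{R}^m\times[0,T]\to\mathbb{R}^n$ of class $C^1$ with respect to its first two variables $(x,u)$ (i.e. $\nabla_x f$ and $\nabla_u f$ exist and are continuous on $\mathbb{R}^n\times\mathbb{R}^m\times[0,T]$). $L^\infty([0,T],\mathrm{U})$ is the set of elements of $L^\infty([0,T],\mathbb{R}^m)$ with values in $\mathrm{U}$ almost everywhere. A control $u\in L^\infty([0,T],\mathbb{R}^m)$ is admissible if there exists an absolutely continuous $x:[0,T]\to\mathbb{R}^n$ with $x(0)=x^0$ and $\dot x(t)=f(x(t),u(t),t)$ for a.e. $t\in[0,T]$; then $x$ is unique and denoted $x_u$. $\mathcal{U}$ is the set of admissible controls. A partition $\mathbb{T}=\{t_i\}_{i=0,\ldots,N}$ of $[0,T]$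 ($N\ge1$) consists of reals $0=t_0<t_1<\cdots<t_N=T$, and $\Vert\mathbb{T}\Vert=\max_{0\le i\le N-1}|t_{i+1}-t_i|$. $\mathrm{PC}^{\mathbb T}([0,T],\mathrm{U})$ is the set of functions $v$ such that for every $i\in\{0,\ldots,N-1\}$ there is $v_i\in\mathrm{U}$ with $v(t)=v_i$ for all $t\in[t_i,t_{i+1})$. A point $x^1$ is $\mathrm{PC}^{\mathbb T}_{\mathrm U}$-reachable in time $T$ from $x^0$ if $x^1=x_v(T)$ for some $v\in\mathcal{U}\cap\mathrm{PC}^{\mathbb T}([0,T],\mathrm{U})$. For $u\in\mathcal{U}\cap L^\infty([0,T],\mathrm{U})$ (a representative being fixed), let $\mathcal{L}(f_u)$ be the set of Lebesgue points in $[0,T)$ of $f_u=f(x_u(\cdot),u(\cdot),\cdot)$. For $(\tau,\omega)\in\mathcal{L}(f_u)\times\mathrm{U}$, let $w^u_{(\tau,\omega)}$ be the absolutely continuous solution on $[\tau,T]$ of $\dot w(t)=\nabla_xf(x_u(t),u(t),t)w(t)$ for a.e. $t\in[\tau,T]$, $w(\tau)=f(x_u(\tau),\omega,\tau)-f(x_u(\tau),u(\tau),\tau)$. The $\mathrm{U}$-Pontryagin cone $\mathrm{Pont}_{\mathrm U}[u]$ is the smallest convex cone containing all vectors $w^u_{(\tau,\omega)}(T)$, $(\tau,\omega)\in\mathcal{L}(f_u)\times\mathrm{U}$ (i.e. the set of their finite nonnegative linear combinations). The control $u$ is weakly $\mathrm{U}$-regular if $\mathrm{Pont}_{\mathrm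 U}[u]=\mathbb{R}^n$. *)

(* Defs.v *)
From HB Require Import structures.
From mathcomp Require Import all_boot all_order all_algebra.
From mathcomp Require Import all_classical all_reals all_analysis.
Set Implicit Arguments.
Unset Strict Implicit.
Unset Printing Implicit Defensive.
Import Order.TTheory GRing.Theory Num.Theory.
Import numFieldNormedType.Exports.
Local Open Scope classical_set_scope.
Local Open Scope ring_scope.

(* Vectors of R^n are row vectors; `|.| on 'rV[R]_n is the sup norm, which is
   used only through notions that are invariant under equivalence of norms.
   Functions of time are total functions R -> 'rV[R]_n of which only the values
   on the relevant interval matter. *)

Section LebesgueMeasure.
Context {R : realType}.

(* R with the sigma-algebra of Lebesgue (not only Borel) measurable sets. *)
Definition lebesgueR : measurableType _ :=
  caratheodory_type (wlength (idfun : cumulative R R))^*%mu.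

Definition lebR : {measure set lebesgueR -> \bar R} :=
  @completed_lebesgue_measure R.

Definition ae_on (A : set R) (P : R -> Prop) : Prop :=
  \forall t \ae lebR, A t -> P t.

Definition Linfty (n : nat) (A : set R) (u : R -> 'rV[R]_n) : Prop :=
  (forall i, measurable_fun (A : set lebesgueR)
     ((fun t => u t 0 i) : lebesgueR -> measurableTypeR R)) /\
  exists M : R, ae_on A (fun t => `|u t| <= M).

(* Averages are taken over ball tau r intersected with the domain [0, T], so
   that the notion is two-sided at interior points and one-sided at 0. *)
Definition lebesgue_point (n : nat) (T : R) (g : R -> 'rV[R]_n) (tau : R) :
    Prop :=
  let B r : set lebesgueR := ball tau r `&` `[0, T] in
  ((lebR (B r))^-1 * \int[lebR]_(t in B r) (`|g t - g tau|)%:E)%E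
    @[r --> (0 : R)^'+] --> 0%E.

Definition abs_continuous (n : nat) (a b : R) (x : R -> 'rV[R]_n) : Prop :=
  forall e : R, 0 < e -> exists2 d : R, 0 < d &
    forall (k : nat) (s t : 'I_k -> R),
      (forall i, a <= s i /\ s i <= t i /\ t i <= b) ->
      trivIset [set: 'I_k] (fun i => `]s i, t i[%classic) ->
      \sum_(i < k) (t i - s i) < d ->
      \sum_(i < k) `|x (t i) - x (s i)| < e.

End LebesgueMeasure.

Section ControlSystem.
Context {R : realType} {n m : nat}.
Implicit Types (T : R) (U : set 'rV[R]_m)
  (f : 'rV[R]_n -> 'rV[R]_m -> R -> 'rV[R]_n)
  (u v : R -> 'rV[R]_m) (x w : R -> 'rV[R]_n).

Definition dynamics_domain T : set ('rV[R]_n * 'rV[R]_m * R) :=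
  [set z | z.2 \in `[0, T]].

Definition C1_dynamics T f : Prop :=
  [/\ {within dynamics_domain T, continuous (fun z => f z.1.1 z.1.2 z.2)},
      forall y o t, t \in `[0, T] -> differentiable (fun y' => f y' o t) y,
      forall y o t, t \in `[0, T] -> differentiable (fun o' => f y o' t) o,
      {within dynamics_domain T,
        continuous (fun z => 'J (fun y => f y z.1.2 z.2) z.1.1)} &
      {within dynamics_domain T,
        continuous (fun z => 'J (fun o => f z.1.1 o z.2) z.1.2)}].

Definition Linfty_in T U u : Prop :=
  Linfty `[0, T] u /\ ae_on `[0, T] (fun t => U (u t)).

(* x is "x_u"; it is unique on [0, T]. *)
Definition trajectory T (x0 : 'rV[R]_n) f u x : Prop :=
  [/\ abs_continuous 0 T x, x 0 = x0 &
      ae_on `[0, T] (fun t => is_derive t (1 : R) x (f (x t) (u t) t))].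

Definition admissible T (x0 : 'rV[R]_n) f u : Prop :=
  Linfty `[0, T] u /\ exists x, trajectory T x0 f u x.

(* For s = [:: t_1; ...; t_N], itv_partition 0 T s says that
   0 = t_0 < t_1 < ... < t_N = T, where t_i = (0 :: s)`_i. *)
Definition mesh (s : seq R) : R :=
  \big[Num.max/0]_(i < size s) `|(0 :: s)`_i.+1 - (0 :: s)`_i|.

Definition PC (s : seq R) U : set (R -> 'rV[R]_m) :=
  [set v | forall i, (i < size s)%N -> exists2 o, U o &
    forall t, (0 :: s)`_i <= t < (0 :: s)`_i.+1 -> v t = o].

Definition PC_reachable T (x0 : 'rV[R]_n) f U (s : seq R)
    (x1 : 'rV[R]_n) : Prop :=
  exists v, [/\ admissible T x0 f v, PC s U v &
    exists2 x, trajectory T x0 f v x & x T = x1].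

(* Here and below x is a trajectory of u. *)
Definition velocity f u x : R -> 'rV[R]_n := fun t => f (x t) (u t) t.

(* With row vectors, w *m 'J g y is the differential of g at y applied to w. *)
Definition variation_vector T f u x (tau : R) (o : 'rV[R]_m) w : Prop :=
  [/\ abs_continuous tau T w,
      w tau = f (x tau) o tau - f (x tau) (u tau) tau &
      ae_on `[tau, T] (fun t =>
        is_derive t (1 : R) w (w t *m 'J (fun y => f y (u t) t) (x t)))].

Definition variation_endpoints T f U u x : set 'rV[R]_n :=
  [set p | exists tau o w,
    [/\ tau \in `[0, T[, lebesgue_point T (velocity f u x) tau, U o,
        variation_vector T f u x tau o w & p = w T]].

Definition conic_hull (S : set 'rV[R]_n) : set 'rV[R]_n :=
  [set p | exists (k : nat) (c : 'I_k -> R) (q : 'I_k -> 'rV[R]_n),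
    [/\ forall i, 0 <= c i, forall i, S (q i) &
        p = \sum_(i < k) c i *: q i]].

Definition pontryagin_cone T f U u x : set 'rV[R]_n :=
  conic_hull (variation_endpoints T f U u x).

Definition weakly_regular T f U u x : Prop :=
  pontryagin_cone T f U u x = [set: 'rV[R]_n].

End ControlSystem.

(* Main.v *)
From HB Require Import structures.
Require Import Defs.
From mathcomp Require Import all_boot all_order all_algebra.
From mathcomp Require Import all_classical all_reals all_analysis.
From mathcomp Require Import measurable_realfun ring lra zify.
Set Implicit Arguments.
Unset Strict Implicit.
Unset Printing Implicit Defensive.
Import Order.TTheory GRing.Theory Num.Theory.
Import numFieldNormedType.Exports.
Local Open Scope classical_set_scope.
Local Open Scope ring_scope.

(** Why the theorem holds.

    Weak regularity provides finitely many needles (tau_j, omega_j), with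
    variation vectors w_j, and nonnegative Lipschitz functions c_j on R^n such
    that the sum of the c_j(a) w_j(T) is a, for every a ([regular_needles]).
    For a small e > 0, let omega_j replace u during a time e c_j(a) just after
    tau_j. To first order this moves the endpoint x1 to x1 + e a.

    Given a partition, u is replaced on each cell by one of its values, and the
    needles are inserted cell by cell: in a cell of which a needle covers the
    proportion theta, the constant control v is changed into
    (1 - theta) v + theta omega ([mix], [cell_weight]). This is where convexity
    of U enters. The control so obtained is piecewise constant on the given
    partition and depends continuously on a, hence so does its endpoint. For
    fixed e, as soon as the mesh is small enough, the endpoint differs from
    x1 + e a by at most e / 2 whenever |a| <= 1 ([needle_estimate]). A
    continuous map of the cube [-1, 1]^n which is e / 2-close to e a takes the
    value 0, by the theorem of Poincare and Miranda ([poincare_miranda]), so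
    that some a gives a control which steers x0 exactly to x1 ([pc_hits]).
    A topological argument is needed because the endpoint is not differentiable
    in a with the expected derivative: inside a cell partially covered by a
    needle, the dependence on theta is nonlinear.

    The deviation is estimated without integrating the velocities. If z is the
    difference of the two trajectories and p the sum of the w_j multiplied by
    the time spent so far in the j-th needle, then z - p is absolutely
    continuous and satisfies |(z - p)'| <= L |z - p| + r almost everywhere, with
    r small except on sets of small measure, and Gronwall's lemma applies
    ([gronwall]). The measure of an exceptional set is used only through the
    increments of a nondecreasing cost function that grows at least at unit
    speed on that set ([small_set]). This notion also yields the elementary fact
    behind Gronwall's lemma, that an absolutely continuous function whose slope
    is almost everywhere nonpositive does not increase ([straddle_le]). Measure
    theory itself enters at two places: a control is uniformly continuous, up to
    a given oscillation, outside a set of small measure ([lusin_osc]), and at a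
    Lebesgue point the velocity is close to its value outside a set of small
    density ([lebesgue_point_small]).

    Trajectories of piecewise constant controls are built by Picard iteration on
    each cell ([picard], [pc_ode]) for the dynamics in which the state is
    projected to a large box. The deviation estimate then shows that the
    projection is not active. *)

(** * Straddle inequalities, absolute continuity and Gronwall *)

Section Straddle.
Context {R : realType}.

(** Local properties of increments are tested on pairs s <= t <= s' around the
    point t only. Since the intervals [s, s'] tagged by t are those of Cousin's
    lemma, they can be chained into a partition; and the condition only concerns
    slopes, so that it makes sense at points without derivative. *)
Definition straddle (P : R -> R -> Prop) (t : R) : Prop :=
  exists2 d, 0 < d & forall s s', t - d < s -> s <= t -> t <= s' ->
    s' < t + d -> P s s'.

Lemma straddleW (P Q : R -> R -> Prop) t : (forall s s', P s s' -> Q s s') ->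
  straddle P t -> straddle Q t.
Proof. by move=> PQ [d d0 Pd]; exists d => // s s' *; apply/PQ/Pd. Qed.

Lemma straddleI (P Q : R -> R -> Prop) t : straddle P t -> straddle Q t ->
  straddle (fun s s' => P s s' /\ Q s s') t.
Proof.
move=> [d d0 Pd] [c c0 Qc]; exists (Num.min d c); first by rewrite lt_min d0.
move=> s s' ds st ts' s'd; split; [apply: Pd|apply: Qc] => //.
- by apply: le_lt_trans ds; rewrite lerD2l lerN2 ge_min lexx.
- by apply: lt_le_trans s'd _; rewrite lerD2l ge_min lexx.
- by apply: le_lt_trans ds; rewrite lerD2l lerN2 ge_min lexx orbT.
- by apply: lt_le_trans s'd _; rewrite lerD2l ge_min lexx orbT.
Qed.

Lemma straddle_ord (P : R -> R -> Prop) t : straddle P t ->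
  straddle (fun s s' => s <= s' /\ P s s') t.
Proof.
by move=> [d d0 Pd]; exists d => // s s' *; split; [exact: (@le_trans _ _ t)|exact: Pd].
Qed.

(** A substitute for the statement that A has outer measure at most mu in
    [a, b]. For an open set O the cost G is the measure of O up to time t. *)
Definition small_set (a b mu : R) (A : set R) : Prop :=
  exists G : R -> R, [/\ {homo G : s t / s <= t}, G b - G a <= mu &
    forall t, A t -> straddle (fun s s' => s' - s <= G s' - G s) t].

(** The formula of [abs_continuous] for functions with values in any normed
    space, so that it also applies to real functions such as norms. *)
Definition ac (V : normedZmodType R) (a b : R) (x : R -> V) : Prop :=
  forall e : R, 0 < e -> exists2 d : R, 0 < d &
    forall (k : nat) (s t : 'I_k -> R),
      (forall i, a <= s i /\ s i <= t i /\ t i <= b) ->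
      trivIset [set: 'I_k] (fun i => `]s i, t i[%classic) ->
      \sum_(i < k) (t i - s i) < d ->
      \sum_(i < k) `|x (t i) - x (s i)| < e.

(** Cousin's argument: going from a to b by intervals tagged by their points,
    the slope condition handles the tags outside N. The intervals tagged in N
    have total length less than the budget of absolute continuity, so that h1
    varies little on them. The supremum of the reachable times replaces the
    choice of a partition. Subtracting a nondecreasing phi that need not be
    absolutely continuous is harmless, and lets cost functions of small sets be
    used as phi. *)
Lemma straddle_le (a b : R) (h1 phi : R -> R) (N : set R) : a <= b ->
  ac a b h1 -> {homo phi : s t / s <= t} ->
  (forall e, 0 < e -> small_set a b e N) ->
  (forall t, a <= t <= b -> ~ N t -> forall k, 0 < k ->
    straddle (fun s s' => a <= s -> s' <= b ->
      h1 s' - phi s' - (h1 s - phi s) <= k * (s' - s)) t) ->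
  h1 b - phi b <= h1 a - phi a.
Proof.
move=> ab ach nphi sN str.
set h := fun t => h1 t - phi t.
suff main e : 0 < e -> h b - h a <= e * (b - a) + e.
  apply/ler_addgt0Pl => e e0.
  have ba1 : 0 < b - a + 1 by rewrite ltr_wpDl // subr_ge0.
  have := main (e / (b - a + 1)) (divr_gt0 e0 ba1).
  rewrite -{2}[e / _]mulr1 -mulrDr divfK ?gt_eqF //.
  by rewrite lerBlDr.
move=> e0; have [d d0 dP] := ach _ e0.
have [G [nG Gd GN]] := sN (d / 2) (divr_gt0 d0 (ltr0Sn R 1)).
(* The family (s, t) collects the intervals whose tag lies in N. *)
pose S := [set c | a <= c <= b /\ exists k (s t : 'I_k -> R),
  [/\ forall i, a <= s i /\ s i <= t i /\ t i <= c,
    trivIset [set: 'I_k] (fun i => `]s i, t i[%classic),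
    \sum_(i < k) (t i - s i) <= G c - G a &
    h c - h a <= e * (c - a) + \sum_(i < k) (h1 (t i) - h1 (s i))]].
have Sa : S a.
  split; first by rewrite lexx ab.
  exists 0%N, (fun=> 0), (fun=> 0); split; try by case.
  - by rewrite big_ord0 subrr.
  - by rewrite big_ord0 !subrr mulr0 addr0.
have Sb : ubound S b by move=> c [/andP[]].
have supS : has_sup S by split; [exists a|exists b].
set c := sup S.
have ac_ : a <= c by apply: ub_le_sup => //; case: supS.
have cb : c <= b by apply: ge_sup => //; exists a.
suff SSb : S b.
  have [_ [k [s [t [st tr Gst hb]]]]] := SSb.
  apply: (le_trans hb); rewrite lerD2l; apply/ltW.
  apply: le_lt_trans (dP k s t st tr _).
    by apply: ler_sum => i _; exact: ler_norm.
  apply: (le_lt_trans Gst); apply: (le_lt_trans Gd).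
  by rewrite ltr_pdivrMr // ltr_pMr // ltr1n.
have step r : straddle (fun s s' => a <= s -> s' <= b -> S s -> S s') r ->
    r = c -> S b.
  move=> [q q0 qP] rc; subst r.
  have [c0 Sc0 cc0] := sup_adherent q0 supS.
  have c0c : c0 <= c by apply: ub_le_sup => //; case: supS.
  pose c' := Num.min b (c + q / 2).
  have cc' : c <= c' by rewrite /c' le_min cb lerDl divr_ge0 // ltW.
  have Sc' : S c'.
    apply: (qP c0 c') => //.
    - by rewrite gt_min ltrD2l ltr_pdivrMr // ltr_pMr // ltr1n orbT.
    - by case: Sc0 => /andP[].
    - by rewrite /c' ge_min lexx.
  have : c' <= c by apply: ub_le_sup => //; case: supS.
  rewrite ge_min => /orP[bc|].
    have -> // : b = c'.
    by apply/eqP; rewrite eq_le ge_min lexx andbT (le_trans bc cc').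
  by rewrite gerDl leNgt divr_gt0.
apply: (step c) => //.
have [Nc|Nc] := pselect (N c).
- apply: straddleW (straddle_ord (GN _ Nc)).
  move=> s s' [ss' Gss'] as_ s'b [_ [k [u [v [uv tr Guv hs]]]]].
  split; first by rewrite s'b (le_trans as_ ss').
  pose u' i := if unlift ord_max i is Some j then u j else s.
  pose v' i := if unlift ord_max i is Some j then v j else s'.
  have u'l j : u' (lift ord_max j) = u j by rewrite /u' liftK.
  have v'l j : v' (lift ord_max j) = v j by rewrite /v' liftK.
  have u'm : u' ord_max = s by rewrite /u' unlift_none.
  have v'm : v' ord_max = s' by rewrite /v' unlift_none.
  have sumE (F : 'I_k.+1 -> R) :
      \sum_(i < k.+1) F i = \sum_(i < k) F (lift ord_max i) + F ord_max.
    rewrite big_ord_recr /=; congr (_ + _); apply: eq_bigr => i _.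
    by congr F; apply/val_inj => /=; rewrite /bump leqNgt ltn_ord.
  exists k.+1, u', v'; split.
  + move=> i; rewrite /u' /v'; case: unliftP => [j|] _.
      by have [? [? vj]] := uv j; split=> //; split=> //; exact: le_trans vj ss'.
    by rewrite as_ lexx ss'.
  + move=> i j _ _ [z []] /=.
    case: (unliftP ord_max i) => [i'|] ->; case: (unliftP ord_max j) => [j'|] ->;
      rewrite ?u'l ?v'l ?u'm ?v'm // !in_itv /=.
    * by move=> zi zj; congr lift; apply: tr => //; exists z; rewrite /= !in_itv.
    * move=> /andP[_ zv] /andP[sz _]; have [_ [_ vs]] := uv i'.
      by move: (lt_trans sz zv); rewrite ltNge vs.
    * move=> /andP[sz _] /andP[_ zv]; have [_ [_ vs]] := uv j'.
      by move: (lt_trans sz zv); rewrite ltNge vs.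
  + rewrite sumE u'm v'm; under eq_bigr do rewrite u'l v'l.
    by apply: le_trans (lerD Guv Gss') _; rewrite addrC addrA subrK.
  + rewrite sumE u'm v'm; under eq_bigr do rewrite u'l v'l.
    have phs : phi s <= phi s' by exact: nphi.
    have es : e * (s - a) <= e * (s' - a) by rewrite ler_pM2l // lerD2r.
    by move: hs; rewrite /h; lra.
- apply: straddleW (straddle_ord (str _ _ Nc _ e0)); last by rewrite ac_ cb.
  move=> s s' [ss' H] as_ s'b [_ [k [u [v [uv tr Guv hs]]]]].
  split; first by rewrite s'b (le_trans as_ ss').
  exists k, u, v; split => //.
  + by move=> i; have [? [? vj]] := uv i; split=> //; split=> //; exact: le_trans vj ss'.
  + by apply: le_trans Guv _; rewrite lerD2r; exact: nG.
  + have := H as_ s'b; rewrite -/(h s') -/(h s) => H'.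
    have -> : h s' - h a = (h s' - h s) + (h s - h a) by rewrite addrA subrK.
    apply: le_trans (lerD H' hs) _.
    by rewrite addrA -mulrDr addrA subrK.
Qed.

Lemma small_set_sub (a b b' mu : R) (A : set R) : b' <= b ->
  small_set a b mu A -> small_set a b' mu A.
Proof.
by move=> b'b [G [nG Gb GA]]; exists G; split=> //; apply: le_trans Gb; rewrite lerD2r nG.
Qed.

Lemma ac_sub (V : normedZmodType R) (a b a' b' : R) (x : R -> V) :
  a <= a' -> b' <= b -> ac a b x -> ac a' b' x.
Proof.
move=> aa' bb' acx e e0; have [d d0 dP] := acx e e0; exists d => // k s t st.
apply: dP => i; have [s1 [s2 s3]] := st i.
by split; [exact: le_trans aa' s1|split=> //; exact: le_trans s3 bb'].
Qed.

Lemma ac_unif (V : normedZmodType R) (a b : R) (x : R -> V) e : ac a b x ->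
  0 < e -> exists2 d, 0 < d &
  forall s t, a <= s -> s <= t -> t <= b -> t - s < d -> `|x t - x s| < e.
Proof.
move=> acx e0; have [d d0 dP] := acx _ e0; exists d => // s t as_ st tb tsd.
have := dP 1%N (fun=> s) (fun=> t); rewrite !big_ord1; apply => //.
by move=> i j _ _ _; rewrite (ord1 i) (ord1 j).
Qed.

(** Uniform continuity bounds the growth on each step of length d / 2. *)
Lemma ac_bounded (V : normedZmodType R) (a b : R) (x : R -> V) : a <= b ->
  ac a b x -> exists2 M, 0 < M & forall t, a <= t -> t <= b -> `|x t| <= M.
Proof.
move=> ab acx; have [d d0 dP] := ac_unif acx ltr01.
have d20 : 0 < d / 2 by rewrite divr_gt0.
have main n : forall t, a <= t -> t <= b -> t - a <= n%:R * (d / 2) ->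
    `|x t| <= `|x a| + n%:R.
  elim: n => [|n IH] t.
    move=> at_ tb; rewrite mul0r addr0 subr_le0 => ta.
    by have -> : t = a by apply/eqP; rewrite eq_le ta at_.
  move=> at_ tb tn; pose s := Num.max a (t - d / 2).
  have sa : a <= s by rewrite le_max lexx.
  have st : s <= t by rewrite ge_max at_ gerBl ltW.
  have tsd : t - s < d.
    apply: (@le_lt_trans _ _ (d / 2)); first by rewrite lerBlDr -lerBlDl le_max lexx orbT.
    by rewrite ltr_pdivrMr // ltr_pMr // ltr1n.
  have sn : s - a <= n%:R * (d / 2).
    have q0 : 0 <= n%:R * (d / 2) by rewrite mulr_ge0 // ltW.
    rewrite lerBlDr ge_max lerDr q0 /= -[X in _ <= X]addrC.
    by move: tn; rewrite -natr1 mulrDl mul1r; move: (_ * _) => q; lra.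
  have := IH _ sa (le_trans st tb) sn; have := dP _ _ sa st tb tsd.
  have := lerB_dist (x t) (x s); rewrite -natr1; lra.
exists (`|x a| + (Num.bound ((b - a) / (d / 2)))%:R + 1).
  by rewrite ltr_wpDl // addr_ge0.
move=> t at_ tb; apply: le_trans (main (Num.bound ((b - a) / (d / 2))) _ at_ tb _) _.
  rewrite -ler_pdivrMr //; apply: (@le_trans _ _ ((b - a) / (d / 2))).
    by rewrite ler_pM2r ?invr_gt0 // lerD2r.
  apply/ltW/archi_boundP; rewrite divr_ge0 ?subr_ge0 // ltW //.
by rewrite lerDl.
Qed.

(** Covers sums, products by Lipschitz factors and norms at once. *)
Lemma ac_dom (V V1 V2 : normedZmodType R) (a b C : R) (h : R -> V)
    (z1 : R -> V1) (z2 : R -> V2) : ac a b z1 -> ac a b z2 ->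
  (forall s t, a <= s -> s <= t -> t <= b ->
    `|h t - h s| <= C * (`|z1 t - z1 s| + `|z2 t - z2 s| + (t - s))) ->
  ac a b h.
Proof.
move=> ac1 ac2 hC e e0.
pose D := Num.max C 1.
have D0 : 0 < D by rewrite lt_max ltr01 orbT.
have e'0 : 0 < e / (4 * D) by rewrite divr_gt0 // mulr_gt0.
have [d1 d10 d1P] := ac1 _ e'0; have [d2 d20 d2P] := ac2 _ e'0.
exists (Num.min (e / (4 * D)) (Num.min d1 d2)); first by rewrite !lt_min e'0 d10.
move=> k s t st tr; rewrite !lt_min => /and3P[se s1 s2].
have := d1P k s t st tr s1; have := d2P k s t st tr s2 => e2 e1.
apply: (@le_lt_trans _ _ (D * (\sum_(i < k) `|z1 (t i) - z1 (s i)| +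
    \sum_(i < k) `|z2 (t i) - z2 (s i)| + \sum_(i < k) (t i - s i)))).
  rewrite -!big_split mulr_sumr /=; apply: ler_sum => i _.
  have [q1 [q2 q3]] := st i; apply: le_trans (hC _ _ q1 q2 q3) _.
  apply: ler_wpM2r; last by rewrite /D le_max lexx.
  by apply: addr_ge0; [exact: addr_ge0|rewrite subr_ge0].
rewrite -ltr_pdivlMl //; apply: lt_trans (ltrD (ltrD e1 e2) se) _.
have -> : D^-1 * e = 4 * (e / (4 * D)) by field; rewrite gt_eqF.
by move: e'0; lra.
Qed.

Lemma ac_lip (V : normedZmodType R) (a b C : R) (h : R -> V) :
  (forall s t, a <= s -> s <= t -> t <= b -> `|h t - h s| <= C * (t - s)) ->
  ac a b h.
Proof.
move=> hC e e0; pose D := Num.max C 1.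
have D0 : 0 < D by rewrite lt_max ltr01 orbT.
exists (e / D); first by rewrite divr_gt0.
move=> k s t st _; rewrite ltr_pdivlMr // mulrC; apply: le_lt_trans.
rewrite mulr_sumr; apply: ler_sum => i _; have [q1 [q2 q3]] := st i.
apply: le_trans (hC _ _ q1 q2 q3) _.
by apply: ler_wpM2r; [rewrite subr_ge0|rewrite /D le_max lexx].
Qed.

(** These two inequalities between difference quotients take the place of the
    derivative of t |-> exp (- L t). *)
Lemma expRN_lip (L s t : R) : 0 <= L -> 0 <= s -> s <= t ->
  expR (- (L * t)) * (L * (t - s)) <= expR (- (L * s)) - expR (- (L * t))
  /\ `|expR (- (L * t)) - expR (- (L * s))| <= L * (t - s).
Proof.
move=> L0 s0 st.
have Lts : 0 <= L * (t - s) by rewrite mulr_ge0 // subr_ge0.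
have E1 : expR (- (L * s)) = expR (- (L * t)) * expR (L * (t - s)).
  by rewrite -expRD; congr expR; ring.
have E2 : expR (- (L * t)) = expR (- (L * s)) * expR (- (L * (t - s))).
  by rewrite -expRD; congr expR; ring.
split.
  rewrite E1 -[X in _ <= _ - X]mulr1 -mulrBr ler_pM2l ?expR_gt0 //.
  by rewrite lerBrDl expR_ge1Dx.
have s1 : expR (- (L * s)) <= 1 by rewrite -expR0 ler_expR oppr_le0 mulr_ge0.
have l1 : expR (- (L * (t - s))) <= 1 by rewrite -expR0 ler_expR oppr_le0.
rewrite distrC ger0_norm; last by rewrite subr_ge0 ler_expR lerN2 ler_wpM2l.
rewrite E2 -[X in X - _ <= _]mulr1 -mulrBr.
apply: (@le_trans _ _ (1 * (1 - expR (- (L * (t - s)))))).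
  by rewrite ler_wpM2r // subr_ge0.
by rewrite mul1r lerBlDr -lerBlDl expR_ge1Dx.
Qed.

(** The function exp (- L t) |z t| - phi t has nonpositive slope outside N, so
    that [straddle_le] applies; [phi] collects the source terms. *)
Lemma gronwall (V : normedZmodType R) (T L : R) (z : R -> V) (phi : R -> R)
    (N : set R) : 0 <= L -> ac 0 T z -> {homo phi : s t / s <= t} ->
  (forall e, 0 < e -> small_set 0 T e N) ->
  (forall t, 0 <= t <= T -> ~ N t -> forall k, 0 < k ->
    straddle (fun s s' => 0 <= s -> s' <= T ->
      `|z s' - z s| <= (L * `|z t| + k) * (s' - s) + (phi s' - phi s)) t) ->
  forall t, 0 <= t <= T -> `|z t| <= expR (L * T) * (`|z 0| + (phi T - phi 0)).
Proof.
move=> L0 acz nphi sN str t /andP[t0 tT].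
have T0 := le_trans t0 tT.
have [M M0 zM] := ac_bounded T0 acz.
pose h1 s := expR (- (L * s)) * `|z s|.
have ach1 : ac 0 t h1.
  apply: (@ac_dom _ _ _ _ _ (L * M + 1) h1 z z).
  - exact: ac_sub acz.
  - exact: ac_sub acz.
  move=> s r s0 sr rt; rewrite /h1.
  have [_ e2] := expRN_lip L0 s0 sr.
  have -> : expR (- (L * r)) * `|z r| - expR (- (L * s)) * `|z s| =
    expR (- (L * r)) * (`|z r| - `|z s|) +
    (expR (- (L * r)) - expR (- (L * s))) * `|z s| by ring.
  have er1 : expR (- (L * r)) <= 1.
    by rewrite -expR0 ler_expR oppr_le0 mulr_ge0 // (le_trans s0).
  apply: le_trans (ler_normD _ _) _; rewrite !normrM.
  rewrite (ger0_norm (expR_ge0 _)) normr_id.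
  have zs : `|z s| <= M by rewrite zM // (le_trans sr) // (le_trans rt).
  apply: (@le_trans _ _ (1 * `|z r - z s| + L * (r - s) * M)).
    apply: lerD; last exact: ler_pM.
    by apply: ler_pM => //; rewrite ?expR_ge0 // ler_dist_dist.
  have := normr_ge0 (z r - z s); set q := `| _ |; move=> q0.
  have rs0 : 0 <= r - s by rewrite subr_ge0.
  have LM : 0 <= L * M by rewrite mulr_ge0 // ltW.
  have := mulr_ge0 LM q0; nra.
have := @straddle_le 0 t h1 phi N t0 ach1 nphi.
have -> : h1 0 = `|z 0| by rewrite /h1 mulr0 oppr0 expR0 mul1r.
move=> H.
have {}H : h1 t - phi t <= `|z 0| - phi 0.
  apply: H => [e e0|r /andP[r0 rt] Nr k k0].
    exact: small_set_sub tT (sN _ e0).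
  have k2 : 0 < k / 2 by rewrite divr_gt0.
  have kL : 0 < k / (2 * (L + 1)) by rewrite divr_gt0 // mulr_gt0 // ltr_wpDl.
  have [d d0 dP] := ac_unif acz kL.
  have rT := le_trans rt tT.
  have cl : straddle (fun s s' => 0 <= s -> L * `|z r| <= L * `|z s| + k / 2) r.
    exists d => // s s' ds sr rs' _ s0.
    have zrs : `|z r - z s| < k / (2 * (L + 1)) by apply: dP => //; lra.
    have : `|z r| - `|z s| <= k / (2 * (L + 1)).
      by apply: le_trans (ltW zrs); rewrite lerB_dist.
    move=> /(ler_wpM2l L0); rewrite mulrBr => /le_trans H'.
    rewrite -lerBlDl; apply: H'.
    have -> : k / 2 = (L + 1) * (k / (2 * (L + 1))) by field; rewrite gt_eqF // ltr_wpDl.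
    by rewrite ler_pM2r // lerDl.
  have strr := str r; rewrite r0 rT in strr.
  apply: straddleW (straddle_ord (straddleI cl (strr isT Nr _ k2))).
  move=> s s' [ss' [A B]] s0 s't.
  have {}A := A s0; have {}B := B s0 (le_trans s't tT).
  have [e1 _] := expRN_lip L0 s0 ss'.
  have es1 : expR (- (L * s')) <= 1.
    by rewrite -expR0 ler_expR oppr_le0 mulr_ge0 // (le_trans s0).
  have dphi : 0 <= phi s' - phi s by rewrite subr_ge0 nphi.
  have es0 : 0 <= expR (- (L * s')) by exact: expR_ge0.
  have zz : `|z s'| <= `|z s| + ((L * `|z r| + k / 2) * (s' - s) + (phi s' - phi s)).
    by rewrite -lerBlDl; apply: le_trans B; exact: lerB_dist.
  have ds : 0 <= s' - s by rewrite subr_ge0.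
  rewrite /h1.
  set E := expR (- (L * s')) in e1 es1 es0 *; set F := expR (- (L * s)) in e1 *.
  have z0 := normr_ge0 (z s).
  have p1 : E * `|z s'| <= E * (`|z s| + ((L * `|z s| + k) * (s' - s) + (phi s' - phi s))).
    apply: ler_wpM2l => //; apply: le_trans zz _.
    rewrite lerD2l lerD2r ler_wpM2r //; lra.
  have p2 : E * (L * (s' - s)) * `|z s| <= (F - E) * `|z s| by rewrite ler_wpM2r.
  have p3 : E * (phi s' - phi s) <= phi s' - phi s by rewrite ler_piMl.
  have p4 : E * (k * (s' - s)) <= k * (s' - s) by rewrite ler_piMl // mulr_ge0 // ltW.
  move: p1 p2 p3 p4; rewrite !mulrDr !mulrDl !mulrA; lra.
have eT : expR (L * t) <= expR (L * T) by rewrite ler_expR ler_wpM2l.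
have -> : `|z t| = expR (L * t) * h1 t.
  by rewrite /h1 mulrA -expRD subrr expR0 mul1r.
have h10 : 0 <= h1 t by rewrite mulr_ge0 ?expR_ge0.
have phT := nphi _ _ tT.
apply: ler_pM => //.
lra.
Qed.
End Straddle.

(** * Sets of small measure *)

Section SmallSets.
Context {R : realType}.
Implicit Types (a b mu e t : R) (A B : set R).

Lemma small_set_subset a b mu A B : A `<=` B ->
  small_set a b mu B -> small_set a b mu A.
Proof. by move=> AB [G [? ? GB]]; exists G; split => // t /AB /GB. Qed.

Lemma small_setW a b mu mu' A : mu <= mu' ->
  small_set a b mu A -> small_set a b mu' A.
Proof. by move=> mm [G [? Gm ?]]; exists G; split => //; exact: le_trans mm. Qed.

Lemma small_setU a b mu mu' A B : small_set a b mu A -> small_set a b mu' B ->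
  small_set a b (mu + mu') (A `|` B).
Proof.
move=> [G [nG Gm GA]] [H [nH Hm HB]]; exists (fun t => G t + H t); split.
- by move=> s t st; rewrite lerD ?nG ?nH.
- by move: Gm Hm; lra.
- move=> t [/GA|/HB] /straddle_ord; apply: straddleW => s s' [ss' ?].
  + by have := nH _ _ ss'; lra.
  + by have := nG _ _ ss'; lra.
Qed.

Lemma small_set0 a b : small_set a b 0 set0.
Proof. by exists (fun=> 0); split => //; rewrite subrr. Qed.

Lemma small_set_bigU a b (I : finType) (mu : I -> R) (A : I -> set R) :
  (forall i, small_set a b (mu i) (A i)) ->
  small_set a b (\sum_i mu i) [set t | exists i, A i t].
Proof.
move=> sA.
suff H (r : seq I) : small_set a b (\sum_(i <- r) mu i) [set t | exists2 i, i \in r & A i t].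
  by apply: small_set_subset (H (index_enum I)) => t [i Ait]; exists i.
elim: r => [|i r IH].
  by rewrite big_nil; apply: small_set_subset (small_set0 a b) => t [].
rewrite big_cons; apply: small_set_subset (small_setU (sA i) IH).
move=> t [j]; rewrite inE => /predU1P[->|jr] Aj; [by left|by right; exists j].
Qed.

(** The length of [c, c + l] `&` ]-oo, t]: the cost function of ]c, c + l[ and,
    for a needle, the time spent in it before t. *)
Definition ramp (c l t : R) : R := Num.max 0 (Num.min (t - c) l).

Lemma ramp_ge0 c l t : 0 <= ramp c l t.
Proof. by rewrite /ramp le_max lexx. Qed.

Lemma ramp_le c l t : 0 <= l -> ramp c l t <= l.
Proof. by move=> l0; rewrite /ramp ge_max l0 ge_min lexx orbT. Qed.

Lemma ramp0 c l t : t <= c -> ramp c l t = 0.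
Proof.
move=> tc; apply/max_idPl; rewrite ge_min subr_le0 tc //.
Qed.

Lemma ramp_mid c l t : c <= t -> t <= c + l -> ramp c l t = t - c.
Proof.
move=> ct tcl; rewrite /ramp (min_idPl _); last by rewrite lerBlDl.
by apply/max_idPr; rewrite subr_ge0.
Qed.

Lemma ramp_end c l t : 0 <= l -> c + l <= t -> ramp c l t = l.
Proof.
move=> l0 tcl; rewrite /ramp (min_idPr _); last by rewrite lerBrDl.
exact/max_idPr.
Qed.

Lemma ramp_homo c l : {homo ramp c l : s t / s <= t}.
Proof.
move=> s t st; have H : Num.min (s - c) l <= Num.min (t - c) l.
  by rewrite le_min !ge_min lexx lerD2r st orbT.
by rewrite /ramp ge_max !le_max lexx H orbT.
Qed.

Lemma ramp_lip c l s t : s <= t -> ramp c l t - ramp c l s <= t - s.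
Proof.
move=> st; rewrite lerBlDl /ramp ge_max; apply/andP; split.
  by rewrite addr_ge0 ?subr_ge0 // le_max lexx.
have [sl|sl] := leP (s - c) l.
  rewrite ge_min; apply/orP; left.
  have : s - c <= Num.max 0 (s - c) by rewrite le_max lexx orbT.
  lra.
rewrite ge_min; apply/orP; right.
have : l <= Num.max 0 l by rewrite le_max lexx orbT.
by move: st; lra.
Qed.

Lemma small_set_itv a b c d : c <= d -> small_set a b (d - c) `]c, d[.
Proof.
move=> cd; have l0 : 0 <= d - c by rewrite subr_ge0.
exists (ramp c (d - c)); split.
- exact: ramp_homo.
- by have := ramp_le c b l0; have := ramp_ge0 c (d - c) a; lra.
- move=> t; rewrite /= in_itv /= => /andP[ct td].
  exists (Num.min (t - c) (d - t)); first by rewrite lt_min !subr_gt0 ct.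
  move=> s s' ts st ts' s't.
  have cs : c < s.
    by apply: le_lt_trans ts; rewrite lerBrDr -lerBrDl ge_min lexx.
  have sd : s' < d.
    by apply: lt_le_trans s't _; rewrite -lerBrDl ge_min lexx orbT.
  rewrite !ramp_mid //; lra.
Qed.

Lemma small_set_pt a b c e : 0 < e -> small_set a b e [set c].
Proof.
move=> e0; have cc : c - e / 2 <= c + e / 2 by lra.
have := small_set_itv a b cc; have -> : c + e / 2 - (c - e / 2) = e by lra.
apply: small_set_subset => _ ->; rewrite /= in_itv /=; apply/andP; split; lra.
Qed.

Lemma open_small_set a b mu (O : set R) : open O ->
  (lebesgue_measure O <= mu%:E)%E -> small_set a b mu O.
Proof.
move=> oO Om.
have mO : measurable O by exact: open_measurable.
pose A t : set (measurableTypeR R) := O `&` `]-oo, t]%classic.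
have mA t : measurable (A t) by exact: measurableI.
have Ale t : (lebesgue_measure (A t) <= mu%:E)%E.
  by apply: le_trans Om; rewrite le_measure ?inE //; exact: subIsetl.
have Afin t : lebesgue_measure (A t) \is a fin_num.
  by rewrite ge0_fin_numE // (le_lt_trans (Ale t)) // ltry.
exists (fun t => fine (lebesgue_measure (A t))); split.
- move=> s t st; rewrite fine_le // le_measure ?inE //.
  by apply: setIS => r /=; rewrite !in_itv /= => /le_trans; apply.
- apply: (@le_trans _ _ (fine (lebesgue_measure (A b)))).
    by rewrite gerBl fine_ge0.
  by rewrite -lee_fin fineK.
- move=> t /= Ot.
  have /nbhs_ballP[d /= d0 dO] : nbhs t O by exact: open_nbhs_nbhs.
  exists d => // s s' ds st ts' s'd.
  have ss' := le_trans st ts'.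
  rewrite -lee_fin [X in (_ <= X)%E]EFinB !fineK //.
  rewrite leeBrDr //.
  have mI : measurable (`]s, s']%classic : set (measurableTypeR R)) by [].
  have -> : (s' - s)%:E = lebesgue_measure (`]s, s']%classic : set (measurableTypeR R)).
    rewrite lebesgue_measure_itv /= lte_fin; case: ltP => // ss.
    have -> : s = s' by apply/eqP; rewrite eq_le ss' ss.
    by rewrite subrr.
  rewrite -measureU //; last first.
    apply/seteqP; split => // r [] /=; rewrite in_itv /= => /andP[sr _] [_].
    by rewrite /= in_itv /= leNgt sr.
  rewrite le_measure ?inE //; first exact: measurableU.
  move=> r [|[Or]]; rewrite /= !in_itv /=.
    move=> /andP[sr rs']; split; last by rewrite /= in_itv.
    apply: dO; rewrite /ball /= ltr_distl; apply/andP; split; lra.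
  by move=> rs; split => //; rewrite /= in_itv /= (le_trans rs).
Qed.

(** The measure of A is the infimum of those of the open sets containing A. *)
Lemma lebR_small_set a b mu e A : (lebR A <= mu%:E)%E -> 0 < e ->
  small_set a b (mu + e) A.
Proof.
move=> Am e0; have [V [oV AV Ve]] := outer_measure_open_le A e0.
apply: small_set_subset AV _; apply: open_small_set => //.
by apply: le_trans Ve _; rewrite EFinD leeD2r.
Qed.

Lemma null_small_set a b e A : lebR.-negligible A -> 0 < e ->
  small_set a b e A.
Proof.
move=> [B [mB B0 AB]] e0; apply: small_set_subset AB _.
by have := @lebR_small_set a b 0 e B; rewrite add0r; apply => //; rewrite B0.
Qed.

End SmallSets.

(** * Compactness, inner regularity and almost uniform continuity of controls *)

Section Utils.
Context {R : realType}.

Lemma rv_norm_le n (x : 'rV[R]_n) M : 0 <= M -> (forall i, `|x 0 i| <= M) ->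
  `|x| <= M.
Proof.
move=> M0 xM; rewrite /Num.norm /= mx_normrE; apply: bigmax_le => //= -[i j] _.
by rewrite /= (ord1 i).
Qed.

Lemma le_rv_norm n (x : 'rV[R]_n) i : `|x 0 i| <= `|x|.
Proof.
rewrite [leRHS]/Num.norm /= mx_normrE.
exact: (le_bigmax _ (fun ij => `|x ij.1 ij.2|) (0, i)).
Qed.

(** Lebesgue's number lemma, for a property inherited by smaller sets that
    holds near each point of the compact K. *)
Lemma lebesgue_number_set (X : pseudoMetricType R) (K : set X)
    (P : set X -> Prop) : compact K ->
  (forall A B, A `<=` B -> P B -> P A) ->
  (forall x, K x -> exists2 d, 0 < d & P (K `&` ball x d)) ->
  exists2 d, 0 < d & forall y, K y -> P (K `&` ball y d).
Proof.
move=> /compact_near_coveringP cK Pmono loc.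
have := cK R (0 : R)^'+ (fun d y => K y -> P (K `&` ball y d)) _.
case.
  move=> x Kx; have [d d0 dP] := loc x Kx.
  have d20 : 0 < d / 2 by rewrite divr_gt0.
  exists (ball x (d / 2), [set e | 0 < e < d / 2]) => /=.
    split; first exact: nbhsx_ballx.
    by near=> e; apply/andP; split; near: e;
      [exact: nbhs_right_gt|exact: nbhs_right_lt].
  move=> [y e] [/= xy /andP[e0 ed]] Ky; apply: Pmono dP => z [Kz yz].
  split => //; rewrite [d]splitr; apply: ball_triangle xy _.
  exact: le_ball (ltW ed) _ yz.
move=> d d0 dP; exists (d / 2); first by rewrite divr_gt0.
move=> y Ky; apply: (dP (d / 2)) => //=.
  rewrite sub0r normrN gtr0_norm ?divr_gt0 //.
  by rewrite ltr_pdivrMr // ltr_pMr // ltr1n.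
by rewrite divr_gt0.
Unshelve. all: by end_near. Qed.

Lemma lebesgue_number (X : pseudoMetricType R) (K : set X)
    (P : X -> X -> Prop) : compact K ->
  (forall x, K x -> exists2 d, 0 < d & forall y z, K y -> K z ->
     ball x d y -> ball x d z -> P y z) ->
  exists2 d, 0 < d & forall y z, K y -> K z -> ball y d z -> P y z.
Proof.
move=> cK loc.
have [|x Kx|d d0 dP] := @lebesgue_number_set X K
  (fun A => forall y z, A y -> A z -> P y z) cK.
- by move=> A B AB PB y z /AB Ay /AB Az; exact: PB.
- have [d d0 dP] := loc x Kx; exists d => // y z [Ky xy] [Kz xz]; exact: dP.
- by exists d => // y z Ky Kz yz; apply: (dP y Ky); split => //; exact: ballxx.
Qed.

Lemma borel_lebesgueR (A : set R) :
  measurable (A : set (measurableTypeR R)) -> measurable (A : set lebesgueR).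
Proof. exact: sub_caratheodory. Qed.

(** The complement in [0, T] of an open set containing [0, T] `\` E and of
    nearly the same measure. *)
Lemma lebR_inner (T e : R) (E : set R) : 0 < e ->
  measurable (E : set lebesgueR) -> E `<=` `[0, T] ->
  exists C : set R, [/\ compact C, C `<=` E & (lebR (E `\` C) <= e%:E)%E].
Proof.
move=> e0 mE ET; pose F := `[0, T] `\` E.
have mI : measurable (`[0, T]%classic : set lebesgueR) by apply: borel_lebesgueR.
have mF : measurable (F : set lebesgueR) by exact: measurableD.
have [V [oV FV Ve]] := outer_measure_open_le F e0.
have mV : measurable (V : set lebesgueR) by apply: borel_lebesgueR; exact: open_measurable.
have Ffin : lebR F \is a fin_num.
  rewrite ge0_fin_numE //; apply: (@le_lt_trans _ _ (lebR `[0, T]%classic)).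
    by rewrite le_measure ?inE //; exact: subIsetl.
  rewrite [ltLHS](@lebesgue_measure_itv R `[0, T]) /= lte_fin.
  by case: ifP => _; rewrite ltry.
exists (`[0, T] `\` V); split.
- apply: (subclosed_compact _ (@segment_compact _ 0 T)); last exact: subIsetl.
  by apply: closedI; [exact: interval_closed|exact: open_closedC].
- by move=> t [tT nV]; apply: contrapT => nE; apply: nV; apply: FV.
apply: (@le_trans _ _ (lebR (V `\` F))).
  rewrite le_measure ?inE //.
  + by do 2! apply: measurableD => //.
  + exact: measurableD.
  move=> t [Et nC]; split; first by apply: contrapT => nV; apply: nC; split=> //; exact: ET.
  by move=> [].
have VF : (lebR V <= lebR F + e%:E)%E by exact: Ve.
rewrite measureD //=; last by apply: le_lt_trans VF _; rewrite -(fineK Ffin) -EFinD ltry.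
by rewrite setIidr // leeBlDl.
Qed.

Lemma ae_on_negligible (A : set R) (P : R -> Prop) : ae_on A P ->
  lebR.-negligible (A `&` ~` [set t | P t]).
Proof.
rewrite /ae_on /prop_near1 /nbhs /= /almost_everywhere; apply: negligibleS.
by move=> t [At nP] /= /(_ At).
Qed.

Lemma ae_onW (A : set R) (P Q : R -> Prop) :
  (forall t, P t -> Q t) -> ae_on A P -> ae_on A Q.
Proof.
move=> PQ; rewrite /ae_on /prop_near1 /nbhs /= /almost_everywhere.
by apply: negligibleS => t nQ H; apply: nQ => At; exact/PQ/H.
Qed.

(** The weak form of Lusin's theorem in which the oscillation rho is fixed: cut
    the range of u into finitely many boxes of size rho / 2, and take in each
    preimage a compact subset with nearly the same measure. Points of K that are
    close enough to t lie in the compact sets to which t belongs. *)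
Lemma lusin_osc (n : nat) (T M rho mu : R) (U : set 'rV[R]_n) u :
  0 < rho -> 0 < mu -> Linfty_in T U u ->
  ae_on `[0, T] (fun t => `|u t| <= M) ->
  exists K : set R, [/\ measurable (K : set lebesgueR),
    small_set 0 T mu (`[0, T] `\` K),
    K `<=` `[0, T] `&` [set t | U (u t) /\ `|u t| <= M] &
    exists2 d, 0 < d & forall s t, K s -> K t -> `|s - t| < d ->
      `|u s - u t| <= rho].
Proof.
move=> rho0 mu0 [[mu_ _] uU] uM.
have [B [mB B0 NB]] : lebR.-negligible
    (~` [set t | `[0, T]%classic t -> U (u t) /\ `|u t| <= M]).
  apply: negligibleS (negligibleU (ae_on_negligible uU) (ae_on_negligible uM)).
  move=> t /not_implyP[tT]; case/not_andP=> H; [left|right]; split => //.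
have mI : measurable (`[0, T]%classic : set lebesgueR) by apply: borel_lebesgueR.
pose r := rho / 2.
have r0 : 0 < r by rewrite divr_gt0.
(* q intervals of length r, starting from - M, cover [- M, M]. *)
pose q := (Num.bound (2 * M / r)).+1.
pose I (k : 'I_q) : set R := `[- M + k%:R * r, - M + k%:R * r + r]%classic.
pose E (f : {ffun 'I_n -> 'I_q}) : set R := (`[0, T] `\` B) `&`
  \bigcap_(i in [set: 'I_n]) (`[0, T] `&` [set t | I (f i) (u t 0 i)]).
have mE f : measurable (E f : set lebesgueR).
  apply: measurableI; first exact: measurableD.
  apply: fin_bigcap_measurable => // i _.
  exact: (mu_ i mI (I (f i)) (measurable_itv _)).
have EI f : E f `<=` `[0, T] by move=> t [[]].
have osc f s t : E f s -> E f t -> `|u s - u t| <= r.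
  move=> [_ Es] [_ Et]; apply: rv_norm_le => [|i]; first exact: ltW.
  have [_] := Es i Logic.I; have [_] := Et i Logic.I.
  rewrite /I /= !in_itv /= !mxE => /andP[a1 a2] /andP[b1 b2].
  by rewrite ler_norml; apply/andP; split; lra.
pose N := #|{: {ffun 'I_n -> 'I_q}}|.
pose e := mu / (4 * (N.+1)%:R).
have e0 : 0 < e by rewrite divr_gt0 // mulr_gt0.
have /choice[C CP] f := lebR_inner e0 (mE f) (EI f).
pose K := \bigcup_(f in [set: {ffun 'I_n -> 'I_q}]) C f.
exists K; split.
- apply: fin_bigcup_measurable => // f _; apply: borel_lebesgueR.
  by apply: compact_measurable; case: (CP f).
- have sB : small_set 0 T (mu / 2) B by apply: null_small_set => //;
    [exists B; split|rewrite divr_gt0].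
  have sE f : small_set 0 T (e + e) (E f `\` C f).
    by apply: lebR_small_set => //; case: (CP f).
  apply: small_setW _ (small_set_subset _ (small_setU sB (small_set_bigU sE))).
    rewrite sumr_const -/N -mulr_natl.
    have N0 : (N%:R <= N.+1%:R :> R) by rewrite ler_nat.
    have : N%:R * (e + e) <= N.+1%:R * (e + e) by rewrite ler_wpM2r // addr_ge0 // ltW.
    have -> : N.+1%:R * (e + e) = mu / 2 by rewrite /e;
      move: (N.+1%:R) (gt_eqF (ltr0Sn R N)) => c c0; field; rewrite c0.
    by lra.
  move=> t [tT nC].
  have [Bt|Bt] := pselect (B t); [by left|right].
  have [Ut ut] : U (u t) /\ `|u t| <= M.
    by apply: contrapT => H; apply: Bt; apply: NB => /(_ tT).
  have M00 : 0 <= M by apply: le_trans ut.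
  have z0 i : 0 <= (u t 0 i + M) / r.
    rewrite divr_ge0 ?(ltW r0) //.
    by have := le_trans (le_rv_norm (u t) i) ut; rewrite ler_norml; lra.
  have kP (i : 'I_n) : (Num.truncn ((u t 0 i + M) / r)%R < q)%N.
    have /andP[kz _] := truncn_itv (z0 i).
    rewrite /q ltnS -(ler_nat R); apply: le_trans kz _.
    apply: (@le_trans _ _ (2 * M / r)); last first.
      by apply/ltW/archi_boundP; rewrite divr_ge0 ?(ltW r0) // mulr_ge0.
    rewrite ler_pM2r ?invr_gt0 //.
    by have := le_trans (le_rv_norm (u t) i) ut; rewrite ler_norml; lra.
  pose f := [ffun i => Ordinal (kP i)].
  exists f; split; last by move=> Cf; apply: nC; exists f.
  split => // i _; split => //; rewrite /I /= in_itv /= ffunE /=.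
  have /andP[] := truncn_itv (z0 i); set k := Num.truncn _.
  by rewrite ler_pdivlMr // ltr_pdivrMr // -natr1 mulrDl mul1r => *; apply/andP; split; lra.
- move=> t [f _ Cft]; have [_ + _] := CP f => /(_ _ Cft) [[tT nB] _]; split => //.
  by apply: contrapT => H; apply: nB; apply: NB => /(_ tT).
- have cC f : compact (C f) by case: (CP f).
  have cK : compact K.
    rewrite /K -bigsetU_fset_set //; last exact: finite_finset.
    by apply: bigsetU_compact.
  apply: (lebesgue_number (X := R) cK) => x [f _ Cfx].
  have : \forall y \near x, forall g, ~ C g x -> ~ C g y.
    apply: (@filter_forall _ _ (fun g y => ~ C g x -> ~ C g y) (nbhs x) (nbhs_filter x)) => g.
    have [Cgx|Cgx] := pselect (C g x); first exact: nearW.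
    have := closed_openC (compact_closed (@Rhausdorff R) (cC g)).
    by move=> /(_ x Cgx); apply: filterS => y nC _.
  move=> /nbhs_ballP[d /= d0 dP]; exists d => // y z [g _ Cgy] [h _ Chz] xy xz.
  have Cgx : C g x by apply: contrapT => H; exact: (dP _ xy g H).
  have Chx : C h x by apply: contrapT => H; exact: (dP _ xz h H).
  have CE g' : C g' `<=` E g' by case: (CP g').
  have := osc _ _ _ (CE _ _ Cgy) (CE _ _ Cgx).
  have := osc _ _ _ (CE _ _ Chx) (CE _ _ Chz).
  by have := ler_distD (u x) (u y) (u z); rewrite /r; lra.
Qed.
End Utils.

(** * Lebesgue points *)

Section Chebyshev.
Local Open Scope ereal_scope.
Import HBNNSimple.

(** The integral is a supremum over the simple functions below g, and c times the
    indicator of S is one of them, whether or not g is measurable. *)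
Lemma chebyshev_inner d (X : measurableType d) (R : realType)
    (mu : {measure set X -> \bar R}) (D S : set X) (g : X -> \bar R) (c : R) :
  (0 <= c)%R -> measurable S -> S `<=` D -> (forall x, 0 <= g x) ->
  (forall x, S x -> c%:E <= g x) -> c%:E * mu S <= \int[mu]_(x in D) g x.
Proof.
move=> c0 mS SD g0 gS; rewrite ge0_integralE //.
apply: ereal_sup_ubound; exists (scale_nnsfun (indic_nnsfun R mS) c0) => /=.
  move=> x; rewrite /patch /=; rewrite mindicE; case: ifPn => [/set_mem Dx|/negP nDx].
    by case: (asboolP (S x)) => Sx; [rewrite mem_set // mulr1 gS|rewrite memNset // mulr0].
  by rewrite memNset ?mulr0 // => Sx; apply: nDx; apply/mem_set/SD.
by rewrite sintegralrM sintegral_indic.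
Qed.

End Chebyshev.

Section LebesguePoint.
Context {R : realType}.

(** What Lusin's theorem says about g, at a fixed scale of oscillation. *)
Definition quasi_unif_cont (n : nat) (T : R) (g : R -> 'rV[R]_n) : Prop :=
  forall rho mu, 0 < rho -> 0 < mu -> exists K : set R,
    [/\ measurable (K : set lebesgueR), small_set 0 T mu (`[0, T] `\` K),
      K `<=` `[0, T] & exists2 d, 0 < d &
      forall s t, K s -> K t -> `|s - t| < d -> `|g s - g t| <= rho].

(** Chebyshev's inequality on the ball of radius r. The set where
    |g t - g tau| > eta need not be measurable, but inside the set K of
    [quasi_unif_cont] its d-neighbourhood S is relatively open, and
    |g t - g tau| >= eta / 2 holds on S. *)
Lemma lebesgue_point_small (n : nat) (T tau eta : R) (g : R -> 'rV[R]_n) :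
  0 <= tau -> tau < T -> lebesgue_point T g tau -> quasi_unif_cont T g ->
  0 < eta -> exists2 r0, 0 < r0 & forall r, 0 < r -> r < r0 ->
    small_set 0 T (eta * r)
      [set t | ball tau r t /\ 0 <= t <= T /\ eta < `|g t - g tau|].
Proof.
move=> tau0 tauT lp qg eta0.
(* The ball has measure at most 2 r, so that S has measure at most
   (2 / eta) * 2 r * kap = eta * r / 4. *)
pose kap := eta ^+ 2 / 16.
have kap0 : 0 < kap by rewrite divr_gt0 // exprn_gt0.
have := lp => /(_ [set y | (y < kap%:E)%E])[].
  by apply: (open_nbhs_nbhs (T := \bar R)); split; [exact: open_ereal_lt_ereal|rewrite /= lte_fin].
move=> r1 /= r10 r1P.
exists (Num.min r1 (T - tau)); first by rewrite lt_min r10 subr_gt0.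
move=> r rgt0; rewrite lt_min => /andP[rr1 rT].
have {r1P} := r1P r; rewrite /ball /= sub0r normrN gtr0_norm // => /(_ rr1 rgt0).
set B : set lebesgueR := (ball tau r `&` `[0, T]).
have mB : measurable B.
  apply: borel_lebesgueR; apply: measurableI; last by [].
  by apply: open_measurable; exact: ball_open.
have Ble : (lebR B <= (2 * r)%:E)%E.
  apply: (@le_trans _ _ (lebR (`]tau - r, tau + r[%classic : set lebesgueR))).
    rewrite le_measure ?inE //; first exact: borel_lebesgueR.
    move=> t [+ _]; rewrite /ball /= ltr_distl in_itv /=.
    by move=> /andP[]; move=> *; apply/andP; split; lra.
  rewrite [leLHS](@lebesgue_measure_itv R `]tau - r, tau + r[) /= lte_fin.
  case: ifP => _; last by rewrite lee_fin; lra.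
  by rewrite lee_fin; lra.
have Bge : (r%:E <= lebR B)%E.
  apply: (@le_trans _ _ (lebR (`[tau, tau + r[%classic : set lebesgueR))).
    rewrite [leRHS](@lebesgue_measure_itv R `[tau, tau + r[) /= lte_fin.
    by rewrite ltrDl rgt0 lee_fin; lra.
  rewrite le_measure ?inE //; first exact: borel_lebesgueR.
  move=> t; rewrite /= in_itv /= => /andP[t1 t2]; split.
    by rewrite /ball /= ltr_distl; apply/andP; split; lra.
  by rewrite /= in_itv /=; apply/andP; split; lra.
have Bfin : lebR B \is a fin_num by rewrite ge0_fin_numE // (le_lt_trans Ble) // ltry.
have [b [b1 b2 bE]] : exists b, [/\ r <= b, b <= 2 * r & lebR B = b%:E].
  by exists (fine (lebR B)); rewrite -!lee_fin fineK.
rewrite bE => Hint.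
have er : 0 < eta * r / 4 by rewrite divr_gt0 // mulr_gt0.
have e2 : 0 < eta / 2 by rewrite divr_gt0.
have [K [mK sK KT [d d0 dP]]] := qg (eta / 2) (eta * r / 4) e2 er.
pose V := \bigcup_(s in K `&` [set s | eta < `|g s - g tau|]) (ball s d : set R).
pose S : set lebesgueR := B `&` K `&` V.
have mS : measurable S.
  apply: measurableI; first exact: measurableI.
  apply: borel_lebesgueR; apply: open_measurable; apply: bigcup_open => s _; exact: ball_open.
have Sg t : S t -> eta / 2 <= `|g t - g tau|.
  move=> [[Bt Kt] [s [Ks gs] st]]; have := dP s t Ks Kt st.
  have := ler_distD (g t) (g s) (g tau); move: gs => /=; lra.
have Sle : (lebR S <= (eta * r / 4)%:E)%E.
  have := @chebyshev_inner _ _ _ lebR B S (fun t => (`|g t - g tau|)%:E) _ (ltW e2) mS.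
  have b0 : 0 < b by apply: lt_le_trans b1.
  have H : (\int[lebR]_(x in B) (`|g x - g tau|)%:E <= (b * kap)%:E)%E.
    move: Hint; rewrite inver gt_eqF //= lte_pdivrMl // => /ltW.
    by rewrite EFinM.
  move=> /(_ (fun t Bt => Bt.1.1)) => /(_ (fun t => normr_ge0 _)) => /(_ Sg).
  move=> /le_trans /(_ H).
  rewrite -lee_pdivlMl // => /le_trans; apply; rewrite -EFinM lee_fin /kap.
  have -> : (eta / 2)^-1 * (b * (eta ^+ 2 / 16)) = b * eta / 8 by field; rewrite gt_eqF.
  have : b * eta <= 2 * r * eta by rewrite ler_pM2r.
  lra.
apply: small_setW _ (small_set_subset _ (small_setU sK (lebR_small_set 0 T Sle er))).
  have p : 0 < eta * r by exact: mulr_gt0.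
  by lra.
move=> t [bt [tT gt]].
have tT' : `[0, T]%classic t by rewrite /= in_itv.
have [Kt|Kt] := pselect (K t); [right|by left].
by split => //; exists t => //; exact: ballxx.
Qed.

End LebesguePoint.

(** * The Poincare-Miranda theorem *)

Section Kuhn.
Context (p : nat).
Let pt := nat -> nat.

Definition upd (q : pt) (i k : nat) : pt := fun j => if j == i then k else q j.
Definition inc (q : pt) (i : nat) : pt := upd q i (q i).+1.

Lemma upd_comm q i j k l : i != j -> upd (upd q i k) j l = upd (upd q j l) i k.
Proof.
move=> ij; apply/funext => x; rewrite /upd; case: eqP => // ->.
by rewrite eq_sym (negbTE ij).
Qed.

Lemma inc_comm q i j : inc (inc q i) j = inc (inc q j) i.
Proof.
have [->//|ij] := eqVneq i j.
rewrite /inc.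
have -> : upd q i (q i).+1 j = q j by rewrite /upd eq_sym (negbTE ij).
have -> : upd q j (q j).+1 i = q i by rewrite /upd (negbTE ij).
exact: upd_comm.
Qed.

(** Cochains modulo 2 on the cubical complex of the lattice: [w D q] is the value
    of [w] on the cube with lowest vertex [q] and set of directions [D]. *)
Definition coboundary (w : seq nat -> pt -> 'F_2) (D : seq nat) (q : pt) : 'F_2 :=
  \sum_(i <- D) (w (rem i D) (inc q i) - w (rem i D) q).

(** The cup product of the coboundaries of the labels g i for i in gs, as the sum
    over all orders of the directions in D. *)
Fixpoint cup (g : nat -> pt -> 'F_2) (gs D : seq nat) (q : pt) : 'F_2 :=
  if gs is i0 :: gs' then
    \sum_(i <- D) (g i0 (inc q i) - g i0 q) * cup g gs' (rem i D) (inc q i)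
  else 1.

Lemma F2_add (x : 'F_2) : x + x = 0.
Proof. by apply: addrr_pchar2; exact: pchar_Fp. Qed.

Lemma F2_opp (x : 'F_2) : - x = x.
Proof. by apply/eqP; rewrite eq_sym -addr_eq0 F2_add. Qed.

(** Each unordered pair is counted twice. *)
Lemma sum_sym_pairs (D : seq nat) (w : nat -> nat -> 'F_2) : uniq D ->
  (forall i j, w i j = w j i) ->
  \sum_(i <- D) \sum_(j <- rem i D) w i j = 0.
Proof.
move=> uD ws; under eq_bigr do rewrite rem_filter // big_filter.
rewrite (eq_bigr (fun i => \sum_(j <- D | (j < i)%N) w i j +
   \sum_(j <- D | (i < j)%N) w i j)); last first.
  move=> i _; rewrite [LHS](bigID (fun j => (j < i)%N)) /=; congr (_ + _);
    apply: eq_bigl => j /=; lia.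
rewrite big_split /= [X in _ + X](exchange_big_dep xpredT) //=.
rewrite [X in _ + X](_ : _ = \sum_(i <- D) \sum_(j <- D | (j < i)%N) w i j).
  by rewrite F2_add.
by apply: eq_bigr => i _; apply: eq_bigr => j _; exact: ws.
Qed.

Lemma coboundaryK w D q : uniq D ->
  coboundary (coboundary w) D q = 0.
Proof.
move=> uD; rewrite /coboundary.
rewrite -[RHS](@sum_sym_pairs D (fun i j =>
  w (rem j (rem i D)) (inc (inc q i) j) - w (rem j (rem i D)) (inc q i)
  - (w (rem j (rem i D)) (inc q j) - w (rem j (rem i D)) q)) uD).
  by apply: eq_bigr => i _; rewrite -sumrB.
move=> i j.
have -> : rem j (rem i D) = rem i (rem j D).
  rewrite !rem_filter ?filter_uniq // -!filter_predI; apply: eq_filter => x /=.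
  by rewrite andbC.
by rewrite inc_comm !F2_opp; ring.
Qed.

(** The two claims depend on each other: the product rule for g i0 times a
    closed cochain, and closedness of a product of coboundaries. *)
Lemma cup_coboundary_closed g gs :
  (forall D q, uniq D -> size D = (size gs).+1 -> coboundary (cup g gs) D q = 0) /\
  (forall i0 D q, uniq D -> size D = (size gs).+1 -> cup g (i0 :: gs) D q =
     coboundary (fun D' q' => g i0 q' * cup g gs D' q') D q).
Proof.
have step hs : (forall D q, uniq D -> size D = (size hs).+1 ->
      coboundary (cup g hs) D q = 0) ->
    forall i0 D q, uniq D -> size D = (size hs).+1 -> cup g (i0 :: hs) D q =
     coboundary (fun D' q' => g i0 q' * cup g hs D' q') D q.
  move=> IH i0 D q uD sD; have := IH D q uD sD; rewrite /coboundary /= => H.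
  apply/eqP; rewrite -subr_eq0.
  rewrite (_ : _ - _ = - (g i0 q * \sum_(i <- D)
      (cup g hs (rem i D) (inc q i) - cup g hs (rem i D) q))).
    by rewrite H mulr0 oppr0.
  by rewrite -sumrB mulr_sumr -sumrN; apply: eq_bigr => i _; ring.
suff H : forall D q, uniq D -> size D = (size gs).+1 ->
    coboundary (cup g gs) D q = 0 by split => //; exact: step.
elim: gs => [|i0 gs IH] D q uD sD.
  by rewrite /coboundary /=; apply: big1 => i _; rewrite subrr.
rewrite -(coboundaryK (fun D' q' => g i0 q' * cup g gs D' q') q uD).
rewrite {1}/coboundary [RHS]/coboundary; apply: eq_big_seq => i iD.
have sr : size (rem i D) = (size gs).+1 by rewrite size_rem // sD.
by rewrite !(step _ IH) // rem_uniq.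
Qed.

Lemma cup_coboundary g i0 gs D q : uniq D -> size D = (size gs).+1 ->
  cup g (i0 :: gs) D q =
  coboundary (fun D' q' => g i0 q' * cup g gs D' q') D q.
Proof. by have [_] := cup_coboundary_closed g gs; apply. Qed.

(** The sum of w over the points of the box b + [0, p[^D; the coordinates in D
    of the base point b are overwritten. *)
Fixpoint lattice_sum (D : seq nat) (b : pt) (w : pt -> 'F_2) : 'F_2 :=
  if D is i :: D' then \sum_(k < p) lattice_sum D' (upd b i k) w else w b.

Lemma lattice_sumD D b w w' : lattice_sum D b (fun q => w q + w' q) =
  lattice_sum D b w + lattice_sum D b w'.
Proof.
elim: D b => [//|i D IH] b /=; rewrite -big_split; apply: eq_bigr => k _.
exact: IH.
Qed.

Lemma lattice_sum0 D b : lattice_sum D b (fun=> 0) = 0.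
Proof. by elim: D b => [//|i D IH] b /=; apply: big1. Qed.

Lemma lattice_sum_big (I : Type) (r : seq I) D b (w : I -> pt -> 'F_2) :
  lattice_sum D b (fun q => \sum_(i <- r) w i q) =
  \sum_(i <- r) lattice_sum D b (w i).
Proof.
elim: r => [|i r IH].
  rewrite big_nil -[RHS](lattice_sum0 D b); congr lattice_sum.
  by apply/funext => q; rewrite big_nil.
rewrite big_cons -IH -lattice_sumD; congr lattice_sum.
by apply/funext => q; rewrite big_cons.
Qed.

Lemma lattice_sum_neq0 D b w : lattice_sum D b w != 0 ->
  exists q, [/\ forall i, i \in D -> (q i < p)%N,
    forall i, i \notin D -> q i = b i & w q != 0].
Proof.
elim: D b => [|i D IH] b /=; first by exists b.
move=> H; have [k Hk] : exists k : 'I_p, lattice_sum D (upd b i k) w != 0.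
  apply: contrapT => nk; move/eqP: H; apply; apply: big1 => k _.
  by apply/eqP/negPn/negP => ?; apply: nk; exists k.
have [q [qD qb qw]] := IH _ Hk; exists q; split => // j.
  rewrite inE => /predU1P[->|]; last exact: qD.
  have [iD|iD] := boolP (i \in D); first exact: qD.
  by rewrite qb // /upd eqxx ltn_ord.
rewrite inE => /norP[ji jD]; rewrite qb // /upd (negbTE ji) //.
Qed.

Lemma eq_lattice_sum D b w w' :
  (forall q, (forall i, i \notin D -> q i = b i) -> w q = w' q) ->
  lattice_sum D b w = lattice_sum D b w'.
Proof.
elim: D b => [|i D IH] b /= H; first exact: H.
apply: eq_bigr => k _; apply: IH => q qb; apply: H => j.
rewrite inE => /norP[ji jD]; rewrite qb // /upd (negbTE ji) //.
Qed.

Lemma lattice_sum_inc D b w i k : i \notin D ->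
  lattice_sum D (upd b i k) (fun q => w (inc q i)) =
  lattice_sum D (upd b i k.+1) w.
Proof.
elim: D b k => [|j D IH] b k /=.
  move=> _; congr w; apply/funext => x; rewrite /inc /upd eqxx.
  by case: eqP.
rewrite inE => /norP[ij iD]; apply: eq_bigr => l _.
by rewrite (upd_comm _ _ _ ij) IH // (upd_comm _ _ _ ij).
Qed.

(** Stokes' formula in the direction i: only the two faces orthogonal to i
    remain. *)
Lemma lattice_sum_telescope D b w i : uniq D -> i \in D ->
  lattice_sum D b (fun q => w (inc q i) - w q) =
  lattice_sum (rem i D) (upd b i p) w - lattice_sum (rem i D) (upd b i 0) w.
Proof.
elim: D b => [//|j D IH] b /= /andP[jD uD]; rewrite inE eq_sym.
have [ij|ij] := eqVneq j i; last rewrite /=.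
  move=> _; subst j.
  rewrite -(telescope_sumr (fun k => lattice_sum D (upd b i k) w)) // big_mkord.
  apply: eq_bigr => k _; rewrite lattice_sumD -lattice_sum_inc //.
  congr (_ + _); rewrite F2_opp; apply: eq_lattice_sum => q _.
  by rewrite F2_opp.
move=> iD /=; rewrite -sumrB; apply: eq_bigr => k _; rewrite IH //.
by rewrite !(upd_comm _ _ _ ij).
Qed.

(** A label that is constant along a face has zero coboundary there. *)
Lemma cup_const g gs D q i c : i \in gs -> i \notin D -> q i = c ->
  (forall r, r i = c -> g i r = g i q) -> cup g gs D q = 0.
Proof.
elim: gs D q => [//|i0 gs IH] D q; rewrite inE => igs iD qc gc /=.
have incE j : j \in D -> inc q j i = c.
  move=> jD; rewrite /inc /upd; case: eqP => // ij.
  by rewrite ij jD in iD.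
rewrite big_seq; apply: big1 => j jD.
have [ii0|ii0] := eqVneq i i0.
  by rewrite -ii0 (gc (inc q j)) ?incE // subrr mul0r.
rewrite (negbTE ii0) /= in igs.
rewrite IH ?mulr0 ?incE //.
  by apply: contra iD; exact: mem_rem.
by move=> r rc; rewrite (gc r) // (gc (inc q j)) // incE.
Qed.

(** By Stokes' formula the sum over all cubes of the product of the coboundaries
    of the labels reduces to the boundary of the box. On the faces orthogonal to
    a direction other than i0 the product vanishes; on those orthogonal to i0 the
    label i0 is 0 or 1, which leaves the same sum in one dimension less. *)
Lemma kuhn_sum g D b : uniq D ->
  (forall i q, i \in D -> q i = 0%N -> g i q = 0) ->
  (forall i q, i \in D -> q i = p -> g i q = 1) ->
  lattice_sum D b (cup g D D) = 1.
Proof.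
elim: D b => [//|i0 D IH] b uD g0 g1.
have /andP[i0D uD'] := uD.
pose w (D' : seq nat) (q' : pt) := g i0 q' * cup g D D' q'.
rewrite (_ : cup g (i0 :: D) (i0 :: D) = coboundary w (i0 :: D)); last first.
  apply/funext => q; exact: cup_coboundary.
rewrite /coboundary lattice_sum_big big_cons [X in _ + X]big_seq big1 => [|i iD].
  rewrite addr0 lattice_sum_telescope ?mem_head // /= eqxx.
  rewrite -[RHS](IH (upd b i0 p)) //; last 2 first.
  - by move=> i q iD; apply: g0; rewrite inE iD orbT.
  - by move=> i q iD; apply: g1; rewrite inE iD orbT.
  rewrite [X in _ - X](_ : _ = 0) ?subr0.
    apply: eq_lattice_sum => q qb; rewrite /w g1 ?mul1r ?mem_head //.
    by rewrite qb // /upd eqxx.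
  rewrite -[RHS](lattice_sum0 D (upd b i0 0)); apply: eq_lattice_sum => q qb.
  by rewrite /w g0 ?mul0r ?mem_head // qb // /upd eqxx.
have iD0 : i \in i0 :: D by rewrite inE iD orbT.
rewrite lattice_sum_telescope //.
have H c : (c = 0%N) \/ (c = p) -> lattice_sum (rem i (i0 :: D)) (upd b i c)
    (w (rem i (i0 :: D))) = 0.
  move=> Hc; rewrite -[RHS](lattice_sum0 (rem i (i0 :: D)) (upd b i c)).
  have inr : i \notin rem i (i0 :: D).
    by rewrite rem_filter // mem_filter /= eqxx.
  apply: eq_lattice_sum => q qb.
  have qi : q i = c by rewrite qb // /upd eqxx.
  rewrite /w (@cup_const g D _ q i c) ?mulr0 // => r rc.
  case: Hc => Hc; first by rewrite !g0 // ?rc ?qi.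
  by rewrite !g1 // ?rc ?qi.
by rewrite !H ?subrr; [|left|right].
Qed.

Lemma cup_neq0 g gs D q : uniq D -> cup g gs D q != 0 -> forall i, i \in gs ->
  exists r r' : pt, [/\ forall k, (q k <= r k <= q k + (k \in D))%N,
    forall k, (q k <= r' k <= q k + (k \in D))%N & g i r != g i r'].
Proof.
elim: gs D q => [//|i0 gs IH] D q uD /= cn i igs.
have [j [jD gj cj]] : exists j, [/\ j \in D, g i0 (inc q j) != g i0 q &
    cup g gs (rem j D) (inc q j) != 0].
  apply: contrapT => nj; move/eqP: cn; apply; rewrite big_seq; apply: big1 => j jD.
  apply/eqP; rewrite mulf_eq0 subr_eq0; apply/negPn/negP; rewrite negb_or.
  by move=> /andP[? ?]; apply: nj; exists j.
have incq k : (q k <= inc q j k <= q k + (k \in D))%N.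
  rewrite /inc /upd; case: eqP => [->|_]; first by rewrite jD; lia.
  by lia.
move: igs; rewrite inE => /predU1P[->|igs].
  by exists (inc q j), q; split => // k; lia.
have [r [r' [rq r'q rr']]] := IH _ _ (rem_uniq j uD) cj i igs.
have bnd s k : (inc q j k <= s <= inc q j k + (k \in rem j D))%N ->
    (q k <= s <= q k + (k \in D))%N.
  rewrite /inc /upd mem_rem_uniq // inE /=; case: eqP => [->|_] /=.
    by rewrite jD; lia.
  by case: (k \in D); lia.
by exists r, r'; split => // k; exact: bnd.
Qed.

(** Kuhn's combinatorial lemma: since the total sum is 1, the product is nonzero
    on some cube, where therefore no label is constant. *)
Lemma kuhn (g : nat -> pt -> bool) (n : nat) :
  (forall i q, (i < n)%N -> q i = 0%N -> g i q = false) ->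
  (forall i q, (i < n)%N -> q i = p -> g i q = true) ->
  exists q : pt, (forall i, (i < n)%N -> (q i < p)%N) /\
    forall i, (i < n)%N -> exists r r' : pt,
    [/\ forall k, (q k <= r k <= (q k).+1)%N,
       forall k, (q k <= r' k <= (q k).+1)%N & g i r != g i r'].
Proof.
move=> g0 g1; pose gF i q : 'F_2 := (g i q)%:R.
have : lattice_sum (iota 0 n) (fun=> 0%N) (cup gF (iota 0 n) (iota 0 n)) = 1.
  apply: kuhn_sum; first exact: iota_uniq.
- by move=> i q; rewrite mem_iota /= add0n /gF => ? ?; rewrite g0.
- by move=> i q; rewrite mem_iota /= add0n /gF => ? ?; rewrite g1.
move=> e1; have := oner_neq0 'F_2; rewrite -e1 => /lattice_sum_neq0.
move=> [q [qp _ cn]]; exists q; split=> [i ni|i ni].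
  by apply: qp; rewrite mem_iota.
have [|r [r' [rq r'q rr']]] := cup_neq0 (iota_uniq _ _) cn (i := i).
  by rewrite mem_iota.
exists r, r'; split.
- by move=> k; have := rq k; case: (_ \in _) => /=; lia.
- by move=> k; have := r'q k; case: (_ \in _) => /=; lia.
- by apply: contra rr' => /eqP; rewrite /gF => ->.
Qed.
End Kuhn.

Section PM.
Context {R : realType}.

Lemma compact_rv_ball n (r : R) : compact [set a : 'rV[R]_n | `|a| <= r].
Proof.
apply: bounded_closed_compact.
  exists r; split; first exact: num_real.
  by move=> x rx a /= ar; apply: le_trans ar (ltW rx).
rewrite (_ : [set a | _] = closed_ball_ (fun x => `|x|) (0 : 'rV[R]_n) r).
  exact: closed_closed_ball_.
by apply/seteqP; split => a /=; rewrite /closed_ball_ /= sub0r normrN.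
Qed.

Lemma rv_ball n (x y : 'rV[R]_n) d : ball x d y <-> `|x - y| < d.
Proof. by rewrite -ball_normE. Qed.

(** Otherwise, by compactness, on every ball of some fixed radius d one component
    of F has a constant strict sign. Kuhn's lemma for the signs of F on a grid of
    step 2 / p < d gives a cube on which each component takes both signs. *)
Lemma poincare_miranda n (F : 'rV[R]_n -> 'rV[R]_n) :
  (forall a, `|a| <= 1 -> forall eta, 0 < eta -> exists2 d, 0 < d &
    forall b, `|b| <= 1 -> `|a - b| < d -> `|F a - F b| < eta) ->
  (forall (a : 'rV[R]_n) i, `|a| <= 1 -> a 0 i = 1 -> 0 < F a 0 i) ->
  (forall (a : 'rV[R]_n) i, `|a| <= 1 -> a 0 i = -1 -> F a 0 i < 0) ->
  exists2 a, `|a| <= 1 & F a = 0.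
Proof.
move=> Fc F1 FN1; apply: contrapT => nF.
pose K := [set a : 'rV[R]_n | `|a| <= 1].
pose P (A : set 'rV[R]_n) := exists i : 'I_n,
  (forall y, A y -> 0 < F y 0 i) \/ (forall y, A y -> F y 0 i < 0).
have [|x Kx|d d0 dP] := @lebesgue_number_set R _ K P (@compact_rv_ball n 1).
- by move=> A B AB [i [H|H]]; exists i; [left|right] => y /AB; exact: H.
- have [i Fi] : exists i, F x 0 i != 0.
    apply: contrapT => ni; apply: nF; exists x => //; apply/rowP => i.
    by rewrite mxE; apply/eqP/negPn/negP => Hi; apply: ni; exists i.
  have Fi0 : 0 < `|F x 0 i| by rewrite normr_gt0.
  have [d d0 dP] := Fc x Kx _ Fi0; exists d => //; exists i.
  have H y : (K `&` ball x d) y -> `|F x 0 i - F y 0 i| < `|F x 0 i|.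
    move=> [Ky /rv_ball xy]; apply: le_lt_trans (dP y Ky xy).
    by have := le_rv_norm (F x - F y) i; rewrite !mxE.
  have [Fp|Fn] := ltP 0 (F x 0 i); [left|right] => y /H.
    by rewrite (gtr0_norm Fp) ltr_norml; lra.
  by rewrite (ler0_norm Fn) ltr_norml; move: Fi; rewrite neq_lt; lra.
pose p := (Num.bound (2 / d)).+1.
have p0 : 0 < p%:R :> R by rewrite ltr0n.
have pd : 2 / p%:R < d.
  rewrite ltr_pdivrMr // mulrC -ltr_pdivrMr //.
  apply: (@lt_trans _ _ (Num.bound (2 / d))%:R); last by rewrite ltr_nat.
  by apply: archi_boundP; rewrite divr_ge0 // ltW.
pose pnt (q : nat -> nat) : 'rV[R]_n := \row_i (-1 + 2 * (minn (q i) p)%:R / p%:R).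
have Kpnt q : K (pnt q).
  apply: rv_norm_le => // i; rewrite mxE ler_norml.
  have : (minn (q i) p)%:R / p%:R <= 1 :> R.
    by rewrite ler_pdivrMr // mul1r ler_nat geq_minr.
  have : 0 <= (minn (q i) p)%:R / p%:R :> R by rewrite divr_ge0.
  rewrite -mulrA; lra.
pose g (i : nat) q : bool := if insub i is Some j then 0 < F (pnt q) 0 (j : 'I_n) else false.
have gE (i : 'I_n) q : g i q = (0 < F (pnt q) 0 i) by rewrite /g valK.
have [|i q ni qi|q [qp qP]] := @kuhn p g n.
- move=> i q ni qi; rewrite -[i]/(val (Ordinal ni)) gE.
  apply/negbTE; rewrite -leNgt ltW //; apply: FN1; first exact: Kpnt.
  by rewrite mxE /= qi min0n mulr0 mul0r addr0.
- rewrite -[i]/(val (Ordinal ni)) gE; apply: F1; first exact: Kpnt.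
  by rewrite mxE /= qi minnn mulfK ?gt_eqF //; lra.
have near r : (forall k, (q k <= r k <= (q k).+1)%N) -> ball (pnt q) d (pnt r).
  move=> qr; apply/rv_ball; apply: le_lt_trans pd.
  apply: rv_norm_le => [|i]; first by rewrite divr_ge0.
  rewrite !mxE.
  have -> : -1 + 2 * (minn (q i) p)%:R / p%:R - (-1 + 2 * (minn (r i) p)%:R / p%:R)
    = (2 / p%:R) * ((minn (q i) p)%:R - (minn (r i) p)%:R) :> R.
    by field; rewrite gt_eqF.
  rewrite normrM ger0_norm ?divr_ge0 // ler_piMr ?divr_ge0 //.
  rewrite distrC.
  have [e|e] : minn (r i) p = minn (q i) p \/ minn (r i) p = (minn (q i) p).+1.
    by have := qr i; lia.
  - by rewrite e subrr normr0.
  - by rewrite e -natr1 addrAC subrr add0r normr1.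
have [i H] := dP _ (Kpnt q).
have [r [r' [qr qr']]] := qP i (ltn_ord i); rewrite !gE => /eqP; apply.
have Hr := conj (Kpnt r) (near r qr); have Hr' := conj (Kpnt r') (near r' qr').
case: H => H; first by rewrite !H.
by rewrite !ltNge !ltW //; exact: H.
Qed.
End PM.

(** * Derivatives and first-order expansion of the dynamics *)

Section Derivatives.
Context {R : realType}.

Lemma is_deriveP (V W : normedModType R) (f : V -> W) (a v : V) (D : W) :
  is_derive a v f D <-> forall k, 0 < k -> exists2 d, 0 < d &
    forall h : R, `|h| < d -> `|f (a + h *: v) - f a - h *: D| <= k * `|h|.
Proof.
have qE h : h != 0 -> `|f (a + h *: v) - f a - h *: D| =
    `|h| * `|D - h^-1 *: (f (h *: v + a) - f a)|.
  move=> h0; rewrite -normrZ -normrN; congr `| _ |.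
  by rewrite scalerBr scalerA mulfV // scale1r opprB (addrC a).
split=> [[df dfE] k k0|H].
  have cv : (h^-1 *: ((f \o shift a) (h *: v) - f a)) @[h --> 0^'] --> D.
    by rewrite -dfE; exact: df.
  move/cvgrPdist_le : cv => /(_ k k0)[d /= d0 dP].
  exists d => // h hd; have [->|h0] := eqVneq h 0.
    by rewrite !scale0r addr0 !subrr !normr0 mulr0.
  rewrite qE // mulrC ler_pM2r ?normr_gt0 //.
  by apply: dP => //=; rewrite sub0r normrN.
have cv : (h^-1 *: ((f \o shift a) (h *: v) - f a)) @[h --> 0^'] --> D.
  apply/cvgrPdist_le => k k0; have [d d0 dP] := H k k0.
  exists d => // h /=; rewrite sub0r normrN => hd h0.
  by have := dP h hd; rewrite qE // mulrC ler_pM2r ?normr_gt0.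
by constructor; [apply/cvg_ex; exists D|exact: cvg_lim].
Qed.

Lemma is_derive1P (W : normedModType R) (f : R -> W) (t : R) (D : W) :
  is_derive t (1 : R) f D <-> forall k, 0 < k -> exists2 d, 0 < d &
    forall s : R, `|s - t| < d -> `|f s - f t - (s - t) *: D| <= k * `|s - t|.
Proof.
rewrite is_deriveP; split=> H k k0; have [d d0 dP] := H k k0; exists d => //.
  move=> s sd; have := dP _ sd; rewrite [(s - t) *: 1](_ : _ = s - t).
    by rewrite [t + _]addrC subrK.
  by rewrite /GRing.scale /= mulr1.
move=> h hd; have := dP (t + h); rewrite addrAC subrr add0r => /(_ hd).
by rewrite [h *: 1](_ : _ = h) // /GRing.scale /= mulr1.
Qed.

(** Stated for row vectors, for which identities between sums are checked
    coordinatewise by [ring]. *)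
Lemma is_derive_straddle n (x : R -> 'rV[R]_n) (t : R) (D : 'rV[R]_n) k :
  is_derive t (1 : R) x D -> 0 < k ->
  straddle (fun s s' => `|x s' - x s - (s' - s) *: D| <= k * (s' - s)) t.
Proof.
move=> /is_derive1P H k0; have [d d0 dP] := H k k0; exists d => // s s' ds st ts' s'd.
have [H1 H2] : `|s' - t| < d /\ `|s - t| < d.
  by split; rewrite ltr_norml; apply/andP; split; lra.
have := dP _ H1; have := dP _ H2.
rewrite (ger0_norm (_ : 0 <= s' - t)) ?subr_ge0 //.
rewrite (ler0_norm (_ : s - t <= 0)) ?subr_le0 //.
set A := x s - _ - _; set B := x s' - _ - _.
have -> : x s' - x s - (s' - s) *: D = B - A.
  by apply/rowP => i; rewrite /A /B !mxE; ring.
by have := ler_normB B A; lra.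
Qed.

End Derivatives.

Section Dynamics.
Context {R : realType} {n m : nat}.
Implicit Types (y : 'rV[R]_n) (o : 'rV[R]_m) (t T : R)
  (f : 'rV[R]_n -> 'rV[R]_m -> R -> 'rV[R]_n).

Definition phase_box (Rx Ru T : R) : set ('rV[R]_n * 'rV[R]_m * R) :=
  [set z | `|z.1.1| <= Rx /\ `|z.1.2| <= Ru /\ 0 <= z.2 <= T].

Lemma phase_box_compact Rx Ru T : compact (phase_box Rx Ru T).
Proof.
rewrite (_ : phase_box _ _ _ = ([set y | `|y| <= Rx] `*` [set o | `|o| <= Ru]) `*`
    `[0, T]).
  apply: compact_setX; last exact: segment_compact.
  by apply: compact_setX; exact: compact_rv_ball.
apply/seteqP; split => -[[y o] t] /=; rewrite in_itv /=.
  by move=> [? [? ?]].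
by move=> [[? ?] ?].
Qed.

Lemma phase_box_domain Rx Ru T : phase_box Rx Ru T `<=` dynamics_domain T.
Proof. by move=> z [_ [_ zT]]; rewrite /dynamics_domain /= in_itv. Qed.

Lemma within_unif_cont (X : pseudoMetricType R) (W : normedModType R) (K : set X)
    (g : X -> W) : compact K -> {within K, continuous g} ->
  forall eta, 0 < eta -> exists2 d, 0 < d &
    forall (a b : X), K a -> K b -> ball a d b -> `|g a - g b| < eta.
Proof.
move=> cK /subspace_continuousP gK eta eta0; apply: lebesgue_number => // x Kx.
have e2 : 0 < eta / 2 by rewrite divr_gt0.
have /cvgrPdist_lt/(_ _ e2) := gK x Kx.
move=> /nbhs_ballP[d /= d0 dP].
exists d => // a b Ka Kb xa xb.
have := dP _ xa Ka; have := dP _ xb Kb; have := ler_distD (g x) (g a) (g b).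
by rewrite (distrC (g a) (g x)); lra.
Qed.

Lemma within_bounded (X : pseudoMetricType R) (W : normedModType R) (K : set X)
    (g : X -> W) : compact K -> {within K, continuous g} ->
  exists2 M, 0 < M & forall z, K z -> `|g z| <= M.
Proof.
move=> cK gK; have := compact_bounded (continuous_compact gK cK).
move=> [M [_ MP]]; exists (Num.max 1 (M + 1)); first by rewrite lt_max ltr01.
move=> z Kz; apply: (MP _ _ (g z)); last by exists z.
by rewrite lt_max ltrDl ltr01 orbT.
Qed.

Lemma mulmx_norm_le (q : 'rV[R]_n) (A : 'M[R]_n) : `|q *m A| <= n%:R * `|A| * `|q|.
Proof.
apply: rv_norm_le => [|i]; first by rewrite !mulr_ge0.
rewrite mxE; apply: le_trans (ler_norm_sum _ _ _) _.
rewrite (_ : n%:R * `|A| * `|q| = \sum_(j < n) `|q| * `|A|).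
  apply: ler_sum => j _; rewrite normrM; apply: ler_pM => //; first exact: le_rv_norm.
  rewrite [leRHS]/Num.norm /= mx_normrE.
  exact: (le_bigmax _ (fun ij => `|A ij.1 ij.2|) (j, i)).
by rewrite sumr_const card_ord -mulr_natl; ring.
Qed.

Lemma phase_ball (y y' : 'rV[R]_n) (o o' : 'rV[R]_m) t t' d :
  `|y - y'| < d -> `|o - o'| < d -> `|t - t'| < d ->
  ball (y, o, t) d (y', o', t').
Proof. by move=> a b c; split => //=; split => /=; exact/rv_ball. Qed.

Lemma dynamics_bounded T f Rx Ru : C1_dynamics T f -> exists2 M, 0 < M &
  forall y o t, `|y| <= Rx -> `|o| <= Ru -> 0 <= t <= T -> `|f y o t| <= M.
Proof.
move=> [fc _ _ _ _].
have [M M0 MP] := within_bounded (@phase_box_compact Rx Ru T)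
  (continuous_subspaceW (@phase_box_domain Rx Ru T) fc).
by exists M => // y o t yR oR tT; apply: (MP (y, o, t)).
Qed.

Lemma dynamics_unif_cont T f Rx Ru : C1_dynamics T f -> forall eta, 0 < eta ->
  exists2 d, 0 < d & forall y y' o o' t t', `|y| <= Rx -> `|o| <= Ru ->
  0 <= t <= T -> `|y'| <= Rx -> `|o'| <= Ru -> 0 <= t' <= T ->
  `|y - y'| < d -> `|o - o'| < d -> `|t - t'| < d ->
  `|f y o t - f y' o' t'| < eta.
Proof.
move=> [fc _ _ _ _] eta eta0.
have [d d0 dP] := within_unif_cont (@phase_box_compact Rx Ru T)
  (continuous_subspaceW (@phase_box_domain Rx Ru T) fc) eta0.
exists d => // y y' o o' t t' ? ? ? ? ? ? a b c.
by apply: (dP (y, o, t) (y', o', t')) => //; exact: phase_ball.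
Qed.

Definition dfdx f y o t : 'M[R]_n := 'J (fun y' => f y' o t) y.

Lemma dfdx_bounded T f Rx Ru : C1_dynamics T f -> exists2 L, 0 < L &
  forall y o t (q : 'rV[R]_n), `|y| <= Rx -> `|o| <= Ru -> 0 <= t <= T ->
  `|q *m dfdx f y o t| <= L * `|q|.
Proof.
move=> [_ _ _ fc _].
have [M M0 MP] := within_bounded (@phase_box_compact Rx Ru T)
  (continuous_subspaceW (@phase_box_domain Rx Ru T) fc).
exists (n%:R * M + 1); first by rewrite ltr_wpDl // mulr_ge0 // ltW.
move=> y o t q yR oR tT; apply: le_trans (mulmx_norm_le _ _) _.
apply: ler_wpM2r => //; apply: (@le_trans _ _ (n%:R * M)); last by rewrite lerDl.
by apply: ler_wpM2l => //; apply: (MP (y, o, t)).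
Qed.

Lemma line_MVT (g dg : R -> R) C : (forall s, is_derive s (1 : R) g (dg s)) ->
  (forall s, 0 <= s <= 1 -> `|dg s| <= C) -> `|g 1 - g 0| <= C.
Proof.
move=> gd dgC; have [|c] := @MVT_segment R g dg 0 1 ler01 (fun s _ => gd s).
  by apply: derivable_within_continuous => s _; case: (gd s).
by rewrite in_itv /= subr0 mulr1 => c01 ->; exact: dgC.
Qed.

(** Mean value inequality along the segment from y to y', for the function
    y |-> f y o t - y *m A. *)
Lemma dynamics_increment T f y y' o t (A : 'M[R]_n) C : C1_dynamics T f ->
  0 <= t <= T -> 0 <= C ->
  (forall s, 0 <= s <= 1 ->
    `|(y' - y) *m (dfdx f (y + s *: (y' - y)) o t - A)| <= C) ->
  `|f y' o t - f y o t - (y' - y) *m A| <= C.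
Proof.
move=> [_ fd _ _ _] tT C0 H; set h := y' - y.
have tT' : t \in `[0, T] by rewrite in_itv.
apply: rv_norm_le => // i.
pose g s := f (y + s *: h) o t 0 i - s * (h *m A) 0 i.
have gd s : is_derive s (1 : R) g
    ((h *m (dfdx f (y + s *: h) o t - A)) 0 i).
  apply/is_derive1P => k k0.
  have df := fd (y + s *: h) o t tT'.
  have /is_deriveP/(_ k k0)[d d0 dP] : is_derive (y + s *: h) h
      (fun y' => f y' o t) (h *m dfdx f (y + s *: h) o t).
    by constructor; [exact: diff_derivable|exact: deriveEjacobian].
  exists d => // r rd; have := dP _ rd.
  have -> : y + s *: h + (r - s) *: h = y + r *: h.
    by rewrite -addrA -scalerDl [s + _]addrC subrK.
  apply: le_trans; rewrite /g.
  set P := f _ o t; set Q := f _ o t.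
  apply: le_trans (le_rv_norm _ i); rewrite mulmxBr !mxE.
  by rewrite le_eqVlt; apply/orP; left; apply/eqP; congr `| _ |;
    rewrite /GRing.scale /=; ring.
have := line_MVT gd (C := C) _.
rewrite /g scale1r scale0r mul0r mul1r subr0 addr0 /h [y + _]addrC subrK => K.
rewrite !mxE -[X in `|X|](_ : f y' o t 0 i - (h *m A) 0 i - f y o t 0 i = _).
  by apply: K => s s01; apply: le_trans (le_rv_norm _ i) (H s s01).
by rewrite /h !mxE; ring.
Qed.

Lemma box_segment Rx y y' s : `|y| <= Rx -> `|y'| <= Rx -> 0 <= s <= 1 ->
  `|y + s *: (y' - y)| <= Rx.
Proof.
move=> yR yR' /andP[s0 s1].
have -> : y + s *: (y' - y) = (1 - s) *: y + s *: y'.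
  by apply/rowP => i; rewrite !mxE; ring.
apply: le_trans (ler_normD _ _) _; rewrite !normrZ.
rewrite (ger0_norm s0) (ger0_norm (_ : 0 <= 1 - s)) ?subr_ge0 //.
have := ler_wpM2l s0 yR'; have s10 : 0 <= 1 - s by rewrite subr_ge0.
have := ler_wpM2l s10 yR; lra.
Qed.

Lemma dynamics_lipschitz T f Rx Ru : C1_dynamics T f -> exists2 L, 0 < L &
  (forall y y' o t, `|y| <= Rx -> `|y'| <= Rx -> `|o| <= Ru -> 0 <= t <= T ->
    `|f y' o t - f y o t| <= L * `|y' - y|) /\
  (forall y o t (q : 'rV[R]_n), `|y| <= Rx -> `|o| <= Ru -> 0 <= t <= T ->
    `|q *m dfdx f y o t| <= L * `|q|).
Proof.
move=> fC; have [L L0 LP] := dfdx_bounded Rx Ru fC; exists L => //.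
split => // y y' o t yR yR' oR tT.
have := @dynamics_increment T f y y' o t 0 (L * `|y' - y|) fC tT.
rewrite mulmx0 subr0; apply; first by rewrite mulr_ge0 // ltW.
by move=> s s01; rewrite subr0; apply: LP => //; exact: box_segment.
Qed.

(** The differential is taken at the control o and the increment at a nearby
    control o': in the deviation estimate o is the reference control and o' the
    sampled one. *)
Lemma dynamics_expansion T f Rx Ru : C1_dynamics T f -> forall eta, 0 < eta ->
  exists2 d, 0 < d & forall y y' o o' t, `|y| <= Rx -> `|y'| <= Rx ->
  `|o| <= Ru -> `|o'| <= Ru -> 0 <= t <= T -> `|y' - y| < d -> `|o' - o| < d ->
  `|f y' o' t - f y o' t - (y' - y) *m dfdx f y o t| <= eta * `|y' - y|.
Proof.
move=> fC eta eta0; have [_ _ _ fc _] := fC.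
have en : 0 < eta / (n%:R + 1) by rewrite divr_gt0 // ltr_wpDl.
have [d d0 dP] := within_unif_cont (@phase_box_compact Rx Ru T)
  (continuous_subspaceW (@phase_box_domain Rx Ru T) fc) en.
exists d => // y y' o o' t yR yR' oR oR' tT yd od.
apply: (dynamics_increment fC tT); first by rewrite mulr_ge0 // ltW.
move=> s s01; apply: le_trans (mulmx_norm_le _ _) _.
apply: ler_wpM2r => //.
have : `|dfdx f (y + s *: (y' - y)) o' t - dfdx f y o t| < eta / (n%:R + 1).
  apply: (dP (y + s *: (y' - y), o', t) (y, o, t)) => /=.
  - by split => //=; exact: box_segment.
  - by split.
  - apply: phase_ball => //; last by rewrite subrr normr0.
    rewrite addrAC subrr add0r normrZ; apply: le_lt_trans yd.
    by case/andP: s01 => s0 s1; rewrite ger0_norm // ler_piMl.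
move=> /ltW/(ler_wpM2l (ler0n R n)) /le_trans; apply.
rewrite mulrA ler_pdivrMr ?ltr_wpDl // mulrC ler_pM2l // lerDl //.
Qed.

End Dynamics.

(** * Trajectories of piecewise constant controls *)

Section Clamp.
Context {R : realType}.

Definition clamp (a b t : R) : R := Num.max a (Num.min t b).

Lemma clamp_itv a b t : a <= b -> a <= clamp a b t <= b.
Proof.
by move=> ab; rewrite /clamp le_max lexx /= ge_max ab ge_min lexx orbT.
Qed.

Lemma clamp_id a b t : a <= t <= b -> clamp a b t = t.
Proof. by move=> /andP[at_ tb]; rewrite /clamp (min_idPl tb) (max_idPr at_). Qed.

Lemma clamp_homo a b s t : a <= b -> s <= t ->
  clamp a b s <= clamp a b t /\ clamp a b t - clamp a b s <= t - s.
Proof.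
move=> ab st; rewrite /clamp.
by case: (leP t b) => tb; case: (leP s b) => sb; rewrite /Num.max;
  do ?case: ltP => ?; split; lra.
Qed.

Lemma clamp_dist a b s t : a <= b -> `|clamp a b s - clamp a b t| <= `|s - t|.
Proof.
move=> ab; wlog st : s t / s <= t.
  move=> H; have [st|/ltW ts] := leP s t; first exact: H.
  by rewrite distrC [leRHS]distrC; exact: H.
rewrite [leRHS]ler0_norm ?subr_le0 // opprB.
have [h1 h2] := clamp_homo ab st; rewrite ler0_norm ?opprB ?subr_le0 //.
Qed.

(** The nearest-point projection onto the box of radius r for the sup norm. It is
    1-Lipschitz, so that composing with it makes the dynamics globally bounded and
    Lipschitz in the state. *)
Definition clampv n (r : R) (y : 'rV[R]_n) : 'rV[R]_n :=
  \row_i clamp (- r) r (y 0 i).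

Lemma clampv_norm n r (y : 'rV[R]_n) : 0 <= r -> `|clampv r y| <= r.
Proof.
move=> r0; apply: rv_norm_le => // i; rewrite mxE ler_norml clamp_itv //; lra.
Qed.

Lemma clampv_id n r (y : 'rV[R]_n) : `|y| <= r -> clampv r y = y.
Proof.
move=> yr; apply/rowP => i; rewrite mxE clamp_id // -ler_norml.
exact: le_trans (le_rv_norm y i) yr.
Qed.

Lemma clampv_dist n r (y y' : 'rV[R]_n) : 0 <= r ->
  `|clampv r y - clampv r y'| <= `|y - y'|.
Proof.
move=> r0; apply: rv_norm_le => // i; rewrite !mxE.
apply: le_trans (clamp_dist _ _ _) _; first by lra.
by have := le_rv_norm (y - y') i; rewrite !mxE.
Qed.

End Clamp.

Section Picard.
Context {R : realType} {n : nat}.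
Implicit Types (p h : R -> 'rV[R]_n).

(** Stated coordinatewise, as needed by the mean value theorem. *)
Definition primitive (a : R) p h := forall i t, a <= t ->
  is_derive t (1 : R) (fun s => p s 0 i) (h t 0 i).

(** The integral starts from a - 1 in order to be differentiable at a too. *)
Lemma primitive_exists (a : R) h : continuous h -> exists p, primitive a p h.
Proof.
move=> ch; pose F i (x : R) : R :=
  (\int[lebesgue_measure]_(t in `[a - 1, x]) (h t 0 i))%R.
exists (fun x => \row_i F i x) => i t at_.
have chi : continuous (fun s => h s 0 i).
  move=> s; apply: (@continuous_comp _ _ _ h (fun M : 'rV[R]_n => M 0 i)).
    exact: ch.
  exact: coord_continuous.
have -> : (fun s => (\row_i F i s) 0 i) = F i by apply/funext => s; rewrite mxE.
have tt1 : t < t + 1 by rewrite ltrDl.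
have := @continuous_FTC1_closed R (fun s => h s 0 i) (a - 1) t (t + 1) tt1.
case.
- apply: continuous_compact_integrable; first exact: segment_compact.
  exact: continuous_subspaceT.
- by lra.
- exact: chi.
by move=> Fd Fh; apply: DeriveDef; [exact: Fd|rewrite -derive1E Fh].
Qed.

Lemma primitive_le a p h C s t : primitive a p h -> a <= s -> s <= t ->
  (forall r, s <= r <= t -> `|h r| <= C) -> `|p t - p s| <= C * (t - s).
Proof.
move=> ph as_ st hC.
have C0 : 0 <= C by apply: le_trans (normr_ge0 (h s)) (hC s _); rewrite lexx st.
apply: rv_norm_le => [|i]; first by rewrite mulr_ge0 // subr_ge0.
have d r : r \in `]s, t[ -> is_derive r (1 : R) (fun s => p s 0 i) (h r 0 i).
  by rewrite in_itv /= => /andP[sr _]; apply: ph; lra.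
have [|c ct] := MVT_segment st d.
  apply: derivable_within_continuous => r; rewrite in_itv /= => /andP[sr _].
  by case: (ph i r (le_trans as_ sr)).
rewrite !mxE => ->; rewrite normrM (ger0_norm (_ : 0 <= t - s)) ?subr_ge0 //.
rewrite ler_wpM2r ?subr_ge0 //; apply: le_trans (le_rv_norm _ _) _.
by apply: hC; rewrite in_itv in ct.
Qed.

Lemma primitiveB a p p' h h' : primitive a p h -> primitive a p' h' ->
  primitive a (fun t => p t - p' t) (fun t => h t - h' t).
Proof.
move=> ph ph' i t at_; have H := ph i t at_; have H' := ph' i t at_.
rewrite mxE [X in is_derive _ _ _ (_ + X)]mxE.
have -> : (fun s => (p s - p' s) 0 i) = (fun s => p s 0 i) - (fun s => p' s 0 i).
  by apply/funext => s; rewrite !mxE.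
exact: is_deriveB.
Qed.

Lemma primitive_line (v : 'rV[R]_n) a : primitive a (fun t => t *: v) (fun=> v).
Proof.
move=> i t _; apply/is_derive1P => k k0; exists 1 => // s _.
by rewrite !mxE /GRing.scale /= -!mulrBl subrr mul0r normr0 mulr_ge0 // ltW.
Qed.

(** The limit is found in each coordinate as the supremum of the lower bounds
    y k - 2 B / 2 ^ k, which increase with k. *)
Lemma half_cauchy_limit (B : R) (y : nat -> 'rV[R]_n) : 0 <= B ->
  (forall k, `|y k.+1 - y k| <= B / 2 ^+ k) ->
  exists z, forall k, `|z - y k| <= 2 * B / 2 ^+ k.
Proof.
move=> B0 yB.
pose lo i k := y k 0 i - 2 * B / 2 ^+ k; pose hi i k := y k 0 i + 2 * B / 2 ^+ k.
have p0 k : 0 < 2 ^+ k :> R by rewrite exprn_gt0.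
have Bk k : 2 * B / 2 ^+ k = 2 * (2 * B / 2 ^+ k.+1).
  by rewrite exprS; field; rewrite gt_eqF.
have Bk' k : B / 2 ^+ k = 2 * B / 2 ^+ k.+1.
  by rewrite exprS; field; rewrite gt_eqF.
have st i k : `|y k.+1 0 i - y k 0 i| <= B / 2 ^+ k.
  by apply: le_trans (yB k); have := le_rv_norm (y k.+1 - y k) i; rewrite !mxE.
have lom i : {homo lo i : j k / (j <= k)%N >-> j <= k}.
  apply: homo_leq => // [a b c|k]; first exact: le_trans.
  by have := st i k; rewrite (Bk' k) ler_norml /lo (Bk k); lra.
have him i : {homo hi i : j k / (j <= k)%N >-> k <= j}.
  apply: homo_leq => // [a b c ab bc|k]; first exact: le_trans bc ab.
  by have := st i k; rewrite (Bk' k) ler_norml /hi (Bk k); lra.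
have lohi i j k : lo i j <= hi i k.
  apply: (@le_trans _ _ (lo i (maxn j k))); first by apply: lom; exact: leq_maxl.
  apply: (@le_trans _ _ (hi i (maxn j k))); last by apply: him; exact: leq_maxr.
  have : 0 <= 2 * B / 2 ^+ (maxn j k) by rewrite divr_ge0 ?mulr_ge0 // ltW.
  by rewrite /lo /hi; lra.
exists (\row_i sup (range (lo i))) => k.
apply: rv_norm_le => [|i]; first by rewrite divr_ge0 ?mulr_ge0 // ltW.
rewrite !mxE ler_norml; apply/andP; split.
  have : lo i k <= sup (range (lo i)).
    apply: ub_le_sup; last by exists k.
    by exists (hi i 0%N) => _ [j _ <-].
  by rewrite /lo; lra.
have : sup (range (lo i)) <= hi i k.
  by apply: ge_sup; [exists (lo i 0%N), 0%N|move=> _ [j _ <-]].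
by rewrite /hi; lra.
Qed.


Lemma half_pow_small (C e : R) : 0 < e -> exists k, C / 2 ^+ k < e.
Proof.
move=> e0; have p0 k : 0 < 2 ^+ k :> R by rewrite exprn_gt0.
have C0 : 0 <= Num.max C 0 / e by rewrite divr_ge0 ?(ltW e0) // le_max lexx orbT.
exists (Num.bound (Num.max C 0 / e)); rewrite ltr_pdivrMr //.
have := archi_boundP C0; rewrite ltr_pdivrMr // => H.
apply: (@le_lt_trans _ _ (Num.max C 0)); first by rewrite le_max lexx.
apply: lt_le_trans H _; rewrite mulrC ler_pM2l // -natrX ler_nat.
exact/ltnW/ltn_expl.
Qed.

Lemma le_half_pow (C x : R) : (forall k, x <= C / 2 ^+ k) -> x <= 0.
Proof.
move=> H; rewrite leNgt; apply/negP => x0; have [k kx] := half_pow_small C x0.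
by have := H k; rewrite leNgt kx.
Qed.

Lemma le_half_powD (C x z : R) : (forall k, x <= z + C / 2 ^+ k) -> x <= z.
Proof.
move=> H; rewrite -subr_le0; apply: (@le_half_pow C) => k.
by rewrite lerBlDl.
Qed.

(** On an interval so short that L (b - a) <= 1 / 2, the map sending y to the
    primitive of s |-> g (y s) s halves uniform distances. Time is projected to
    [a, b] so that all iterates are defined and Lipschitz on the whole line. *)
Lemma picard (g : 'rV[R]_n -> R -> 'rV[R]_n) (a b M L : R) ya :
  a <= b -> 0 <= L -> L * (b - a) <= 1 / 2 -> (forall y t, `|g y t| <= M) ->
  (forall y y' t, `|g y t - g y' t| <= L * `|y - y'|) ->
  (forall y t eta, 0 < eta -> exists2 d, 0 < d & forall y' t',
     `|y - y'| < d -> `|t - t'| < d -> `|g y t - g y' t'| < eta) ->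
  exists y : R -> 'rV[R]_n, [/\ y a = ya,
    forall s t, `|y s - y t| <= M * `|s - t| &
    forall t, a < t < b -> is_derive t (1 : R) y (g (y t) t)].
Proof.
move=> ab L0 Lab gM gL gc.
have M0 : 0 <= M by apply: le_trans (gM ya a).
pose isLip (y : R -> 'rV[R]_n) := forall s t, `|y s - y t| <= M * `|s - t|.
have unif y : isLip y -> forall t eta, 0 < eta -> exists2 d, 0 < d &
    forall s, `|t - s| < d -> `|g (y t) t - g (y s) s| < eta.
  move=> ly t eta eta0; have [d d0 dP] := gc (y t) t eta eta0.
  have M1 : 0 < M + 1 by rewrite ltr_wpDl.
  exists (Num.min d (d / (M + 1))); first by rewrite lt_min d0 divr_gt0.
  move=> s; rewrite lt_min ltr_pdivlMr // => /andP[s1 s2]; apply: dP => //.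
  apply: le_lt_trans (ly t s) _; apply: le_lt_trans s2.
  by rewrite mulrC ler_wpM2l // lerDl.
have hc y : isLip y -> continuous (fun s => g (y s) s).
  move=> ly t; apply/cvgrPdist_lt => eta eta0; have [d d0 dP] := unif y ly t eta eta0.
  by exists d => //= s; exact: dP.
have /choice[P PP] (y : R -> 'rV[R]_n) :
    exists p, isLip y -> primitive a p (fun s => g (y s) s).
  have [ly|ly] := pselect (isLip y); last by exists y.
  by have [p pP] := primitive_exists a (hc y ly); exists p.
pose c t := clamp a b t.
have cab t : a <= c t <= b by exact: clamp_itv.
have cE t : a <= t <= b -> c t = t by exact: clamp_id.
have cm s t : s <= t -> c s <= c t /\ c t - c s <= t - s by exact: clamp_homo.
pose Phi y t := ya + (P y (c t) - P y a).
have PhiLip y : isLip y -> isLip (Phi y).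
  move=> ly; suff H s t : s <= t -> `|Phi y t - Phi y s| <= M * (t - s).
    move=> s t; have [st|/ltW ts] := leP s t.
      by rewrite distrC [X in M * X]distrC (ger0_norm (_ : 0 <= t - s)) ?subr_ge0 // H.
    by rewrite (ger0_norm (_ : 0 <= s - t)) ?subr_ge0 // H.
  move=> st; have [cst cst'] := cm _ _ st.
  have -> : Phi y t - Phi y s = P y (c t) - P y (c s).
    by rewrite /Phi; apply/rowP => i; rewrite !mxE; ring.
  have /andP[as_ _] := cab s.
  apply: le_trans (primitive_le (PP y ly) as_ cst (C := M) _) _.
    by move=> r _; exact: gM.
  exact: ler_wpM2l.
have Phic y y' C : isLip y -> isLip y' -> (forall t, `|y t - y' t| <= C) ->
    forall t, `|Phi y t - Phi y' t| <= C / 2.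
  move=> ly ly' yC t; have /andP[at_ tb] := cab t.
  have C0 : 0 <= C by apply: le_trans (yC a).
  have := primitive_le (primitiveB (PP y ly) (PP y' ly')) (lexx a) at_ (C := L * C) _.
  have -> : P y (c t) - P y' (c t) - (P y a - P y' a) = Phi y t - Phi y' t.
    by rewrite /Phi; apply/rowP => i; rewrite !mxE; ring.
  move=> /(_ _)/le_trans; apply.
    by move=> r _; apply: le_trans (gL _ _ _) _; rewrite ler_wpM2l.
  apply: (@le_trans _ _ (L * C * (b - a))).
    by rewrite ler_wpM2l ?mulr_ge0 // lerD2r.
  have := ler_wpM2r C0 Lab; lra.
pose Y k := iter k Phi (fun=> ya).
have YL k : isLip (Y k).
  elim: k => [|k IH]; last exact: PhiLip.
  by move=> s t; rewrite /= subrr normr0 mulr_ge0.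
pose B := M * (b - a).
have B0 : 0 <= B by rewrite mulr_ge0 // subr_ge0.
have YB k t : `|Y k.+1 t - Y k t| <= B / 2 ^+ k.
  elim: k t => [|k IH] t.
    rewrite expr0 divr1 /= /Phi addrAC subrr add0r.
    have /andP[at_ tb] := cab t.
    apply: le_trans (primitive_le (PP _ (YL 0%N)) (lexx a) at_ (C := M) _) _.
      by move=> r _; exact: gM.
    by rewrite ler_wpM2l // lerD2r.
  have -> : B / 2 ^+ k.+1 = B / 2 ^+ k / 2.
    by rewrite exprSr; field; rewrite expf_neq0.
  exact: (Phic (Y k.+1) (Y k)).
have /choice[z zP] t := half_cauchy_limit B0 (fun k => YB k t).
exists z.
have zL : isLip z.
  move=> s t; apply: (@le_half_powD (4 * B)) => k.
  have -> : z s - z t = (z s - Y k s) - (z t - Y k t) + (Y k s - Y k t).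
    by apply/rowP => i; rewrite !mxE; ring.
  have := ler_normD (z s - Y k s - (z t - Y k t)) (Y k s - Y k t).
  have := ler_normB (z s - Y k s) (z t - Y k t).
  by have := zP s k; have := zP t k; have := YL k s t; lra.
have zinc s t v eta : a <= s -> s <= t -> t <= b ->
    (forall r, s <= r <= t -> `|g (z r) r - v| <= eta) ->
    `|z t - z s - (t - s) *: v| <= eta * (t - s).
  move=> as_ st tb H.
  have eta0 : 0 <= eta by apply: le_trans (H s _); rewrite // lexx st.
  apply: (@le_half_powD (4 * B + L * (2 * B) * (t - s))) => k.
  have Ck r : s <= r <= t -> `|g (Y k r) r - v| <= eta + L * (2 * B / 2 ^+ k).
    move=> rst; have := gL (Y k r) (z r) r; have := H r rst.
    have := ler_wpM2l L0 (zP r k); rewrite distrC.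
    have := ler_normD (g (Y k r) r - g (z r) r) (g (z r) r - v).
    by rewrite addrA subrK; lra.
  have := primitive_le (primitiveB (PP _ (YL k)) (@primitive_line v a)) as_ st Ck.
  set q := P (Y k) t - t *: v - _.
  have -> : z t - z s - (t - s) *: v = (z t - Y k.+1 t) - (z s - Y k.+1 s) + q.
    rewrite /q /= /Phi !cE; last 2 first.
    - by rewrite as_ (le_trans st).
    - by rewrite tb (le_trans as_).
    by apply/rowP => i; rewrite !mxE; ring.
  have := ler_normD (z t - Y k.+1 t - (z s - Y k.+1 s)) q.
  have := ler_normB (z t - Y k.+1 t) (z s - Y k.+1 s).
  have := zP t k.+1; have := zP s k.+1.
  have -> : 2 * B / 2 ^+ k.+1 = B / 2 ^+ k.
    by rewrite exprS; field; rewrite expf_neq0.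
  have -> : (4 * B + L * (2 * B) * (t - s)) / 2 ^+ k =
     4 * (B / 2 ^+ k) + L * (2 * B / 2 ^+ k) * (t - s) by ring.
  have : 0 <= B / 2 ^+ k by rewrite divr_ge0 // exprn_ge0.
  rewrite mulrDl; lra.
split => //.
  apply/eqP; rewrite -subr_eq0 -normr_le0; apply: (@le_half_pow (2 * B)) => k.
  have := zP a k; suff -> : Y k a = ya by [].
  by case: k => [//|k]; rewrite /= /Phi cE ?lexx // subrr addr0.
move=> t /andP[at_ tb]; apply/is_derive1P => k k0.
have [d d0 dP] := unif z zL t k k0.
exists (Num.min d (Num.min (t - a) (b - t))).
  by rewrite !lt_min d0 !subr_gt0 at_.
move=> s; rewrite !lt_min => /and3P[sd sa sb].
move: sa sb; rewrite !ltr_norml => /andP[sa _] /andP[_ sb].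
move: sd; rewrite ltr_norml => /andP[sd1 sd2].
have [ts|/ltW st] := leP t s.
  rewrite (ger0_norm (_ : 0 <= s - t)) ?subr_ge0 //.
  apply: zinc; [by move: at_ tb sa sb ts; clear; lra..|]; move=> r /andP[r1 r2].
  by rewrite distrC; apply/ltW/dP; rewrite ltr_norml; apply/andP; split; lra.
rewrite (ler0_norm (_ : s - t <= 0)) ?subr_le0 // opprB.
have -> : z s - z t - (s - t) *: g (z t) t = - (z t - z s - (t - s) *: g (z t) t).
  by apply/rowP => i; rewrite !mxE; ring.
rewrite normrN; apply: zinc; [by move: at_ tb sa sb st; clear; lra..|]; move=> r /andP[r1 r2].
by rewrite distrC; apply/ltW/dP; rewrite ltr_norml; apply/andP; split; lra.
Qed.

End Picard.

Section PiecewiseODE.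
Context {R : realType}.

Lemma is_derive_local (W : normedModType R) (f g : R -> W) t D d : 0 < d ->
  (forall s, `|s - t| < d -> f s = g s) ->
  is_derive t (1 : R) f D -> is_derive t (1 : R) g D.
Proof.
move=> d0 fg /is_derive1P H; apply/is_derive1P => k k0.
have [e e0 eP] := H k k0; exists (Num.min d e); first by rewrite lt_min d0.
move=> s; rewrite lt_min => /andP[sd se]; rewrite -!fg ?subrr ?normr0 //.
exact: eP.
Qed.

(** Solutions on successive cells are glued together. The derivative is only
    claimed inside the cells. *)
Lemma pc_ode n m T (f : 'rV[R]_n -> 'rV[R]_m -> R -> 'rV[R]_n) (x0 : 'rV[R]_n)
    Rx Ru M L (N : nat) (tau : nat -> R) (V : nat -> 'rV[R]_m) :
  C1_dynamics T f -> 0 <= T -> 0 <= Rx -> 0 <= L ->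
  (forall y o t, `|y| <= Rx -> `|o| <= Ru -> 0 <= t <= T -> `|f y o t| <= M) ->
  (forall y y' o t, `|y| <= Rx -> `|y'| <= Rx -> `|o| <= Ru -> 0 <= t <= T ->
    `|f y' o t - f y o t| <= L * `|y' - y|) ->
  0 <= tau 0%N -> tau N <= T ->
  (forall i, (i < N)%N -> tau i <= tau i.+1 /\ L * (tau i.+1 - tau i) <= 1 / 2) ->
  (forall i, `|V i| <= Ru) ->
  exists y : R -> 'rV[R]_n, [/\ y (tau 0%N) = x0,
    forall s t, `|y s - y t| <= M * `|s - t| &
    forall i t, (i < N)%N -> tau i < t < tau i.+1 ->
      is_derive t (1 : R) y (f (clampv Rx (y t)) (V i) t)].
Proof.
move=> fC T0 Rx0 L0 fM fL tau0 + + VR.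
have Ru0 : 0 <= Ru by apply: le_trans (VR 0%N).
have M0 : 0 <= M.
  by apply: le_trans (fM 0 0 0 _ _ _) => //; rewrite ?normr0 ?lexx.
elim: N => [|N IH] tauT tauL.
  exists (fun=> x0); split => // s t; by rewrite subrr normr0 mulr_ge0.
have taum i j : (i <= j)%N -> (j <= N.+1)%N -> tau i <= tau j.
  move=> ij jN; elim: j ij jN => [|j IHj]; first by rewrite leqn0 => /eqP->.
  rewrite leq_eqVlt => /predU1P[->//|ij] jN.
  by apply: le_trans (IHj ij (ltnW jN)) _; have [] := tauL j jN.
have [tNN tLN] := tauL N (ltnSn N).
have [|i iN|y [y0 yL yD]] := IH.
- exact: le_trans tNN tauT.
- by apply: tauL; exact: ltnW.
pose g z t := f (clampv Rx z) (V N) (clamp 0 T t).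
have [||||w [w0 wL wD]] := @picard R n g (tau N) (tau N.+1) M L (y (tau N)) tNN L0.
- exact: tLN.
- by move=> z t; apply: fM; rewrite ?clampv_norm ?clamp_itv.
- move=> z z' t; apply: le_trans (fL _ _ _ _ _ _ _ _) _; rewrite ?clampv_norm ?clamp_itv //.
  by rewrite ler_wpM2l // clampv_dist.
- move=> z t eta eta0; have [d d0 dP] := dynamics_unif_cont Rx Ru fC eta0.
  exists d => // z' t' zd td; apply: dP; rewrite ?clampv_norm ?clamp_itv //.
  + by apply: le_lt_trans zd; exact: clampv_dist.
  + by rewrite subrr normr0.
  + by apply: le_lt_trans td; exact: clamp_dist.
pose q t := if t <= tau N then y t else w t.
have t0N : tau 0%N <= tau N by exact: taum.
exists q; split; first by rewrite /q t0N.
- suff H s t : s <= t -> `|q s - q t| <= M * (t - s).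
    move=> s t; have [st|/ltW ts] := leP s t.
      by rewrite [`|s - t|]distrC (ger0_norm (_ : 0 <= t - s)) ?subr_ge0 // H.
    by rewrite distrC (ger0_norm (_ : 0 <= s - t)) ?subr_ge0 // H.
  move=> st; rewrite /q; have [tN|Nt] := leP t (tau N).
    rewrite (le_trans st tN); have := yL s t.
    by rewrite [`|s - t|]distrC (ger0_norm (_ : 0 <= t - s)) ?subr_ge0.
  have [sN|Ns] := leP s (tau N).
    have := yL s (tau N); have := wL (tau N) t; rewrite w0.
    rewrite [`|tau N - t|]distrC (gtr0_norm (_ : 0 < t - tau N)) ?subr_gt0 //.
    rewrite [`|s - tau N|]distrC (ger0_norm (_ : 0 <= tau N - s)) ?subr_ge0 //.
    by have := ler_distD (y (tau N)) (y s) (w t); lra.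
  have := wL s t.
  by rewrite [`|s - t|]distrC (ger0_norm (_ : 0 <= t - s)) ?subr_ge0.
- move=> i t; rewrite ltnS leq_eqVlt => /predU1P[->|iN] /andP[t1 t2].
    have tT : 0 <= t <= T.
      by apply/andP; split; [have := le_trans tau0 t0N; lra|lra].
    have -> : q t = w t by rewrite /q leNgt t1.
    apply: (@is_derive_local _ w q t _ (t - tau N)); first by rewrite subr_gt0.
      move=> s; rewrite /q ltr_norml => /andP[s1 _].
      by rewrite leNgt (_ : tau N < s) //; lra.
    have := wD t; rewrite /g clamp_id // t1 t2; exact.
  have tN : tau i.+1 <= tau N by exact: taum.
  have -> : q t = y t by rewrite /q (_ : t <= tau N) //; lra.
  apply: (@is_derive_local _ y q t _ (tau N - t)); first by lra.
    move=> s; rewrite /q ltr_norml => /andP[_ s1].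
    by rewrite (_ : s <= tau N) //; lra.
  by apply: yD => //; rewrite t1.
Qed.

End PiecewiseODE.

(** * The endpoint deviation caused by needles *)

Section NullSets.
Context {R : realType}.

(** The only property of null sets that the estimates use. *)
Definition thin_set (T : R) (N : set R) := forall e, 0 < e -> small_set 0 T e N.

Lemma thin_setU T N N' : thin_set T N -> thin_set T N' -> thin_set T (N `|` N').
Proof.
move=> nN nN' e e0; have e2 : 0 < e / 2 by rewrite divr_gt0.
by rewrite [e]splitr; apply: small_setU; [exact: nN|exact: nN'].
Qed.

Lemma thin_set_bigU T (I : finType) (N : I -> set R) :
  (forall i, thin_set T (N i)) -> thin_set T [set t | exists i, N i t].
Proof.
move=> nN e e0; have e1 : 0 < e / (#|I|.+1)%:R by rewrite divr_gt0.
apply: small_setW _ (small_set_bigU (fun i => nN i _ e1)).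
rewrite sumr_const -[X in X <= _]mulr_natl mulrCA; apply: ler_piMr; first exact: ltW.
by rewrite ler_pdivrMr // mul1r ler_nat.
Qed.

Lemma thin_set_pts T (I : finType) (c : I -> R) :
  thin_set T [set t | exists i, t = c i].
Proof. by apply: (thin_set_bigU (N := fun i => [set c i])) => i e; exact: small_set_pt. Qed.

Lemma thin_set_ae T (A : set R) (P : R -> Prop) : ae_on A P ->
  exists2 N, thin_set T N & forall t, A t -> ~ N t -> P t.
Proof.
move=> /ae_on_negligible nN; exists (A `&` ~` [set t | P t]).
  by move=> e e0; exact: null_small_set.
by move=> t At; apply: contra_notP => nP; split.
Qed.

(** The form in which Gronwall's lemma is used: |z'| <= L |z| + r outside a thin
    set, with a source r that the slope of phi dominates. *)
Lemma gronwall_derive n (T L : R) (z : R -> 'rV[R]_n) (phi : R -> R)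
    (N : set R) : 0 <= L -> ac 0 T z -> {homo phi : s t / s <= t} ->
  thin_set T N ->
  (forall t, 0 <= t <= T -> ~ N t -> exists D r, [/\ is_derive t (1 : R) z D,
     `|D| <= L * `|z t| + r &
     straddle (fun s s' => r * (s' - s) <= phi s' - phi s) t]) ->
  forall t, 0 <= t <= T -> `|z t| <= expR (L * T) * (`|z 0| + (phi T - phi 0)).
Proof.
move=> L0 acz nphi nN H; apply: (gronwall L0 acz nphi nN) => t tT Nt k k0.
have [D [r [zD DL rphi]]] := H t tT Nt.
apply: straddleW (straddle_ord (straddleI rphi (is_derive_straddle zD k0))).
move=> s s' [ss' [r1 r2]] _ _.
have s0 : 0 <= s' - s by rewrite subr_ge0.
have := ler_normD (z s' - z s - (s' - s) *: D) ((s' - s) *: D).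
rewrite subrK normrZ (ger0_norm s0) => h1.
have := ler_wpM2l s0 DL; lra.
Qed.

End NullSets.

Section Ramps.
Context {R : realType}.

Lemma ramp_slope (c l t : R) : c < t -> t < c + l ->
  straddle (fun s s' : R => s' - s <= ramp c l s' - ramp c l s) t.
Proof.
move=> ct tcl; exists (Num.min (t - c) (c + l - t)).
  by rewrite lt_min !subr_gt0 ct.
move=> s s' ds st ts' s'd.
have cs : c <= s.
  by apply: le_trans (ltW ds); rewrite lerBrDr -lerBrDl ge_min lexx.
have sd : s' <= c + l.
  by apply: le_trans (ltW s'd) _; rewrite -lerBrDl ge_min lexx orbT.
rewrite !ramp_mid //; lra.
Qed.

Lemma ramp_lip_len (c l l' t : R) : `|ramp c l t - ramp c l' t| <= `|l - l'|.
Proof.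
wlog ll' : l l' / l <= l'.
  move=> H; have [ll'|/ltW ll'] := leP l l'; first exact: H.
  by rewrite distrC [leRHS]distrC; exact: H.
rewrite distrC [leRHS]distrC (ger0_norm (_ : 0 <= l' - l)) ?subr_ge0 //.
by rewrite ler_norml /ramp; case: (leP (t - c) l) => ?; case: (leP (t - c) l') => ?;
  rewrite /Num.max; do ?case: ltP => ?; apply/andP; split; lra.
Qed.

Lemma ac_sum (V : normedZmodType R) a b (I : Type) (r : seq I) (z : I -> R -> V) :
  (forall i, ac a b (z i)) -> ac a b (fun t => \sum_(i <- r) z i t).
Proof.
move=> acz; elim: r => [|i r IH].
  apply: (@ac_lip _ _ a b 0) => s t _ _ _.
  by rewrite !big_nil subrr normr0 mul0r.
apply: (@ac_dom _ _ _ _ a b 1 _ (z i) _ (acz i) IH) => s t as_ st tb.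
rewrite !big_cons opprD addrACA mul1r; apply: le_trans (ler_normD _ _) _.
by rewrite lerDl subr_ge0.
Qed.

Lemma acB (V : normedZmodType R) a b (z1 z2 : R -> V) : ac a b z1 -> ac a b z2 ->
  ac a b (fun t => z1 t - z2 t).
Proof.
move=> ac1 ac2; apply: (@ac_dom _ _ _ _ a b 1 _ _ _ ac1 ac2) => s t as_ st tb.
rewrite mul1r; have -> : z1 t - z2 t - (z1 s - z2 s) = (z1 t - z1 s) - (z2 t - z2 s).
  by rewrite !opprB addrACA [RHS]addrACA [- z2 t + _]addrC.
by apply: le_trans (ler_normB _ _) _; rewrite lerDl subr_ge0.
Qed.

(** The product is zero before time tau, where w is arbitrary, so that w may be
    frozen there at its value w tau. *)
Lemma ac_ramp n (T tau b l W : R) (w : R -> 'rV[R]_n) :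
  tau <= b -> tau <= T -> 0 <= l -> ac tau T w ->
  (forall t, tau <= t <= T -> `|w t| <= W) ->
  ac 0 T (fun t => ramp b l t *: w t).
Proof.
move=> tb tauT l0 acw wW.
pose w' t := w (Num.max tau t).
have acw' : ac 0 T w'.
  move=> e e0; have [d d0 dP] := acw e e0; exists d => // k s t st tr sd.
  have mono i : Num.max tau (s i) <= Num.max tau (t i).
    have [_ [sti _]] := st i; rewrite ge_max !le_max lexx sti orbT //.
  apply: (dP k (fun i => Num.max tau (s i)) (fun i => Num.max tau (t i))).
  - move=> i; have [_ [_ tT]] := st i; split; first by rewrite le_max lexx.
    by split; [exact: mono|rewrite ge_max tauT].
  - move=> i j _ _ [r [/=]]; rewrite !in_itv /= => ri rj.
    apply: tr => //; exists r; split; rewrite /= in_itv /=.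
      move: ri => /andP[]; rewrite gt_max lt_max => /andP[t1 ->] /orP[]; last by [].
      by rewrite ltNge (ltW t1).
    move: rj => /andP[]; rewrite gt_max lt_max => /andP[t1 ->] /orP[]; last by [].
    by rewrite ltNge (ltW t1).
  apply: le_lt_trans sd; apply: ler_sum => i _.
  have [_ [sti _]] := st i.
  by rewrite /Num.max; case: ltP => ?; case: ltP => ?; lra.
have W0 : 0 <= W by apply: le_trans (wW tau _); rewrite // lexx.
apply: (@ac_dom _ _ _ _ 0 T (l + W) _ _ _ acw' acw') => s t s0 st tT.
have rE r : ramp b l r *: w r = ramp b l r *: w' r.
  have [rt|tr] := leP r tau; first by rewrite ramp0 ?scale0r // (le_trans rt).
  by rewrite /w' (max_idPr (ltW tr)).
rewrite !rE.
have -> : ramp b l t *: w' t - ramp b l s *: w' s =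
    ramp b l t *: (w' t - w' s) + (ramp b l t - ramp b l s) *: w' s.
  by rewrite scalerBr scalerBl addrA subrK.
apply: le_trans (ler_normD _ _) _; rewrite !normrZ.
rewrite (ger0_norm (ramp_ge0 _ _ _)).
rewrite (ger0_norm (_ : 0 <= ramp b l t - ramp b l s)) ?subr_ge0 ?ramp_homo //.
have h1 : ramp b l t * `|w' t - w' s| <= l * `|w' t - w' s|.
  by rewrite ler_wpM2r // ramp_le.
have h2 : (ramp b l t - ramp b l s) * `|w' s| <= (t - s) * W.
  apply: ler_pM; rewrite ?subr_ge0 ?ramp_homo ?ramp_lip //.
  by apply: wW; rewrite le_max lexx ge_max tauT (le_trans st).
have h3 : 0 <= `|w' t - w' s| by [].
have h4 : 0 <= t - s by rewrite subr_ge0.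
have := mulr_ge0 l0 h4; have := mulr_ge0 W0 h3; have := mulr_ge0 l0 h3; nra.
Qed.

Lemma is_derive_scale_line n (b t : R) (w : R -> 'rV[R]_n) D :
  is_derive t (1 : R) w D ->
  is_derive t (1 : R) (fun s => (s - b) *: w s) (w t + (t - b) *: D).
Proof.
move=> /is_derive1P H; apply/is_derive1P => k k0.
pose A := `|t - b| + 1; have A0 : 0 < A by rewrite ltr_wpDl.
have kA : 0 < k / (2 * A) by rewrite divr_gt0 // mulr_gt0.
have [d d0 dP] := H _ kA.
have kD : 0 < k / (2 * (`|D| + 1)) by rewrite divr_gt0 // mulr_gt0 // ltr_wpDl.
exists (Num.min 1 (Num.min d (k / (2 * (`|D| + 1))))).
  by rewrite !lt_min ltr01 d0.
move=> s; rewrite !lt_min => /and3P[s1 sd sk].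
have -> : (s - b) *: w s - (t - b) *: w t - (s - t) *: (w t + (t - b) *: D) =
  (s - b) *: (w s - w t - (s - t) *: D) + (s - t) *: ((s - t) *: D).
  by apply/rowP => i; rewrite !mxE; ring.
apply: le_trans (ler_normD _ _) _; rewrite !normrZ.
have h1 : `|s - b| <= A.
  by have := ler_distD t s b; rewrite /A; lra.
have h2 := ler_pM (normr_ge0 _) (normr_ge0 _) h1 (dP s sd).
have e2 : A * (k / (2 * A) * `|s - t|) = k / 2 * `|s - t|.
  by field; rewrite gt_eqF.
have h3 : `|s - t| * `|D| <= k / 2.
  apply: (@le_trans _ _ (k / (2 * (`|D| + 1)) * (`|D| + 1))).
    apply: ler_pM => //; [exact: ltW|by rewrite lerDl].
  by rewrite le_eqVlt; apply/orP; left; apply/eqP; field; rewrite gt_eqF // ltr_wpDl.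
have := ler_wpM2l (normr_ge0 (s - t)) h3; lra.
Qed.

(** The endpoints b and b + l are excluded. Before b the product is locally zero
    whatever w is. *)
Lemma is_derive_ramp n (tau b l t : R) (w : R -> 'rV[R]_n) D :
  tau <= b -> 0 <= l -> t != b -> t != b + l ->
  (tau < t -> is_derive t (1 : R) w D) ->
  is_derive t (1 : R) (fun s => ramp b l s *: w s)
    (ramp b l t *: D + (if b < t < b + l then 1 else 0) *: w t).
Proof.
move=> tb l0 tnb tnbl wD.
have [tlb|blt|//] := ltgtP t b; last by move=> E; rewrite E eqxx in tnb.
  rewrite ramp0 ?ltW // scale0r scale0r addr0.
  apply: (@is_derive_local _ _ (fun=> 0) _ t 0 (b - t)); first by rewrite subr_gt0.
    move=> s; rewrite ltr_norml => /andP[_ sb]; rewrite ramp0 ?scale0r //; lra.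
have {}wD := wD (le_lt_trans tb blt).
have [tbl|blt'|E] := ltgtP t (b + l); last by rewrite E eqxx in tnbl.
  rewrite ramp_mid ?ltW // scale1r addrC.
  apply: (@is_derive_local _ _ (fun s => (s - b) *: w s) _ t _ (Num.min (t - b) (b + l - t))).
  - by rewrite lt_min !subr_gt0 blt.
  - move=> s; rewrite lt_min !ltr_norml => /andP[/andP[s1 _] /andP[_ s2]].
    by rewrite ramp_mid //; lra.
  exact: is_derive_scale_line.
rewrite (ramp_end l0 (ltW blt')) andbF scale0r addr0.
apply: (@is_derive_local _ _ (fun s => l *: w s) _ t _ (t - (b + l))).
- by rewrite subr_gt0.
- by move=> s; rewrite ltr_norml => /andP[s1 _]; rewrite ramp_end //; lra.
Qed.

Lemma is_derive_bigsum (W : normedModType R) (I : Type) (r : seq I) (t : R)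
    (z : I -> R -> W) (D : I -> W) : (forall i, is_derive t (1 : R) (z i) (D i)) ->
  is_derive t (1 : R) (fun s => \sum_(i <- r) z i s) (\sum_(i <- r) D i).
Proof.
move=> zD; elim: r => [|i r IH].
  rewrite big_nil (_ : (fun _ => _) = fun=> 0); first exact: is_derive_cst.
  by apply/funext => s; rewrite big_nil.
rewrite big_cons (_ : (fun _ => _) = z i + (fun s => \sum_(i <- r) z i s)).
  by have := zD i => ?; exact: is_deriveD.
by apply/funext => s; rewrite big_cons.
Qed.

End Ramps.

Section NeedleEstimate.
Context {R : realType}.

(** Comparison of the reference trajectory x of u with the trajectory y of v, where
    v equals om j on the needle ]b j, b j + l j[ and is close to u elsewhere, up
    to a bad set B.

    A first use of Gronwall's lemma bounds z = y - x by Z, which is of the order of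
    the total length S of the needles. Let p be the sum of the w j multiplied by the
    time spent in the j-th needle. The derivative of e = z - p is then bounded by
    L |e| + r where r is
    - eta * Z + eta1 off the needles, because f is differentiable in the state and v
      is close to u;
    - of order Z + eta in the needles, because w j t is close there to the jump of
      the velocity; the total length of the needles is S;
    - bounded in B.
    A second use of Gronwall's lemma concludes. *)
Lemma needle_estimate n m (T : R) (f : 'rV[R]_n -> 'rV[R]_m -> R -> 'rV[R]_n)
    (x y : R -> 'rV[R]_n) (u v : R -> 'rV[R]_m) (J : finType)
    (tau b l : J -> R) (om : J -> 'rV[R]_m) (w : J -> R -> 'rV[R]_n)
    (B Ny : set R) (Rx Ru M L W eta eta1 mu d : R) :
  let S := \sum_j l j in
  let Z := expR (L * T) * (eta1 * T + 2 * M * S + 2 * M * mu) in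
  [/\ 0 <= T, 0 <= L, 0 <= W, 0 <= eta & 0 <= eta1] ->
  (forall y o t, `|y| <= Rx -> `|o| <= Ru -> 0 <= t <= T -> `|f y o t| <= M) ->
  (forall y y' o t, `|y| <= Rx -> `|y'| <= Rx -> `|o| <= Ru -> 0 <= t <= T ->
    `|f y' o t - f y o t| <= L * `|y' - y|) ->
  (forall y o t (q : 'rV[R]_n), `|y| <= Rx -> `|o| <= Ru -> 0 <= t <= T ->
    `|q *m dfdx f y o t| <= L * `|q|) ->
  (forall y y' o o' t, `|y| <= Rx -> `|y'| <= Rx ->
    `|o| <= Ru -> `|o'| <= Ru -> 0 <= t <= T -> `|y' - y| < d -> `|o' - o| < d ->
    `|f y' o' t - f y o' t - (y' - y) *m dfdx f y o t| <= eta * `|y' - y|) ->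
  ac 0 T x -> (forall t, 0 <= t <= T -> `|x t| <= Rx - 1) ->
  ae_on `[0, T] (fun t => is_derive t (1 : R) x (f (x t) (u t) t)) ->
  ae_on `[0, T] (fun t => `|u t| <= Ru) ->
  (forall s t, `|y s - y t| <= M * `|s - t|) -> y 0 = x 0 ->
  thin_set T Ny ->
  (forall t, 0 <= t <= T -> ~ Ny t ->
    is_derive t (1 : R) y (f (clampv Rx (y t)) (v t) t)) ->
  (forall t, `|v t| <= Ru) ->
  (forall j, [/\ 0 <= tau j, tau j <= b j, 0 <= l j & b j + l j <= T]) ->
  (forall j, ac (tau j) T (w j)) ->
  (forall j t, tau j <= t <= T -> `|w j t| <= W) ->
  (forall j, ae_on `[tau j, T] (fun t =>
     is_derive t (1 : R) (w j) (w j t *m dfdx f (x t) (u t) t))) ->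
  small_set 0 T mu B ->
  (forall t, 0 <= t <= T -> ~ B t -> ~ Ny t ->
    (forall j, ~ (b j < t < b j + l j)) ->
    `|f (x t) (v t) t - f (x t) (u t) t| <= eta1 /\ `|v t - u t| < d) ->
  (forall t j, 0 <= t <= T -> ~ B t -> ~ Ny t -> b j < t < b j + l j ->
    [/\ v t = om j, `|f (x t) (om j) t - f (x t) (u t) t - w j t| <= eta &
      forall j', j' != j -> ~ (b j' < t < b j' + l j')]) ->
  Z <= 1 -> Z < d ->
  (forall t, 0 <= t <= T -> `|y t - x t| <= Z) /\
  `|y T - x T - \sum_j l j *: w j T| <= expR (L * T) *
    ((eta * Z + eta1) * T + (L * Z + eta + L * (W * S)) * S +
     (2 * M + #|J|%:R * W + L * (W * S)) * mu).
Proof.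
move=> S Z [T0 L0 W0 eta0 eta10] fM fL fJ fE acx xR xD uR yL y0 nNy yD vR.
move=> tb acw wW wD [G [nG GT GB]] Ha Hb Z1 Zd.
have T00 : 0 <= (0 : R) <= T by apply/andP; split.
have Rx1 : 1 <= Rx by have := xR 0 T00; have := normr_ge0 (x 0); lra.
have Rx0 : 0 <= Rx by lra.
have xRx t : 0 <= t <= T -> `|x t| <= Rx by move=> /xR; lra.
have Ru0 : 0 <= Ru by apply: le_trans (vR 0).
have M0 : 0 <= M by apply: le_trans (fM (x 0) (v 0) 0 _ _ _) => //; exact: xRx.
have S0 : 0 <= S by apply: sumr_ge0 => j _; case: (tb j).
have [N1 nN1 N1P] := thin_set_ae T xD.
have [N2 nN2 N2P] := thin_set_ae T uR.
have /choice[N3 N3P] : forall j, exists N, thin_set T N /\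
    forall t, (`[tau j, T]%classic t) -> ~ N t ->
    is_derive t (1 : R) (w j) (w j t *m dfdx f (x t) (u t) t).
  by move=> j; have [N nN NP] := thin_set_ae T (wD j); exists N.
pose ends : set R := [set t | exists j, t = b j] `|` [set t | exists j, t = b j + l j].
pose N := Ny `|` N1 `|` N2 `|` [set t | exists j, N3 j t] `|` ends.
have nN : thin_set T N.
  apply: thin_setU; last by apply: thin_setU; exact: thin_set_pts.
  apply: thin_setU; last by apply: thin_set_bigU => j; case: (N3P j).
  by apply: thin_setU => //; exact: thin_setU.
have NP t : 0 <= t <= T -> ~ N t -> [/\ ~ Ny t,
    is_derive t (1 : R) x (f (x t) (u t) t), `|u t| <= Ru,
    forall j, tau j < t -> is_derive t (1 : R) (w j) (w j t *m dfdx f (x t) (u t) t) &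
    forall j, t != b j /\ t != b j + l j].
  move=> tT Nt; have tT' : `[0, T]%classic t by rewrite /= in_itv.
  split.
  - by move=> H; apply: Nt; do 4 left.
  - by apply: N1P => // H; apply: Nt; do 3 left; right.
  - by apply: N2P => // H; apply: Nt; do 2 left; right.
  - move=> j tj; have [_ H3] := N3P j; apply: H3.
      by rewrite /= in_itv /= ltW //; case/andP: tT.
    by move=> H; apply: Nt; left; right; exists j.
  - by move=> j; split; apply/eqP => H; apply: Nt; right; [left|right]; exists j.
have acy : ac 0 T y.
  apply: (@ac_lip _ _ 0 T M) => s t s0 st tT; have := yL t s.
  by rewrite (ger0_norm (_ : 0 <= t - s)) // subr_ge0.
pose z t := y t - x t.
have acz : ac 0 T z by exact: acB.
have z0 : `|z 0| = 0 by rewrite /z y0 subrr normr0.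
pose Rp t := \sum_j ramp (b j) (l j) t.
have Rp_homo : {homo Rp : s t / s <= t}.
  by move=> s t st; apply: ler_sum => j _; exact: ramp_homo.
have RpT : Rp T - Rp 0 <= S.
  have : 0 <= Rp 0 by apply: sumr_ge0 => j _; exact: ramp_ge0.
  have : Rp T <= S by apply: ler_sum => j _; apply: ramp_le; case: (tb j).
  lra.
have Rp_slope j s s' : s <= s' -> ramp (b j) (l j) s' - ramp (b j) (l j) s <= Rp s' - Rp s.
  move=> ss'; rewrite /Rp (bigD1 j) //= [X in _ <= _ - X](bigD1 j) //=.
  have : \sum_(i | i != j) ramp (b i) (l i) s <= \sum_(i | i != j) ramp (b i) (l i) s'.
    by apply: ler_sum => i _; exact: ramp_homo.
  lra.
have fclamp t o : 0 <= t <= T -> `|o| <= Ru ->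
    `|f (clampv Rx (y t)) o t - f (x t) o t| <= L * `|z t|.
  move=> tT oR; apply: le_trans (fL _ _ _ _ _ _ _ _) _; rewrite ?clampv_norm ?xRx //.
  rewrite ler_wpM2l // -(clampv_id (xRx t tT)); exact: clampv_dist.
(* The sources allowed in the three regions (everywhere, in the needles, in B)
   are paid by the three terms of the function phi of Gronwall's lemma. *)
have budget (C1 C2 C3 r : R) t : 0 <= C1 -> 0 <= C2 -> 0 <= C3 ->
    (r <= C1) \/ (r <= C2 /\ exists j, b j < t < b j + l j) \/ (r <= C3 /\ B t) ->
    straddle (fun s s' => r * (s' - s) <=
      (C1 * s' + C2 * Rp s' + C3 * G s') - (C1 * s + C2 * Rp s + C3 * G s)) t.
  move=> C10 C20 C30 H.
  have base s s' : s <= s' -> 0 <= Rp s' - Rp s /\ 0 <= G s' - G s.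
    by move=> ss'; rewrite !subr_ge0 Rp_homo // nG.
  case: H => [rC|[[rC [j /andP[bt tl]]]|[rC Bt]]].
  - have tr : straddle (fun _ _ : R => True) t by exists 1.
    apply: straddleW (straddle_ord tr) => s s' [ss' _]; have [h1 h2] := base _ _ ss'.
    have := mulr_ge0 C20 h1; have := mulr_ge0 C30 h2.
    have ds : 0 <= s' - s by rewrite subr_ge0.
    by have := ler_wpM2r ds rC; clear; lra.
  - apply: straddleW (straddle_ord (ramp_slope bt tl)) => s s' [ss' h].
    have [h1 h2] := base _ _ ss'; have h3 := Rp_slope j _ _ ss'.
    have ds : 0 <= s' - s by rewrite subr_ge0.
    have := ler_wpM2r ds rC; have := ler_wpM2l C20 (le_trans h h3).
    by have := mulr_ge0 C30 h2; have := mulr_ge0 C10 ds; clear; lra.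
  - apply: straddleW (straddle_ord (GB t Bt)) => s s' [ss' h].
    have [h1 h2] := base _ _ ss'.
    have ds : 0 <= s' - s by rewrite subr_ge0.
    have := ler_wpM2r ds rC; have := ler_wpM2l C30 h.
    by have := mulr_ge0 C20 h1; have := mulr_ge0 C10 ds; clear; lra.
have budget_homo (C1 C2 C3 : R) : 0 <= C1 -> 0 <= C2 -> 0 <= C3 ->
    {homo (fun t => C1 * t + C2 * Rp t + C3 * G t) : s t / s <= t}.
  move=> C10 C20 C30 s t st; rewrite !lerD //; apply: ler_wpM2l => //.
    exact: Rp_homo.
  exact: nG.
have M20 : 0 <= 2 * M by rewrite mulr_ge0.
have zZ t : 0 <= t <= T -> `|z t| <= Z.
  move=> tT; apply: le_trans (gronwall_derive L0 acz
    (budget_homo eta1 (2 * M) (2 * M) eta10 M20 M20) nN _ tT) _; last first.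
    rewrite z0 add0r /Z ler_pM2l ?expR_gt0 //.
    by have := ler_wpM2l M20 RpT; have := ler_wpM2l M20 GT; clear; lra.
  move=> {tT}t tT Nt; have [nNyt xDt uRt _ _] := NP t tT Nt.
  have zD : is_derive t (1 : R) z (f (clampv Rx (y t)) (v t) t - f (x t) (u t) t).
    exact: (is_deriveB (yD t tT nNyt) xDt).
  have triv : `|f (clampv Rx (y t)) (v t) t - f (x t) (u t) t| <= L * `|z t| + 2 * M.
    have h1 := fM (clampv Rx (y t)) (v t) t (clampv_norm _ Rx0) (vR t) tT.
    have h2 := fM (x t) (u t) t (xRx t tT) uRt tT.
    have := mulr_ge0 L0 (normr_ge0 (z t)).
    have := ler_normB (f (clampv Rx (y t)) (v t) t) (f (x t) (u t) t).
    by move: h1 h2; clear; lra.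
  have [Bt|Bt] := pselect (B t).
    exists (f (clampv Rx (y t)) (v t) t - f (x t) (u t) t), (2 * M); split => //.
    by apply: budget => //; right; right.
  have [[j bj]|nj] := pselect (exists j, b j < t < b j + l j).
    exists (f (clampv Rx (y t)) (v t) t - f (x t) (u t) t), (2 * M); split => //.
    by apply: budget => //; right; left; split => //; exists j.
  exists (f (clampv Rx (y t)) (v t) t - f (x t) (u t) t), eta1; split => //; last first.
    by apply: budget => //; left.
  have [|h1 _] := Ha t tT Bt nNyt; first by move=> j bj; apply: nj; exists j.
  have h2 := fclamp t (v t) tT (vR t).
  have := ler_distD (f (x t) (v t) t) (f (clampv Rx (y t)) (v t) t) (f (x t) (u t) t).
  by move: h1 h2; clear; lra.
split=> //.
pose p t := \sum_j ramp (b j) (l j) t *: w j t.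
have acp : ac 0 T p.
  apply: ac_sum => j; have [t1 t2 t3 t4] := tb j.
  by apply: (@ac_ramp _ _ _ (tau j) _ _ W) => //; [move: t2 t3 t4; clear; lra|exact: wW].
have p0 : p 0 = 0.
  apply: big1 => j _; have [t1 t2 _ _] := tb j; by rewrite ramp0 ?scale0r // (le_trans t1).
have pT : p T = \sum_j l j *: w j T.
  by apply: eq_bigr => j _; have [_ _ ? ?] := tb j; rewrite ramp_end.
have pW t : 0 <= t <= T -> `|p t| <= W * S.
  move=> tT; apply: le_trans (ler_norm_sum _ _ _) _.
  rewrite mulr_sumr; apply: ler_sum => j _; have [t1 t2 t3 t4] := tb j.
  rewrite normrZ ger0_norm ?ramp_ge0 //.
  have [ttau|taut] := leP t (tau j).
    by rewrite ramp0 ?mul0r ?mulr_ge0 // (le_trans ttau).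
  rewrite mulrC; apply: ler_pM; rewrite ?ramp_ge0 ?ramp_le //.
  by apply: wW; rewrite ltW //=; case/andP: tT.
have Z0 : 0 <= Z by apply: le_trans (zZ 0 T00).
pose e t := z t - p t.
have ace : ac 0 T e by exact: acB.
have e0 : `|e 0| = 0 by rewrite /e /z y0 p0 !subrr normr0.
pose C1 := eta * Z + eta1.
pose C2 := L * Z + eta + L * (W * S).
pose C3 := 2 * M + #|J|%:R * W + L * (W * S).
have WS0 : 0 <= L * (W * S) by rewrite !mulr_ge0.
have C10 : 0 <= C1 by apply: addr_ge0 => //; exact: mulr_ge0.
have LZ : 0 <= L * Z by exact: mulr_ge0.
have C20 : 0 <= C2 by apply: addr_ge0 => //; exact: addr_ge0.
have JW : 0 <= #|J|%:R * W by exact: mulr_ge0.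
have C30 : 0 <= C3 by apply: addr_ge0 => //; exact: addr_ge0.
have TT : 0 <= T <= T by rewrite T0 lexx.
have -> : y T - x T - \sum_j l j *: w j T = e T by rewrite /e pT.
apply: le_trans (gronwall_derive L0 ace
    (budget_homo C1 C2 C3 C10 C20 C30) nN _ TT) _; last first.
  rewrite e0 add0r ler_pM2l ?expR_gt0 //.
  have := ler_wpM2l C20 RpT; have := ler_wpM2l C30 GT.
  by rewrite -/C1 -/C2 -/C3; clear; lra.
move=> t tT Nt; have [nNyt xDt uRt wDt tbt] := NP t tT Nt.
set A := dfdx f (x t) (u t) t in wDt.
pose ind j : R := if b j < t < b j + l j then 1 else 0.
pose D := f (clampv Rx (y t)) (v t) t - f (x t) (u t) t -
  (p t *m A + \sum_j ind j *: w j t).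
have eD : is_derive t (1 : R) e D.
  apply: is_deriveB; first exact: (is_deriveB (yD t tT nNyt) xDt).
  rewrite (_ : p t *m A + _ = \sum_j (ramp (b j) (l j) t *: (w j t *m A) + ind j *: w j t)).
    apply: is_derive_bigsum => j; have [t1 t2 t3 t4] := tb j.
    have [tb1 tb2] := tbt j.
    exact: (is_derive_ramp t2 t3 tb1 tb2 (wDt j)).
  rewrite big_split /= /p mulmx_suml; congr (_ + _).
  by apply: eq_bigr => j _; rewrite scalemxAl.
have pA : `|p t *m A| <= L * (W * S).
  apply: le_trans (fJ _ _ _ _ (xRx t tT) uRt tT) _.
  by rewrite ler_wpM2l // pW.
have Le : 0 <= L * `|e t| by rewrite mulr_ge0.
exists D.
have [Bt|Bt] := pselect (B t).
  exists C3; split => //; last by apply: budget => //; right; right.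
  have h1 := fM (clampv Rx (y t)) (v t) t (clampv_norm _ Rx0) (vR t) tT.
  have h2 := fM (x t) (u t) t (xRx t tT) uRt tT.
  have h3 : `|\sum_j ind j *: w j t| <= #|J|%:R * W.
    apply: le_trans (ler_norm_sum _ _ _) _.
    rewrite -sum1_card natr_sum mulr_suml; apply: ler_sum => j _.
    rewrite /ind; case: ifP => [/andP[bj _]|_]; last by rewrite scale0r normr0 mul1r.
    rewrite scale1r mul1r wW //; have [t1 t2 _ _] := tb j; case/andP: tT => _ ->.
    by rewrite andbT (le_trans t2 (ltW bj)).
  have h4 := ler_normB (f (clampv Rx (y t)) (v t) t) (f (x t) (u t) t).
  have h5 := ler_normD (p t *m A) (\sum_j ind j *: w j t).
  have := ler_normB (f (clampv Rx (y t)) (v t) t - f (x t) (u t) t)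
    (p t *m A + \sum_j ind j *: w j t).
  by rewrite -/D /C3; move: h1 h2 h3 h4 h5 pA Le; clear; lra.
have [[j bj]|nj] := pselect (exists j, b j < t < b j + l j).
  exists C2; split => //; last by apply: budget => //; right; left; split => //; exists j.
  have [vom wom nj'] := Hb t j tT Bt nNyt bj.
  have indE : \sum_i ind i *: w i t = w j t.
    rewrite (bigD1 j) //= big1 => [|i ij].
      by rewrite addr0 /ind bj scale1r.
    by rewrite /ind; case: ifP => [H|_]; [case: (nj' i ij H)|rewrite scale0r].
  have h2 := fclamp t (v t) tT (vR t); have hz := zZ t tT.
  have DE : D = (f (clampv Rx (y t)) (v t) t - f (x t) (v t) t) +
      (f (x t) (om j) t - f (x t) (u t) t - w j t) - p t *m A.
    by rewrite /D indE vom; apply/rowP => i; rewrite !mxE; ring.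
  have h4 := ler_normB ((f (clampv Rx (y t)) (v t) t - f (x t) (v t) t) +
      (f (x t) (om j) t - f (x t) (u t) t - w j t)) (p t *m A).
  have h5 := ler_normD (f (clampv Rx (y t)) (v t) t - f (x t) (v t) t)
      (f (x t) (om j) t - f (x t) (u t) t - w j t).
  rewrite -DE in h4; have := ler_wpM2l L0 hz.
  by rewrite /C2; move: wom h2 h4 h5 pA Le; clear; lra.
exists C1; split => //; last by apply: budget => //; left.
have [|h1 h2] := Ha t tT Bt nNyt; first by move=> j bj; apply: nj; exists j.
have ind0 : \sum_i ind i *: w i t = 0.
  apply: big1 => i _; rewrite /ind; case: ifP => [H|_]; last by rewrite scale0r.
  by case: nj; exists i.
have hz := zZ t tT.
have yR : `|y t| <= Rx.
  have := ler_normD (y t - x t) (x t); rewrite subrK.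
  by have := xR t tT; move: (le_trans hz Z1); rewrite /z; clear; lra.
have h3 := fE (x t) (y t) (u t) (v t) t (xRx t tT) yR uRt (vR t) tT (le_lt_trans hz Zd) h2.
have h4 := fJ (x t) (u t) t (e t) (xRx t tT) uRt tT.
have DE : D = (f (y t) (v t) t - f (x t) (v t) t - (y t - x t) *m A) +
   ((f (x t) (v t) t - f (x t) (u t) t) + e t *m A).
  rewrite /D ind0 addr0 (clampv_id yR) /e /z [(_ - p t) *m A]mulmxBl.
  by apply/rowP => i; rewrite !mxE; ring.
have h5 := ler_normD (f (y t) (v t) t - f (x t) (v t) t - (y t - x t) *m A)
  ((f (x t) (v t) t - f (x t) (u t) t) + e t *m A).
have h6 := ler_normD (f (x t) (v t) t - f (x t) (u t) t) (e t *m A).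
have := ler_wpM2l eta0 hz; rewrite -DE in h5; rewrite /C1 /z; rewrite /z in hz.
by move: h1 h3 h4 h5 h6; rewrite -/A; clear; lra.
Qed.

End NeedleEstimate.

(** * Mixed controls and needles provided by regularity *)

Section Mix.
Context {R : realType} {m : nat} {J : eqType}.
Implicit Types (th : J -> R) (om : J -> 'rV[R]_m) (r : seq J).

(** The convex combinations are nested, so that the result lies in U for any
    weights in [0, 1], even if the sum of the weights exceeds 1. *)
Fixpoint mix r th om (v0 : 'rV[R]_m) : 'rV[R]_m :=
  if r is j :: r' then (1 - th j) *: mix r' th om v0 + th j *: om j else v0.

Lemma mix_convex (U : set 'rV[R]_m) r th om v0 : convex_set U -> U v0 ->
  (forall j, U (om j)) -> (forall j, 0 <= th j <= 1) -> U (mix r th om v0).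
Proof.
move=> Uc Uv Uom th01; elim: r => [//|j r IH] /=.
have /andP[t0 t1] := th01 j.
have := Uc (om j) (mix r th om v0) (Itv01 t0 t1).
rewrite !inE => /(_ (Uom j) IH); rewrite addrC.
by [].
Qed.

Lemma mix_norm r th om v0 C : `|v0| <= C -> (forall j, `|om j| <= C) ->
  (forall j, 0 <= th j <= 1) -> `|mix r th om v0| <= C.
Proof.
move=> vC omC th01; elim: r => [//|j r IH] /=.
have /andP[t0 t1] := th01 j; have t10 : 0 <= 1 - th j by rewrite subr_ge0.
apply: le_trans (ler_normD _ _) _; rewrite !normrZ !ger0_norm //.
have := ler_wpM2l t0 (omC j); have := ler_wpM2l t10 IH; lra.
Qed.

Lemma mix0 r th om v0 : (forall j, j \in r -> th j = 0) -> mix r th om v0 = v0.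
Proof.
elim: r => [//|j r IH] H /=.
rewrite H ?mem_head // subr0 scale1r scale0r addr0; apply: IH => i ir.
by apply: H; rewrite inE ir orbT.
Qed.

Lemma mix1 r th om v0 j : uniq r -> j \in r -> th j = 1 ->
  (forall i, i != j -> th i = 0) -> mix r th om v0 = om j.
Proof.
elim: r => [//|i r IH] /= /andP[ir ur]; rewrite inE => /predU1P[->|jr] tj t0.
  by rewrite tj subrr scale0r scale1r add0r.
have ij : i != j by apply: contraNneq ir => ->.
by rewrite t0 // subr0 scale1r scale0r addr0 IH.
Qed.

Lemma mix_dist r th th' om v0 C : `|v0| <= C -> (forall j, `|om j| <= C) ->
  (forall j, 0 <= th j <= 1) -> (forall j, 0 <= th' j <= 1) ->
  `|mix r th om v0 - mix r th' om v0| <= 2 * C * \sum_(j <- r) `|th j - th' j|.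
Proof.
move=> vC omC th01 th01'; elim: r => [|j r IH] /=.
  by rewrite subrr normr0 big_nil mulr0.
rewrite big_cons mulrDr.
have -> : (1 - th j) *: mix r th om v0 + th j *: om j -
    ((1 - th' j) *: mix r th' om v0 + th' j *: om j) =
  (th j - th' j) *: (om j - mix r th' om v0) +
    (1 - th j) *: (mix r th om v0 - mix r th' om v0).
  by apply/rowP => i; rewrite !mxE; ring.
apply: le_trans (ler_normD _ _) _; rewrite !normrZ; apply: lerD.
  rewrite mulrC ler_wpM2r //.
  have := ler_normB (om j) (mix r th' om v0); have := omC j.
  have := mix_norm r vC omC th01'; lra.
apply: le_trans IH; apply: ler_piMl => //.
by have /andP[? ?] := th01 j; rewrite ger0_norm; lra.
Qed.

End Mix.

Section Regular.
Context {R : realType} {n m : nat}.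

(** Write each vector of the canonical basis and its opposite as a nonnegative
    combination of endpoints of variation vectors, and a as the combination of
    these 2 n vectors weighted by the positive and negative parts of its
    coordinates. The needles are all those occurring in these combinations, and
    the index set J is a disjoint sum over the 2 n vectors. *)
Lemma regular_needles (T : R) (U : set 'rV[R]_m)
    (f : 'rV[R]_n -> 'rV[R]_m -> R -> 'rV[R]_n) u x :
  weakly_regular T f U u x ->
  exists (J : finType) (tau : J -> R) (om : J -> 'rV[R]_m)
    (w : J -> R -> 'rV[R]_n) (c : J -> 'rV[R]_n -> R) (C : R),
  [/\ forall j, [/\ 0 <= tau j < T, lebesgue_point T (velocity f u x) (tau j),
        U (om j) & variation_vector T f u x (tau j) (om j) (w j)],
    0 <= C /\ (forall j a, 0 <= c j a),
    forall j a a', `|c j a - c j a'| <= C * `|a - a'|,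
    forall j, c j 0 = 0 &
    forall a, \sum_j c j a *: w j T = a].
Proof.
move=> reg.
pose dir (s : 'I_n * bool) : 'rV[R]_n := (if s.2 then 1 else -1) *: delta_mx 0 s.1.
have /choice[k kP] : forall s, exists k, exists (c : 'I_k -> R) (q : 'I_k -> 'rV[R]_n),
    [/\ forall i, 0 <= c i, forall i, variation_endpoints T f U u x (q i) &
      dir s = \sum_(i < k) c i *: q i].
  move=> s; have : pontryagin_cone T f U u x (dir s) by rewrite reg.
  by [].
have [cf [q qP]] : exists (cf : forall s, 'I_(k s) -> R)
    (q : forall s, 'I_(k s) -> 'rV[R]_n), forall s, [/\ forall i, 0 <= cf s i,
      forall i, variation_endpoints T f U u x (q s i) &
      dir s = \sum_(i < k s) cf s i *: q s i].
  exists (fun s => projT1 (cid (kP s))).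
  exists (fun s => projT1 (cid (projT2 (cid (kP s))))).
  by move=> s; exact: projT2 (cid (projT2 (cid (kP s)))).
pose J : finType := {s : 'I_n * bool & 'I_(k s)}.
pose coef (j : J) : R := cf (tag j) (tagged j).
have /choice[D DP] (j : J) : exists d : R * 'rV[R]_m * (R -> 'rV[R]_n),
    [/\ 0 <= d.1.1 < T, lebesgue_point T (velocity f u x) d.1.1, U d.1.2,
      variation_vector T f u x d.1.1 d.1.2 d.2 & q (tag j) (tagged j) = d.2 T].
  have [_ /(_ (tagged j)) [t [om0 [w [tT tl Uo vw E]]]] _] := qP (tag j).
  by exists (t, om0, w); split => //; move: tT; rewrite in_itv.
have coef0 j : 0 <= coef j by have [H _ _] := qP (tag j); exact: H.
pose part (s : 'I_n * bool) (a : 'rV[R]_n) : R :=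
  Num.max 0 (if s.2 then a 0 s.1 else - a 0 s.1).
exists J, (fun j => (D j).1.1), (fun j => (D j).1.2), (fun j => (D j).2).
exists (fun j a => part (tag j) a * coef j), (\sum_j coef j).
have part0 s a : 0 <= part s a by rewrite /part le_max lexx.
split.
- by move=> j; have [? ? ? ? _] := DP j; split.
- split; first exact: sumr_ge0.
  by move=> j a; exact: mulr_ge0.
- move=> j a a'; rewrite -mulrBl normrM mulrC (ger0_norm (coef0 j)).
  apply: ler_pM => //.
    rewrite (bigD1 j) //= lerDl; exact: sumr_ge0.
  apply: (@le_trans _ _ `|a 0 (tag j).1 - a' 0 (tag j).1|); last first.
    by have := le_rv_norm (a - a') (tag j).1; rewrite !mxE.
  have maxd (p p' : R) : `|Num.max 0 p - Num.max 0 p'| <= `|p - p'|.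
    have := ler_norm (p - p'); have := ler_norm (p' - p).
    rewrite (distrC p' p) ler_norml => h1 h2.
    by case: (leP 0 p) => ?; case: (leP 0 p') => ?; apply/andP; split; lra.
  rewrite /part; case: (tag j).2; first exact: maxd.
  by apply: le_trans (maxd _ _) _; rewrite opprK addrC distrC.
- by move=> j; rewrite /part !mxE oppr0 if_same /Num.max ltxx mul0r.
move=> a.
have -> : \sum_j (part (tag j) a * coef j) *: (D j).2 T =
    \sum_(s : 'I_n * bool) \sum_(i < k s) (part s a * cf s i) *: q s i.
  rewrite (sig_big_dep _ (fun s : 'I_n * bool => fun i : 'I_(k s) => true)) /=.
  by apply: eq_bigr => j _; have [_ _ _ _ <-] := DP j.
transitivity (\sum_(s : 'I_n * bool) part s a *: dir s).
  apply: eq_bigr => s _; have [_ _ ->] := qP s; rewrite scaler_sumr.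
  by apply: eq_bigr => i _; rewrite scalerA.
rewrite -(pair_big xpredT xpredT (fun i b => part (i, b) a *: dir (i, b))) /=.
rewrite [RHS]row_sum_delta; apply: eq_bigr => i _.
rewrite big_bool /= /part /dir /= !scalerA mulr1 mulrN1 -scalerDl; congr (_ *: _).
by rewrite /Num.max; case: ltP => ?; case: ltP => ?; lra.
Qed.

End Regular.

(** * Reaching the target on a fixed partition *)

Section Hit.
Context {R : realType} {n m : nat}.
Implicit Types (f : 'rV[R]_n -> 'rV[R]_m -> R -> 'rV[R]_n).

(** Solutions for the dynamics with projected state, as built by [pc_ode]. *)
Definition pc_solution f (Rx M : R) (x0 : 'rV[R]_n) (N : nat) (tn : nat -> R)
    (V : nat -> 'rV[R]_m) (y : R -> 'rV[R]_n) : Prop :=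
  [/\ y (tn 0%N) = x0, forall s t, `|y s - y t| <= M * `|s - t| &
    forall i t, (i < N)%N -> tn i < t < tn i.+1 ->
      is_derive t (1 : R) y (f (clampv Rx (y t)) (V i) t)].

Definition nodes (N : nat) (tn : nat -> R) : set R :=
  [set t | exists i : 'I_N.+1, t = tn i].

Lemma cell_of (N : nat) (tn : nat -> R) t : tn 0%N <= t < tn N ->
  exists2 i, (i < N)%N & tn i <= t < tn i.+1.
Proof.
elim: N => [|N IH] /andP[t0 tN]; first by move: (le_lt_trans t0 tN); rewrite ltxx.
have [Nt|tN'] := leP (tn N) t; first by exists N => //; rewrite Nt.
have [|i iN it] := IH; first by rewrite t0.
by exists i => //; exact: ltnW.
Qed.

Lemma open_cell_of (N : nat) (tn : nat -> R) t : tn 0%N <= t <= tn N ->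
  ~ nodes N tn t -> exists2 i, (i < N)%N & tn i < t < tn i.+1.
Proof.
move=> /andP[t0 tN] nt.
have neq i : (i <= N)%N -> t != tn i.
  move=> iN; apply/eqP => E; apply: nt.
  by exists (Ordinal (iN : (i < N.+1)%N)).
have [|i iN /andP[it ti]] := @cell_of N tn t.
  by rewrite t0 lt_neqAle neq.
by exists i => //; rewrite ti lt_neqAle eq_sym neq ?it // ltnW.
Qed.

Lemma ac_lipschitz (y : R -> 'rV[R]_n) M T :
  (forall s t, `|y s - y t| <= M * `|s - t|) -> ac 0 T y.
Proof.
move=> yL; apply: (@ac_lip _ _ 0 T M) => s t s0 st tT; have := yL t s.
by rewrite (ger0_norm (_ : 0 <= t - s)) // subr_ge0.
Qed.

(** The map sending a to the endpoint for V a, minus x1, is continuous by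
    Gronwall's lemma, and on the face a_i = 1 (resp. a_i = -1) of the cube its i-th
    coordinate is at least eps / 2 (resp. at most - eps / 2). *)
Lemma pc_hits f (T Rx Ru M L eps : R) (N : nat) (tn : nat -> R)
    (x0 x1 : 'rV[R]_n) (V : 'rV[R]_n -> nat -> 'rV[R]_m) :
  C1_dynamics T f -> 0 < T -> 0 <= Rx -> 0 <= L -> 0 < eps ->
  (forall y o t, `|y| <= Rx -> `|o| <= Ru -> 0 <= t <= T -> `|f y o t| <= M) ->
  (forall y y' o t, `|y| <= Rx -> `|y'| <= Rx -> `|o| <= Ru -> 0 <= t <= T ->
    `|f y' o t - f y o t| <= L * `|y' - y|) ->
  tn 0%N = 0 -> tn N = T ->
  (forall i, (i < N)%N -> tn i <= tn i.+1 /\ L * (tn i.+1 - tn i) <= 1 / 2) ->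
  (forall a i, `|V a i| <= Ru) ->
  (forall a eta, 0 < eta -> exists2 d, 0 < d & forall b, `|a - b| < d ->
    forall i, (i < N)%N -> `|V a i - V b i| < eta) ->
  (forall a y, `|a| <= 1 -> pc_solution f Rx M x0 N tn (V a) y ->
    `|y T - x1 - eps *: a| <= eps / 2) ->
  exists a y, [/\ `|a| <= 1, pc_solution f Rx M x0 N tn (V a) y & y T = x1].
Proof.
move=> fC T0 Rx0 L0 eps0 fM fL tn0 tnN tnL VR Vc est.
have /choice[y yP] a : exists y, pc_solution f Rx M x0 N tn (V a) y.
  by apply: (pc_ode x0 fC (ltW T0) Rx0 L0 fM fL _ _ tnL (VR a)); rewrite ?tn0 ?tnN.
suff [a a1 Fa] : exists2 a, `|a| <= 1 & y a T - x1 = 0.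
  by exists a, (y a); split=> //; apply/eqP; rewrite -subr_eq0 Fa.
apply: poincare_miranda.
- move=> a _ eta eta0; pose E := expR (L * T).
  have E0 : 0 < E by exact: expR_gt0.
  have e'0 : 0 < eta / (2 * E * T) by rewrite divr_gt0 // !mulr_gt0.
  have [d1 d10 d1P] := dynamics_unif_cont Rx Ru fC e'0.
  have [d d0 dP] := Vc a d1 d10; exists d => // b _ ab.
  have [ya0 yaL yaD] := yP a; have [yb0 ybL ybD] := yP b.
  set phi := fun t : R => eta / (2 * E * T) * t.
  have := @gronwall_derive R n T L (fun t => y a t - y b t) phi (nodes N tn) L0.
  have TT : 0 <= T <= T by rewrite (ltW T0) lexx.
  move=> /(_ _ _ _ _ T TT)/le_lt_trans H.
  have -> : y a T - x1 - (y b T - x1) = y a T - y b T.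
    by apply/rowP => i; rewrite !mxE; ring.
  apply: H.
  + by apply: acB; [exact: ac_lipschitz yaL|exact: ac_lipschitz ybL].
  + by move=> s t st; rewrite /phi ler_wpM2l // ltW.
  + exact: thin_set_pts.
  + move=> t tT nt; have [|i iN ti] := open_cell_of (t := t) _ nt.
      by rewrite tn0 tnN.
    exists (f (clampv Rx (y a t)) (V a i) t - f (clampv Rx (y b t)) (V b i) t).
    exists (eta / (2 * E * T)); split.
    * exact: is_deriveB (yaD i t iN ti) (ybD i t iN ti).
    * have h1 : `|f (clampv Rx (y a t)) (V a i) t - f (clampv Rx (y b t)) (V a i) t|
          <= L * `|y a t - y b t|.
        apply: le_trans (fL _ _ _ _ _ _ _ _) _; rewrite ?clampv_norm //.
        by rewrite ler_wpM2l // clampv_dist.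
      have h2 : `|f (clampv Rx (y b t)) (V a i) t - f (clampv Rx (y b t)) (V b i) t|
          < eta / (2 * E * T).
        by apply: d1P; rewrite ?clampv_norm ?subrr ?normr0 //; exact: dP.
      have := ler_distD (f (clampv Rx (y b t)) (V a i) t)
        (f (clampv Rx (y a t)) (V a i) t) (f (clampv Rx (y b t)) (V b i) t).
      lra.
    * exists 1 => // s s' _ _ _ _; rewrite /phi; lra.
  + rewrite -tn0 ya0 yb0 subrr normr0 add0r /phi -/E tn0 mulr0 subr0.
    have -> : E * (eta / (2 * E * T) * T) = eta / 2.
      by field; rewrite (gt_eqF E0) (gt_eqF T0).
    lra.
- move=> a i a1 ai; have := est a (y a) a1 (yP a).
  move=> /(le_trans (le_rv_norm _ i)); rewrite !mxE ai mulr1 ler_norml; lra.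
- move=> a i a1 ai; have := est a (y a) a1 (yP a).
  move=> /(le_trans (le_rv_norm _ i)); rewrite !mxE ai mulrN1 ler_norml; lra.
Qed.

Section Partition.
Context (T : R) (s : seq R).
Let tn i := (0 :: s)`_i.

Lemma partition_end : itv_partition 0 T s -> tn (size s) = T.
Proof. by move=> ps; exact: (itv_partition_nth_size 0 ps). Qed.

Lemma partition_lt i : itv_partition 0 T s -> (i < size s)%N -> tn i < tn i.+1.
Proof. by move=> [/(pathP 0) H _] iN; exact: H. Qed.

Lemma partition_le i j : itv_partition 0 T s -> (i <= j)%N -> (j <= size s)%N ->
  tn i <= tn j.
Proof.
move=> ps; elim: j => [|j IHj]; first by rewrite leqn0 => /eqP->.
rewrite leq_eqVlt => /predU1P[->//|ij] jN.
by apply: le_trans (IHj ij (ltnW jN)) _; exact/ltW/partition_lt.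
Qed.

Lemma find_cell i t : itv_partition 0 T s -> (i < size s)%N ->
  tn i <= t < tn i.+1 -> find (fun r => t < r) s = i.
Proof.
move=> ps iN /andP[it ti]; apply/eqP; rewrite eqn_leq; apply/andP; split.
  rewrite leqNgt; apply/negP => /(before_find 0).
  by rewrite -[s`_i]/(tn i.+1) ti.
rewrite leqNgt; apply/negP => H.
have hs : has (fun r => t < r) s by rewrite has_find (ltn_trans H).
have := nth_find 0 hs; set k := find _ s in H *.
rewrite -[s`_k]/(tn k.+1) ltNge => /negP; apply.
by apply: le_trans it; apply: partition_le => //; exact: ltnW.
Qed.

Lemma le_mesh i : (i < size s)%N -> `|tn i.+1 - tn i| <= mesh s.
Proof.
move=> iN; rewrite /mesh.
exact: (le_bigmax _ (fun i : 'I_(size s) => `|tn i.+1 - tn i|) (Ordinal iN)).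
Qed.
End Partition.

(** If y stays in the box of radius Rx, the projection of the state disappears. *)
Lemma pc_reachable_of_solution f (T Rx Ru M : R) (s : seq R)
    (U : set 'rV[R]_m) (x0 : 'rV[R]_n) (V : nat -> 'rV[R]_m) y :
  0 < T -> itv_partition 0 T s -> (forall i, U (V i)) -> (forall i, `|V i| <= Ru) ->
  pc_solution f Rx M x0 (size s) (fun i => (0 :: s)`_i) V y ->
  (forall t, 0 <= t <= T -> `|y t| <= Rx) ->
  PC_reachable T x0 f U s (y T).
Proof.
move=> T0 ps UV VR [y0 yL yD] yR.
set tn := fun i => (0 :: s)`_i.
have tnN : tn (size s) = T by exact: partition_end.
have tnm i j : (i <= j)%N -> (j <= size s)%N -> tn i <= tn j.
  by move=> *; exact: (partition_le ps).
pose idx t := find (fun r => t < r) s.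
have idxE i t : (i < size s)%N -> tn i <= t < tn i.+1 -> idx t = i.
  by move=> *; exact: (find_cell ps).
pose v t := V (idx t).
have vR t : `|v t| <= Ru by exact: VR.
have vLinf : Linfty `[0, T] v.
  split; last first.
    by exists Ru; apply: aeW => t _; exact: vR.
  move=> j _ Y mY.
  have -> : `[0, T]%classic `&` (fun t : lebesgueR => v t 0 j) @^-1` Y =
    (\bigcup_(i in [set i : 'I_(size s) | Y (V i 0 j)])
      `[tn i, tn i.+1[%classic) `|` ([set T] `&` [set t | Y (v t 0 j)]) :> set R.
    apply/seteqP; split => t.
      move=> [/=]; rewrite in_itv /= => /andP[t0 tT] Yt.
      have [tT'|Tt] := ltP t T; last first.
        by right; split => //; apply/eqP; rewrite eq_le tT Tt.
      left; have [|i iN it] := @cell_of (size s) tn t; first by rewrite tnN tT' t0.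
      exists (Ordinal iN); last by rewrite /= in_itv.
      by rewrite /=; move: Yt; rewrite /v (idxE i).
    move=> [[i /= Yi]|[/= -> YT]]; last first.
      by split => //; rewrite /= in_itv /= lexx ltW.
    rewrite in_itv /= => it; split; last by rewrite /= /v (idxE i).
    rewrite /= in_itv /=; move: it => /andP[it ti]; apply/andP; split.
      by apply: le_trans it; rewrite -[0]/(tn 0%N); apply: tnm => //; exact: ltnW.
    apply: le_trans (ltW ti) _; rewrite -tnN; exact: tnm.
  apply: measurableU; last first.
    have [YT|YT] := pselect (Y (v T 0 j)).
      rewrite (_ : _ `&` _ = [set T]); first by apply: borel_lebesgueR; exact: measurable_set1.
      by apply/seteqP; split => t; [case|move=> /= ->].
    rewrite (_ : _ `&` _ = set0) //.
    by apply/seteqP; split => t // [/= ->].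
  apply: fin_bigcup_measurable => // i _; apply: borel_lebesgueR; exact: measurable_itv.
have ytraj : trajectory T x0 f v y.
  split; [exact: (@ac_lipschitz y M T yL)|exact: y0|].
  have cD : countable [set t : R | t \in 0 :: s].
    by apply: finite_set_countable; exact: finite_seq.
  exists [set t | t \in 0 :: s]; split.
  - apply: borel_lebesgueR; apply: countable_measurable => // t; exact: measurable_set1.
  - exact: (countable_lebesgue_measure0 cD).
  move=> t /= H; apply: contrapT => nt; apply: H; rewrite in_itv /= => tT.
  have [||i iN it] := @open_cell_of (size s) tn t.
  - by rewrite tnN.
  - by move=> [i ti]; apply: nt; rewrite ti; apply: mem_nth; rewrite /= ltn_ord.
  rewrite /v (idxE i) //; last by case/andP: it => /ltW-> ->.
  by have := yD i t iN it; rewrite clampv_id // yR.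
exists v; split; [by split => //; exists y| |by exists y].
move=> i iN; exists (V i); first exact: UV.
by move=> t it; rewrite /v (idxE i).
Qed.

End Hit.

(** * Needle intervals, cells and constants *)

Section CellWeight.
Context {R : realType}.

(** The proportion of the cell [s, t] that is covered by [b, b + l]. *)
Definition cell_weight (b l s t : R) : R := (ramp b l t - ramp b l s) / (t - s).

Lemma cell_weight_itv b l s t : s < t -> 0 <= cell_weight b l s t <= 1.
Proof.
move=> st; have ts : 0 < t - s by rewrite subr_gt0.
rewrite /cell_weight; apply/andP; split.
  by apply: divr_ge0; [rewrite subr_ge0; apply: ramp_homo|]; exact: ltW.
by rewrite ler_pdivrMr // mul1r ramp_lip // ltW.
Qed.

Lemma cell_weight0 b l s t : 0 <= l -> s <= t -> (t <= b) || (b + l <= s) ->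
  cell_weight b l s t = 0.
Proof.
move=> l0 st /orP[tb|bs]; rewrite /cell_weight.
  by rewrite !ramp0 ?subrr ?mul0r // (le_trans st).
by rewrite !ramp_end ?subrr ?mul0r // (le_trans bs).
Qed.

Lemma cell_weight1 b l s t : s < t -> b <= s -> t <= b + l ->
  cell_weight b l s t = 1.
Proof.
move=> st bs tb; rewrite /cell_weight !ramp_mid ?(le_trans (ltW st)) ?(le_trans bs (ltW st)) //.
by rewrite opprB addrA subrK divff // subr_eq0 gt_eqF.
Qed.

Lemma cell_weight_dist b l l' s t h : 0 < h -> h <= t - s ->
  `|cell_weight b l s t - cell_weight b l' s t| <= 2 / h * `|l - l'|.
Proof.
move=> h0 hts; have ts : 0 < t - s by exact: lt_le_trans hts.
rewrite /cell_weight -mulrBl normrM (ger0_norm (_ : 0 <= (t - s)^-1)); last first.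
  by rewrite invr_ge0 ltW.
rewrite ler_pdivrMr //.
apply: (@le_trans _ _ (2 * `|l - l'|)).
  have -> : ramp b l t - ramp b l s - (ramp b l' t - ramp b l' s) =
    (ramp b l t - ramp b l' t) - (ramp b l s - ramp b l' s) by ring.
  have := ler_normB (ramp b l t - ramp b l' t) (ramp b l s - ramp b l' s).
  by have := ramp_lip_len b l l' t; have := ramp_lip_len b l l' s; lra.
have : 1 <= h^-1 * (t - s) by rewrite mulrC ler_pdivlMr // mul1r.
have := normr_ge0 (l - l'); move: (`|l - l'|) (h^-1) => p q p0 H.
by have := ler_wpM2l p0 H; lra.
Qed.

End CellWeight.

Section Windows.
Context {R : realType} {n m : nat}.
Implicit Types (f : 'rV[R]_n -> 'rV[R]_m -> R -> 'rV[R]_n).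

Lemma velocity_quasi_unif_cont T f (U : set 'rV[R]_m) u x Rx Ru :
  C1_dynamics T f -> Linfty_in T U u -> ac 0 T x ->
  (forall t, 0 <= t <= T -> `|x t| <= Rx) ->
  ae_on `[0, T] (fun t => `|u t| <= Ru) ->
  quasi_unif_cont T (velocity f u x).
Proof.
move=> fC uU acx xR uR rho mu rho0 mu0.
have [d1 d10 d1P] := dynamics_unif_cont Rx Ru fC rho0.
have d12 : 0 < d1 / 2 by rewrite divr_gt0.
have [K [mK sK KT [d2 d20 d2P]]] := lusin_osc d12 mu0 uU uR.
have [d3 d30 d3P] := ac_unif acx d10.
have KT' t : K t -> 0 <= t <= T by move=> /KT[]; rewrite /= in_itv.
exists K; split; [exact: mK|exact: sK|by move=> t /KT[]|].
exists (Num.min d1 (Num.min d2 d3)); first by rewrite !lt_min d10 d20.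
move=> s t Ks Kt; rewrite !lt_min => /and3P[h1 h2 h3].
have [_ [_ us]] := KT s Ks; have [_ [_ ut]] := KT t Kt.
apply/ltW/d1P => //; rewrite ?xR ?KT' //.
  have := KT' s Ks; have := KT' t Kt => /andP[t0 tT] /andP[s0 sT].
  have [st|/ltW ts] := leP s t.
    by rewrite distrC; apply: d3P => //; move: h3; rewrite ltr_norml; lra.
  by apply: d3P => //; move: h3; rewrite ltr_norml; lra.
by apply: le_lt_trans (d2P s t Ks Kt h2) _; lra.
Qed.

(** Just after tau, the vector w is close to the velocity jump
    f (x t) o t - f (x t) (u t) t, except on a set of small density: all terms are
    continuous at tau except the velocity of u, for which tau is a Lebesgue
    point. *)
Lemma needle_window T f (U : set 'rV[R]_m) u x Rx Ru tau o w H eta kap :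
  C1_dynamics T f -> Linfty_in T U u -> ac 0 T x ->
  (forall t, 0 <= t <= T -> `|x t| <= Rx) ->
  ae_on `[0, T] (fun t => `|u t| <= Ru) -> `|o| <= Ru ->
  0 <= tau < T -> lebesgue_point T (velocity f u x) tau ->
  variation_vector T f u x tau o w -> 0 <= H -> 0 < eta -> 0 < kap ->
  exists2 e0, 0 < e0 & forall e, 0 < e -> e < e0 ->
    tau + H * e < T /\
    small_set 0 T (kap * e) [set t | tau <= t <= tau + H * e /\
      eta < `|f (x t) o t - f (x t) (u t) t - w t| ].
Proof.
move=> fC uU acx xR uR oR /andP[tau0 tauT] lp [acw w0 _] H0 eta0 kap0.
have qc := velocity_quasi_unif_cont fC uU acx xR uR.
have H10 : 0 < H + 1 by rewrite ltr_wpDl.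
pose et := Num.min (eta / 3) (kap / (H + 1)).
have et0 : 0 < et by rewrite lt_min !divr_gt0.
have [r0 r00 r0P] := lebesgue_point_small tau0 tauT lp qc et0.
have eta3 : 0 < eta / 3 by rewrite divr_gt0.
have [d1 d10 d1P] := dynamics_unif_cont Rx Ru fC eta3.
have [d2 d20 d2P] := ac_unif acx d10.
have [d3 d30 d3P] := ac_unif acw eta3.
have m0 : 0 < Num.min r0 (Num.min d1 (Num.min d2 (Num.min d3 (T - tau)))).
  by rewrite !lt_min r00 d10 d20 d30 subr_gt0.
exists (Num.min r0 (Num.min d1 (Num.min d2 (Num.min d3 (T - tau)))) / (H + 1)).
  by rewrite divr_gt0.
move=> e e0; rewrite ltr_pdivlMr // !lt_min => /and5P[er e1 e2 e3 eT].
have He : H * e < e * (H + 1) by lra.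
split; first by move: He eT; clear; lra.
have r1 : 0 < e * (H + 1) by rewrite mulr_gt0.
apply: small_setW _ (small_set_subset _ (r0P _ r1 er)).
  have : et <= kap / (H + 1) by rewrite /et ge_min lexx orbT.
  by rewrite ler_pdivlMr // => /(ler_wpM2r (ltW e0)); clear; lra.
move=> t [/andP[taut tH] big].
have tT : t <= T by move: tH He eT; clear; lra.
have tT' : 0 <= t <= T by rewrite (le_trans tau0 taut) tT.
have tauT' : 0 <= tau <= T by rewrite tau0 ltW.
have tt : `|tau - t| < e * (H + 1).
  by rewrite distrC ger0_norm ?subr_ge0 //; move: tH He; clear; lra.
split; first exact: tt.
split => //.
have tt' : t - tau < e * (H + 1).
  by apply: le_lt_trans tt; rewrite distrC ler_norm.
have xt : `|x t - x tau| < d1 by apply: d2P => //; exact: lt_trans tt' e2.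
have wt : `|w t - w tau| < eta / 3 by apply: d3P => //; exact: lt_trans tt' e3.
have ft : `|f (x t) o t - f (x tau) o tau| < eta / 3.
  apply: d1P => //; rewrite ?xR ?subrr ?normr0 //.
  by rewrite distrC; exact: lt_trans tt e1.
rewrite ltNge; apply/negP => small; move: big; apply/negP; rewrite -leNgt.
have et3 : et <= eta / 3 by rewrite /et ge_min lexx.
have -> : f (x t) o t - f (x t) (u t) t - w t =
   (f (x t) o t - f (x tau) o tau) - (velocity f u x t - velocity f u x tau) - (w t - w tau).
  by rewrite w0 /velocity; apply/rowP => i; rewrite !mxE; ring.
have := ler_normB (f (x t) o t - f (x tau) o tau -
  (velocity f u x t - velocity f u x tau)) (w t - w tau).
have := ler_normB (f (x t) o t - f (x tau) o tau) (velocity f u x t - velocity f u x tau).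
by move: small et3 ft wt; clear; lra.
Qed.

End Windows.

Section Slots.
Context {R : realType} {J : finType}.

(** A bound, in units of e, on the time after tau j in which all needles attached
    to the time tau j take place. *)
Definition slot_width (C : R) : R := (C + 1) * #|J|%:R.

(** Needles attached to the same time must not overlap: each is given a slot of
    length e * (C + 1), of which it occupies at most e * C. *)
Definition slot_start (tau : J -> R) (C e : R) (j : J) : R :=
  tau j + e * ((C + 1) * (enum_rank j : nat)%:R).

Lemma slot_bounds (tau l : J -> R) (C e : R) j : 0 <= C -> 0 < e ->
  l j <= e * C -> tau j <= slot_start tau C e j /\
  slot_start tau C e j + l j <= tau j + slot_width C * e.
Proof.
move=> C0 e0 lC; have C10 : 0 <= C + 1 by rewrite addr_ge0.
split; first by rewrite /slot_start lerDl !mulr_ge0 // ltW.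
have rk : (enum_rank j : nat)%:R + 1 <= #|J|%:R :> R by rewrite natr1 ler_nat ltn_ord.
have := ler_wpM2l (ltW e0) (ler_wpM2l C10 rk).
by rewrite /slot_start /slot_width; move: lC e0; clear; lra.
Qed.

Lemma slot_sep (tau l : J -> R) (C e : R) : 0 <= C -> 0 < e ->
  (forall j, l j <= e * C) ->
  (forall j j', tau j < tau j' -> (slot_width C + 1) * e < tau j' - tau j) ->
  forall j j', j' != j -> slot_start tau C e j' + l j' < slot_start tau C e j \/
    slot_start tau C e j + l j < slot_start tau C e j'.
Proof.
move=> C0 e0 lC sep.
have main i i' : (tau i < tau i' \/
    tau i = tau i' /\ (enum_rank i < enum_rank i')%N) ->
    slot_start tau C e i + l i < slot_start tau C e i'.
  move=> [tt|[tt rr]].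
    have [_ h1] := slot_bounds tau C0 e0 (lC i).
    have [h2 _] := slot_bounds tau C0 e0 (lC i').
    by have := sep _ _ tt; move: h1 h2 e0; clear; lra.
  have C10 : 0 <= C + 1 by rewrite addr_ge0.
  have : (enum_rank i : nat)%:R + 1 <= (enum_rank i' : nat)%:R :> R.
    by rewrite natr1 ler_nat.
  move=> /(ler_wpM2l C10)/(ler_wpM2l (ltW e0)).
  by have := lC i; rewrite /slot_start tt; move: e0; clear; lra.
move=> j j' jj; have [tt|tt|tt] := ltgtP (tau j) (tau j').
- by right; apply: main; left.
- by left; apply: main; left.
have : enum_rank j' != enum_rank j :> nat.
  by apply: contraNneq jj => /val_inj/enum_rank_inj->.
by rewrite neq_ltn => /orP[rr|rr]; [left|right]; apply: main; right.
Qed.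

Lemma near_ends_small_set (a b del : R) (p q : J -> R) : 0 <= del ->
  small_set a b (8 * del * #|J|%:R) [set t | exists j,
    p j - 2 * del < t < p j + 2 * del \/ q j - 2 * del < t < q j + 2 * del].
Proof.
move=> del0.
have ii r : small_set a b (4 * del) `]r - 2 * del, r + 2 * del[.
  have rr : r - 2 * del <= r + 2 * del by move: del0; clear; lra.
  by apply: small_setW _ (small_set_itv a b rr); clear; lra.
have -> : 8 * del * #|J|%:R = \sum_(j : J) (4 * del + 4 * del).
  by rewrite sumr_const -[RHS]mulr_natr; congr (_ * _); ring.
apply: small_set_bigU => j.
apply: small_set_subset (small_setU (ii (p j)) (ii (q j))).
by move=> t [?|?]; [left|right]; rewrite /= in_itv.
Qed.

End Slots.

Section Cells.
Context {R : realType}.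
Implicit Types (s t b l del : R).

Lemma cell_outside s s' t b l del : 0 <= l -> s < t < s' -> s' - s <= del ->
  ~ (b - 2 * del < t < b + 2 * del \/ b + l - 2 * del < t < b + l + 2 * del) ->
  ~ (b < t < b + l) -> (s' <= b) || (b + l <= s).
Proof.
move=> l0 /andP[st ts'] ss' nn nb.
have [h1|h1] := leP t (b - 2 * del).
  by apply/orP; left; move: h1 st ts' ss'; clear; lra.
apply/orP; right.
have [h2|h2] := leP (b + l + 2 * del) t; first by move: h2 st ts' ss'; clear; lra.
have h3 : b + 2 * del <= t.
  by rewrite leNgt; apply/negP => h3; apply: nn; left; rewrite h1.
have h4 : t <= b + l - 2 * del.
  by rewrite leNgt; apply/negP => h4; apply: nn; right; rewrite h4.
by case: nb; apply/andP; split; move: h3 h4 st ts' ss'; clear; lra.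
Qed.

Lemma cell_inside s s' t b l del : s < t < s' -> s' - s <= del ->
  ~ (b - 2 * del < t < b + 2 * del \/ b + l - 2 * del < t < b + l + 2 * del) ->
  b < t < b + l -> b <= s /\ s' <= b + l.
Proof.
move=> /andP[st ts'] ss' nn /andP[bt tl].
have h3 : b + 2 * del <= t.
  rewrite leNgt; apply/negP => h3; apply: nn; left; rewrite h3 andbT.
  by move: bt st ts' ss'; clear; lra.
have h4 : t <= b + l - 2 * del.
  rewrite leNgt; apply/negP => h4; apply: nn; right; rewrite h4 /=.
  by move: tl st ts' ss'; clear; lra.
by split; move: h3 h4 st ts' ss'; clear; lra.
Qed.

End Cells.

Section Budget.
Context {R : realType}.

(** Together with [error_cst], the coefficients of the bounds of [needle_estimate]
    when the total length of the needles is at most A * e and every error is at most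
    eta * e. *)
Definition deviation_cst (T M A E : R) : R := E * (T + 2 * M * A + 2 * M).

Definition error_cst (T M L W A P E : R) : R :=
  E * ((deviation_cst T M A E + 1) * T +
       (L * deviation_cst T M A E + 1 + L * (W * A)) * A +
       (2 * M + P * W + L * (W * A))).

Lemma deviation_cst_ge0 (T M A E : R) : 0 <= T -> 0 <= M -> 0 <= A -> 0 <= E ->
  0 <= deviation_cst T M A E.
Proof. by move=> *; rewrite /deviation_cst !(mulr_ge0, addr_ge0). Qed.

Lemma error_cst_ge0 (T M L W A P E : R) : 0 <= T -> 0 <= M -> 0 <= L ->
  0 <= W -> 0 <= A -> 0 <= P -> 0 <= E -> 0 <= error_cst T M L W A P E.
Proof.
move=> T0 M0 L0 W0 A0 P0 E0; have Z0 := deviation_cst_ge0 T0 M0 A0 E0.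
by rewrite /error_cst !(mulr_ge0, addr_ge0).
Qed.

Lemma deviation_le (T M A E eta e S : R) : 0 <= T -> 0 <= M -> 0 <= E ->
  0 <= e -> eta <= 1 -> S <= A * e ->
  E * (eta * e * T + 2 * M * S + 2 * M * (eta * e)) <= deviation_cst T M A E * e.
Proof.
move=> T0 M0 E0 e0 eta1 SA; rewrite /deviation_cst -[X in _ <= X]mulrA; apply: ler_wpM2l => //.
have h1 : eta * e <= e by rewrite ler_piMl.
have M20 : 0 <= 2 * M by rewrite mulr_ge0.
have := ler_wpM2r T0 h1; have := ler_wpM2l M20 SA; have := ler_wpM2l M20 h1.
by clear; lra.
Qed.

Lemma error_le (T M L W A P E eta e S Z : R) : 0 <= T -> 0 <= M -> 0 <= L ->
  0 <= W -> 0 <= A -> 0 <= P -> 0 <= E -> 0 <= e -> e <= eta -> eta <= 1 ->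
  0 <= S -> S <= A * e -> 0 <= Z -> Z <= deviation_cst T M A E * e ->
  E * ((eta * Z + eta * e) * T + (L * Z + eta + L * (W * S)) * S +
     (2 * M + P * W + L * (W * S)) * (eta * e)) <=
  eta * e * error_cst T M L W A P E.
Proof.
move=> T0 M0 L0 W0 A0 P0 E0 e0 eeta eta1 S0 SA Z0 ZZ.
have eta0 : 0 <= eta by exact: le_trans eeta.
have ee0 : 0 <= eta * e by exact: mulr_ge0.
have D0 := deviation_cst_ge0 T0 M0 A0 E0.
rewrite /error_cst [X in _ <= X]mulrCA; apply: ler_wpM2l => //.
set D := deviation_cst T M A E in ZZ D0 *.
have h1 : (eta * Z + eta * e) * T <= eta * e * ((D + 1) * T).
  by have := ler_wpM2r T0 (ler_wpM2l eta0 ZZ); clear; lra.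
have q1 : Z <= eta * D by apply: le_trans ZZ _; rewrite mulrC ler_wpM2r.
have SAe : S <= A * eta by apply: le_trans SA _; rewrite ler_wpM2l.
have q2 : W * S <= eta * (W * A).
  by have := ler_wpM2l W0 SAe; clear; lra.
have h2 : L * Z + eta + L * (W * S) <= eta * (L * D + 1 + L * (W * A)).
  by have := ler_wpM2l L0 q1; have := ler_wpM2l L0 q2; clear; lra.
have WS0 : 0 <= L * (W * S) by rewrite !mulr_ge0.
have h3 : (L * Z + eta + L * (W * S)) * S <= eta * e * ((L * D + 1 + L * (W * A)) * A).
  have B0 : 0 <= L * Z + eta + L * (W * S).
    by rewrite addr_ge0 // addr_ge0 // mulr_ge0.
  by have := ler_pM B0 S0 h2 SA; clear; lra.
have SA1 : S <= A by apply: le_trans SAe _; rewrite ler_piMr.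
have h4 : (2 * M + P * W + L * (W * S)) * (eta * e) <=
    eta * e * (2 * M + P * W + L * (W * A)).
  by rewrite mulrC ler_wpM2l // lerD2l ler_wpM2l // ler_wpM2l.
by move: h1 h3 h4; clear; lra.
Qed.

End Budget.

(** * Reachability under sampling *)

Theorem theorem1 (R : realType) (n m : nat) (n_ge1 : (1 <= n)%N)
    (m_ge1 : (1 <= m)%N) (T : R) (T_gt0 : 0 < T) (x0 : 'rV[R]_n)
    (U : set 'rV[R]_m) (U_neq0 : U !=set0)
    (f : 'rV[R]_n -> 'rV[R]_m -> R -> 'rV[R]_n) (f_C1 : C1_dynamics T f)
    (U_convex : convex_set U) (x1 : 'rV[R]_n)
    (u : R -> 'rV[R]_m) (u_Linfty : Linfty_in T U u)
    (x : R -> 'rV[R]_n) (x_traj : trajectory T x0 f u x) (x_T : x T = x1)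
    (u_regular : weakly_regular T f U u x) :
  exists2 delta : R, 0 < delta &
    forall s : seq R, itv_partition 0 T s -> mesh s <= delta ->
      PC_reachable T x0 f U s x1.
Proof.
have [acx xx0 xD] := x_traj.
have [J [tau [ om [w [c [C [nd [C0 c0] cL c00 cw]]]]]]] := regular_needles u_regular.
have [ o0 Uo0] := U_neq0.
have T0 : 0 <= T := ltW T_gt0.
have [Mx Mx0 xM] := ac_bounded T0 acx.
have [[_ [Mu uMu]] _] := u_Linfty.
pose Ru := `|Mu| + `|o0| + \sum_j `|om j|.
have omS0 : 0 <= \sum_j `|om j| by exact: sumr_ge0.
have o0R : `|o0| <= Ru.
  by rewrite /Ru; have := normr_ge0 Mu; move: omS0; clear; lra.
have omR j : `|om j| <= Ru.
  have : `|om j| <= \sum_j `|om j| by rewrite (bigD1 j) //= lerDl sumr_ge0.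
  by rewrite /Ru; have := normr_ge0 Mu; have := normr_ge0 o0; lra.
have uR : ae_on `[0, T] (fun t => `|u t| <= Ru).
  apply: ae_onW uMu => t /le_trans; apply; rewrite /Ru.
  by have := ler_norm Mu; have := normr_ge0 o0; lra.
pose Rx := Mx + 1.
have Rx0 : 0 <= Rx by rewrite /Rx addr_ge0 // ltW.
have xR t : 0 <= t <= T -> `|x t| <= Rx - 1.
  by move=> /andP[? ?]; rewrite /Rx addrK xM.
have xR' t : 0 <= t <= T -> `|x t| <= Rx by move=> /xR; clear; lra.
have [M M0 fM] := dynamics_bounded Rx Ru f_C1.
have [L L0' [fL fJ]] := dynamics_lipschitz Rx Ru f_C1.
have L0 := ltW L0'.
have acw j : ac (tau j) T (w j) by have [_ _ _ []] := nd j.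
have /choice[Wj WjP] : forall j, exists W, 0 < W /\
    forall t, tau j <= t <= T -> `|w j t| <= W.
  move=> j; have [/andP[_ tT] _ _ _] := nd j.
  have [W W0 wW] := ac_bounded (ltW tT) (acw j); exists W; split => // t /andP[? ?].
  exact: wW.
pose W := \sum_j Wj j.
have Wj0 j : 0 <= Wj j by have [/ltW] := WjP j.
have W0 : 0 <= W by exact: sumr_ge0.
have wW j t : tau j <= t <= T -> `|w j t| <= W.
  move=> tt; have [_ /(_ t tt)] := WjP j; move/le_trans; apply.
  by rewrite /W (bigD1 j) //= lerDl sumr_ge0.
pose P : R := #|J|%:R.
have P0 : 0 <= P by exact: ler0n.
have P10 : 0 < P + 1 by rewrite ltr_wpDl.
pose E := expR (L * T).
have E0 : 0 < E by exact: expR_gt0.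
pose A := P * C.
have A0 : 0 <= A by exact: mulr_ge0.
have M0' := ltW M0.
pose Z1 := deviation_cst T M A E.
have Z10 : 0 <= Z1 by exact: deviation_cst_ge0 (ltW E0).
pose Q := error_cst T M L W A P E.
have Q0 : 0 <= Q by exact: error_cst_ge0 (ltW E0).
pose eta : R := (2 * (Q + 1))^-1.
have eta0 : 0 < eta by rewrite invr_gt0 mulr_gt0 // ltr_wpDl.
have eta1 : eta <= 1.
  by rewrite invf_le1 ?mulr_gt0 ?ltr_wpDl //; move: Q0; clear; lra.
have etaQ : eta * Q <= 1 / 2.
  have Q2 : 0 < 2 * (Q + 1) by rewrite mulr_gt0 // ltr_wpDl.
  by rewrite /eta ler_pdivrMl //; move: Q0; clear; lra.
have [dx dx0 fE] := dynamics_expansion Rx Ru f_C1 eta0.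
pose H := slot_width (J := J) C.
have H0 : 0 <= H by rewrite mulr_ge0 // addr_ge0.
pose kap := eta / (4 * (P + 1)).
have kap0 : 0 < kap by rewrite divr_gt0 // mulr_gt0.
have /choice[ew ewP] : forall j, exists e0, 0 < e0 /\ forall e, 0 < e -> e < e0 ->
    tau j + H * e < T /\
    small_set 0 T (kap * e) [set t | tau j <= t <= tau j + H * e /\
      eta < `|f (x t) (om j) t - f (x t) (u t) t - w j t| ].
  move=> j; have [tT lp _ vw] := nd j.
  have [e0 e00 eP] := needle_window f_C1 u_Linfty acx xR' uR (omR j) tT lp vw H0 eta0 kap0.
  by exists e0.
(* The scale e of the needles: the deviation Z1 * e keeps y in the region where
   f is well approximated, the Lebesgue point estimates apply, and needles
   attached to different times do not meet. *)
have [e [e0 eeta eZ ew' esep]] : exists e, [/\ 0 < e, e < eta,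
    (Z1 + 1) * e < Num.min 1 dx, forall j, e < ew j &
    forall j j', tau j < tau j' -> (H + 1) * e < tau j' - tau j].
  near (0 : R)^'+ => e; exists e; split.
  - by near: e; exact: nbhs_right_gt.
  - by near: e; exact: nbhs_right_lt.
  - rewrite mulrC -ltr_pdivlMr ?ltr_wpDl //; near: e; apply: nbhs_right_lt.
    by rewrite divr_gt0 ?ltr_wpDl // lt_min ltr01.
  - near: e; apply: filter_forall => j; apply: nbhs_right_lt.
    by have [] := ewP j.
  - near: e; apply: filter_forall => j; apply: filter_forall => j'.
    have [tt|tt] := ltP (tau j) (tau j'); last by apply: nearW.
    have H10 : 0 < H + 1 by rewrite ltr_wpDl.
    have : 0 < (tau j' - tau j) / (H + 1) by rewrite divr_gt0 ?subr_gt0.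
    move=> /nbhs_right_lt; apply: filterS => r /= + _.
    by rewrite ltr_pdivlMr // mulrC.
have ee0 : 0 < eta * e by rewrite mulr_gt0.
have ee4 : 0 < eta * e / 4 by rewrite divr_gt0.
have [du du0 fU] := dynamics_unif_cont Rx Ru f_C1 ee0.
(* From here on e is fixed, and errors caused by sampling must be small
   compared with e. *)
pose rho := Num.min du dx / 2.
have rho0 : 0 < rho by rewrite divr_gt0 // lt_min du0.
have rhou : rho < du.
  by rewrite /rho ltr_pdivrMr // gt_min; apply/orP; left; move: du0; clear; lra.
have rhox : rho < dx.
  by rewrite /rho ltr_pdivrMr // gt_min; apply/orP; right; move: dx0; clear; lra.
have [K [mK sK KT [dk dk0 dkP]]] := lusin_osc rho0 ee4 u_Linfty uR.
pose del := Num.min dk (Num.min (eta * e / (32 * (P + 1))) (1 / (2 * L))).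
have del0 : 0 < del.
  by rewrite !lt_min dk0 !divr_gt0 // mulr_gt0.
have deldk : del <= dk by rewrite /del ge_min lexx.
have delB : 8 * del * P <= eta * e / 4.
  have : del <= eta * e / (32 * (P + 1)) by rewrite /del !ge_min lexx orbT.
  rewrite ler_pdivlMr ?mulr_gt0 // => h.
  by have := mulr_ge0 (ltW del0) P0; move: h del0; clear; lra.
have delL : L * del <= 1 / 2.
  have : del <= 1 / (2 * L) by rewrite /del !ge_min lexx !orbT.
  by rewrite ler_pdivlMr ?mulr_gt0 //; clear; lra.
exists del => // s ps ms.
pose tn i := (0 :: s)`_i; pose N := size s.
have tnN : tn N = T by exact: partition_end.
have tnS i : (i < N)%N -> tn i < tn i.+1 by move=> iN; exact: (partition_lt ps).
have tnd i : (i < N)%N -> tn i.+1 - tn i <= del.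
  by move=> iN; apply: le_trans ms; apply: le_trans (le_mesh iN); exact: ler_norm.
have tnT i t : (i < N)%N -> tn i <= t <= tn i.+1 -> 0 <= t <= T.
  move=> iN /andP[it ti]; apply/andP; split.
    by apply: le_trans it; rewrite -[0]/(tn 0%N); apply: (partition_le ps) => //; exact: ltnW.
  by apply: le_trans ti _; rewrite -tnN; exact: (partition_le ps).
(* The sampled control: a value of u at a point of K in the cell, if any. *)
have /choice[v0 v0P] : forall i, exists o, [/\ U o, `|o| <= Ru &
    (i < N)%N -> forall t, tn i < t < tn i.+1 -> K t -> `|o - u t| <= rho].
  move=> i; have [[r [/andP[ir ri] Kr]]|nK] := pselect (exists r, tn i < r < tn i.+1 /\ K r).
    have [_ [Ur ur]] := KT r Kr; exists (u r); split => // iN t /andP[it ti] Kt.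
    apply: dkP => //; apply: lt_le_trans deldk.
    by rewrite ltr_norml; have := tnd i iN; move: ir ri it ti; clear; lra.
  by exists o0; split => // iN t it Kt; case: nK; exists t.
pose b := slot_start tau C e.
pose l j a := e * c j a.
pose th a i j := cell_weight (b j) (l j a) (tn i) (tn i.+1).
(* Indices beyond the last cell get the default value o0, so that V is bounded
   and U-valued without conditions. *)
pose V a i := if (i < N)%N then mix (enum J) (th a i) om (v0 i) else o0.
have th01 a i j : (i < N)%N -> 0 <= th a i j <= 1.
  by move=> iN; apply: cell_weight_itv; exact: tnS.
have VR a i : `|V a i| <= Ru.
  rewrite /V; case: ifP => // iN; apply: mix_norm => //; first by case: (v0P i).
  by move=> j; exact: th01.
have VU a i : U (V a i).
  rewrite /V; case: ifP => // iN; apply: mix_convex => //; first by case: (v0P i).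
    by move=> j; have [] := nd j.
  by move=> j; exact: th01.
have l0 j a : 0 <= l j a by rewrite mulr_ge0 // ltW.
have Ru0 : 0 <= Ru by exact: le_trans o0R.
have [h h0 hP] : exists2 h, 0 < h & forall i, (i < N)%N -> h <= tn i.+1 - tn i.
  rewrite /N; elim: {1 3}(size s) (leqnn (size s)) => [|k IH] kN; first by exists 1.
  have [h h0 hP] := IH (ltnW kN).
  exists (Num.min h (tn k.+1 - tn k)); first by rewrite lt_min h0 subr_gt0 tnS.
  move=> i; rewrite ltnS leq_eqVlt => /predU1P[->|ik]; first by rewrite ge_min lexx orbT.
  by apply: le_trans (hP i ik); rewrite ge_min lexx.
have Vc a q : 0 < q -> exists2 d, 0 < d & forall a', `|a - a'| < d ->
    forall i, (i < N)%N -> `|V a i - V a' i| < q.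
  move=> q0; pose G := 2 * Ru * (P * (2 / h * (e * C))) + 1.
  have G0 : 0 < G.
    rewrite ltr_wpDl // !mulr_ge0 // ?(ltW e0) // invr_ge0 ltW //.
  exists (q / G); first by rewrite divr_gt0.
  move=> a'; rewrite ltr_pdivlMr // => aa i iN; rewrite /V iN.
  have [_ v0R _] := v0P i.
  apply: le_lt_trans (mix_dist _ v0R omR (fun j => th01 a i j iN) (fun j => th01 a' i j iN)) _.
  apply: le_lt_trans aa.
  have : \sum_(j <- enum J) `|th a i j - th a' i j| <= P * (2 / h * (e * C)) * `|a - a'|.
    rewrite big_enum /= /P -sum1_card natr_sum !mulr_suml; apply: ler_sum => j _.
    apply: le_trans (cell_weight_dist _ _ _ h0 (hP i iN)) _.
    rewrite mul1r -[X in _ <= X]mulrA; apply: ler_wpM2l; first by rewrite divr_ge0 // ltW.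
    rewrite /l -mulrBr normrM (ger0_norm (ltW e0)) -mulrA; apply: ler_wpM2l; last exact: cL.
    exact: ltW.
  move=> /(ler_wpM2l (mulr_ge0 (ler0n R 2) Ru0)); have := normr_ge0 (a - a').
  by rewrite /G; clear; lra.
have lC j a : `|a| <= 1 -> l j a <= e * C.
  move=> a1; rewrite ler_pM2l //; have := cL j a 0.
  rewrite c00 !subr0 (ger0_norm (c0 j a)) => /le_trans; apply.
  exact: ler_piMr.
have bT j a : `|a| <= 1 -> [/\ 0 <= tau j, tau j <= b j &
    b j + l j a <= tau j + H * e].
  move=> a1; have [/andP[t0 _] _ _ _] := nd j.
  by have [h1 h2] := slot_bounds tau (l := l ^~ a) C0 e0 (lC j a a1).
have bsep j j' a : `|a| <= 1 -> j' != j -> b j' + l j' a < b j \/ b j + l j a < b j'.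
  by move=> a1; apply: (slot_sep (l := l ^~ a) C0 e0 (fun j => lC j a a1)).
have est a y : `|a| <= 1 -> pc_solution f Rx M x0 N tn (V a) y ->
    (forall t, 0 <= t <= T -> `|y t| <= Rx) /\ `|y T - x1 - e *: a| <= e / 2.
  move=> a1 [y0 yL yD].
  pose v t := V a (find (fun r => t < r) s).
  (* Outside these neighbourhoods the cell of t lies either inside or outside each
     needle. *)
  pose near_end t := exists j, (b j - 2 * del < t < b j + 2 * del) \/
    (b j + l j a - 2 * del < t < b j + l j a + 2 * del).
  pose bad t := exists j, tau j <= t <= tau j + H * e /\
      eta < `|f (x t) (om j) t - f (x t) (u t) t - w j t|.
  pose B : set R := (`[0, T] `\` K) `|` ([set t | near_end t] `|` [set t | bad t]).
  have sB : small_set 0 T (eta * e) B.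
    have s1 := near_ends_small_set 0 T b (fun j => b j + l j a) (ltW del0).
    have s2 j : small_set 0 T (kap * e) [set t | tau j <= t <= tau j + H * e /\
        eta < `|f (x t) (om j) t - f (x t) (u t) t - w j t| ].
      by have [_ /(_ e e0 (ew' j))[_ ?]] := ewP j.
    apply: small_setW _ (small_setU sK (small_setU s1 (small_set_bigU s2))).
    rewrite sumr_const -(mulr_natl (kap * e)) -/P.
    have : P * (kap * e) <= eta * e / 4.
      have -> : eta * e / 4 = (P + 1) * (kap * e).
        by rewrite /kap; move: (gt_eqF P10); clear; move=> P1; field; rewrite P1.
      by rewrite ler_wpM2r ?lerDl // mulr_ge0 // ltW.
    by move: delB ee0; clear; lra.
  have cellP t : 0 <= t <= T -> ~ nodes N tn t -> exists i, [/\ (i < N)%N,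
      tn i < t < tn i.+1 & v t = mix (enum J) (th a i) om (v0 i)].
    move=> tT nt; have [|i iN it] := open_cell_of (tn := tn) (N := N) _ nt.
      by rewrite tnN.
    exists i; split => //; rewrite /v (find_cell ps iN) ?/V ?iN //.
    by case/andP: it => /ltW-> ->.
  pose S := \sum_j l j a.
  have S0 : 0 <= S by exact: sumr_ge0.
  have SP : S <= A * e.
    rewrite /S /A /P -sum1_card natr_sum !mulr_suml; apply: ler_sum => j _.
    by rewrite mul1r [X in _ <= X]mulrC; exact: lC.
  pose Z := E * (eta * e * T + 2 * M * S + 2 * M * (eta * e)).
  have ZZ : Z <= Z1 * e by exact: deviation_le (ltW E0) (ltW e0) eta1 SP.
  have Zmin : Z < Num.min 1 dx.
    apply: le_lt_trans eZ; apply: le_trans ZZ _.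
    by rewrite mulrDl lerDl mul1r ltW.
  have [Z1' Zdx] : Z <= 1 /\ Z < dx by move: Zmin; rewrite lt_min => /andP[/ltW].
  have := @needle_estimate R n m T f x y u v J tau b (l ^~ a) om w B (nodes N tn)
    Rx Ru M L W eta (eta * e) (eta * e) dx.
  rewrite -/E -/S -/Z => /(_ _ fM fL fJ fE acx xR xD uR yL) NE.
  have [||||||||||||||yx yT] := NE.
  - by split => //; exact: ltW.
  - by rewrite xx0 -[0]/(tn 0%N).
  - exact: thin_set_pts.
  - move=> t tT nt; have [i [iN it vt]] := cellP t tT nt.
    by rewrite vt; have := yD i t iN it; rewrite /V iN.
  - by move=> t; exact: VR.
  - move=> j; have [h1 h2 h4] := bT j a a1.
    have [_ /(_ e e0 (ew' j))[h5 _]] := ewP j.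
    by split=> //; exact: le_trans h4 (ltW h5).
  - exact: acw.
  - exact: wW.
  - by move=> j; have [_ _ _ []] := nd j.
  - exact: sB.
  - move=> t tT Bt nt nb; have [i [iN it vt]] := cellP t tT nt.
    have Kt : K t.
      by apply: contrapT => nK; apply: Bt; left; split => //; rewrite /= in_itv.
    have [_ [_ ut]] := KT t Kt.
    have -> : v t = v0 i.
      rewrite vt mix0 // => j _; apply: cell_weight0 => //; first exact/ltW/tnS.
      apply: (cell_outside (l0 j a) it (tnd i iN) _ (nb j)) => near_t.
      by apply: Bt; right; left; exists j.
    have [_ v0R v0K] := v0P i.
    have vu : `|v0 i - u t| <= rho by exact: v0K.
    split; last exact: le_lt_trans rhox.
    apply/ltW/fU; rewrite ?xR' ?subrr ?normr0 //.
    exact: le_lt_trans rhou.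
  - move=> t j tT Bt nt bj; have [i [iN it vt]] := cellP t tT nt.
    have [|cell1 cell2] := cell_inside it (tnd i iN) _ bj.
      by move=> near_t; apply: Bt; right; left; exists j.
    have [_ h2 h4] := bT j a a1; have /andP[b1 b2] := bj.
    split.
    + rewrite vt (@mix1 _ _ _ _ _ _ _ j) ?enum_uniq ?mem_enum //.
        by apply: cell_weight1 => //; exact: tnS.
      move=> j' jj; apply: cell_weight0 => //; first exact/ltW/tnS.
      apply/orP; case: (bsep j j' a a1 jj) => bb; [right|left].
        exact: le_trans (ltW bb) cell1.
      exact: le_trans cell2 (ltW bb).
    + rewrite leNgt; apply/negP => H'; apply: Bt; right; right; exists j; split => //.
      by rewrite (le_trans h2 (ltW b1)) (le_trans (ltW b2) h4).
    + move=> j' jj /andP[b3 b4]; case: (bsep j j' a a1 jj) => bb.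
        by move: (lt_trans (lt_trans b4 bb) b1); rewrite ltxx.
      by move: (lt_trans (lt_trans b2 bb) b3); rewrite ltxx.
  - exact: Z1'.
  - exact: Zdx.
  have yR t : 0 <= t <= T -> `|y t| <= Rx.
    move=> tT; have := ler_normD (y t - x t) (x t); rewrite subrK.
    by have := le_trans (yx t tT) Z1'; have := xR t tT; clear; lra.
  split => //.
  have -> : e *: a = \sum_j l j a *: w j T.
    by rewrite -{1}[a]cw scaler_sumr; apply: eq_bigr => j _; rewrite scalerA.
  rewrite -x_T; apply: (le_trans yT).
  have Z0 : 0 <= Z by apply: le_trans (yx 0 _) => //; rewrite lexx.
  apply: (@le_trans _ _ (eta * e * Q)).
    exact: error_le (ltW E0) (ltW e0) (ltW eeta) eta1 S0 SP Z0 ZZ.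
  by have := ler_wpM2l (ltW e0) etaQ; clear; lra.
have [a [y [a1 ysol yT]]] : exists a y, [/\ `|a| <= 1,
    pc_solution f Rx M x0 N tn (V a) y & y T = x1].
  apply: (pc_hits f_C1 T_gt0 Rx0 L0 e0 fM fL _ tnN _ VR Vc) => //.
    move=> i iN; split; first exact/ltW/tnS.
    by apply: le_trans delL; rewrite ler_wpM2l // tnd.
  by move=> a y a1 /(est a y a1)[].
rewrite -yT; have [yR _] := est a y a1 ysol.
exact: (pc_reachable_of_solution T_gt0 ps (VU a) (VR a) ysol yR).
Unshelve. all: by end_near. Qed.
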